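(* Let $\mathbb X=(X,\tau,\mathsf d,\mathfrak m)$ be an extended metric-topological measure space. If $(X,\tau)$ is compact and $\mathscr A\subset\mathrm{Lip}_b(X,\tau,\mathsf d)$ is an algebra compatible with $\mathbb X$, then $H^{1,p}(\mathbb X)=H^{1,p}(\mathbb X,\mathscr A)$ with equal minimal relaxed gradients (and therefore equal Cheeger energies). Equivalently, for every $f\in H^{1,p}(\mathbb X)$ there exists a sequence $f_n\in\mathscr A$ such that $$f_n\to f,\qquad \mathrm{lip}f_n\to|\mathrm Df|_\star\qquad\text{strongly in }L^p(X,\mathfrak m).$$
   Context: $p\in(1,\infty)$ is fixed. An extended distance on $X$ is a symmetric map $\mathsf d:X\times X\to[0,\infty]$ satisfying the triangle inequality, with $\mathsf d(x,y)=0$ iff $x=y$. For $f:X\to\mathbb R$ and $A\subset X$, $\mathrm{Lip}(f,A,\mathsf d)=\inf\{L\in[0,\infty]:|f(y)-f(z)|\le L\,\mathsf d(y,z)\ \forall y,z\in A\}$. For a Hausdorff space $(X,\tau)$, $C_b(X)$ is the space of bounded $\tau$-continuous real functions, $\mathrm{Lip}_b(X,\tau,\mathsf d)=\{f\in C_b(X):\mathrm{Lip}(f,X,\mathsf d)<\infty\}$, and $\mathrm{Lip}_{b,1}(X,\tau,\mathsf d)$ is its subset of functions with $\mathrm{Lip}(f,X,\mathsf d)\le1$. $(X,\tau,\mathsf d)$ is an extended metric-topological (e.m.t.) space if $\tau$ is the initial topology generated by $\mathrm{Lip}_b(X,\tau,\mathsf d)$ and $\mathsf d(x,y)=\sup_{f\in\mathrm{Lip}_{b,1}(X,\tau,\mathsf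 d)}|f(x)-f(y)|$ for all $x,y\in X$. An extended metric-topological measure (e.m.t.m.) space is $\mathbb X=(X,\tau,\mathsf d,\mathfrak m)$ with $(X,\tau,\mathsf d)$ an e.m.t. space and $\mathfrak m$ a finite nonnegative Radon measure on $(X,\tau)$ (a Borel measure with $\mathfrak m(B)=\sup\{\mathfrak m(K):K\subset B\text{ compact}\}$). An algebra compatible with $\mathbb X$ is a unital subalgebra $\mathscr A\subset\mathrm{Lip}_b(X,\tau,\mathsf d)$ such that $\mathsf d(x,y)=\sup\{|f(x)-f(y)|:f\in\mathscr A,\ \mathrm{Lip}(f,X,\mathsf d)\le1\}$ for all $x,y\in X$. For $f\in\mathrm{Lip}_b(X,\tau,\mathsf d)$, $\mathrm{lip}f(x)=\inf\{\mathrm{Lip}(f,U,\mathsf d):U\text{ a }\tau\text{-neighborhood of }x\}$. For $f\in L^p(X,\mathfrak m)$, the Cheeger energy is $\mathsf{CE}_{p,\mathscr A}(f)=\inf\{\liminf_n\int_X(\mathrm{lip}f_n)^p\,d\mathfrak m:f_n\in\mathscr A,\ f_n\to f\text{ in }L^p(X,\mathfrak m)\}$, and $H^{1,p}(\mathbb X,\mathscr A)=\{f\in L^p(X,\mathfrak m):\mathsf{CE}_{p,\mathscr A}(f)<\infty\}$. $G\in L^p(X,\mathfrak m)$ is a $(p,\mathscr A)$-relaxed gradient of $f\in L^p$ if there are $f_n\in\mathscr A$ with $f_n\to f$ in $L^p$, $\mathrm{lip}f_n\rightharpoonup\tilde G$ weakly in $L^p$ and $\tilde G\le G$ a.e.;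 $|\mathrm Df|_{\star,\mathscr A}$ is the unique relaxed gradient of minimal $L^p$ norm, and $\mathsf{CE}_{p,\mathscr A}(f)=\int_X|\mathrm Df|_{\star,\mathscr A}^p\,d\mathfrak m$. The index $\mathscr A$ is omitted when $\mathscr A=\mathrm{Lip}_b(X,\tau,\mathsf d)$. *)

(* Defs.v *)
From HB Require Import structures.
From mathcomp Require Import all_boot all_order all_algebra.
From mathcomp Require Import all_classical all_reals all_analysis.

Set Implicit Arguments.
Unset Strict Implicit.
Unset Printing Implicit Defensive.

Import Order.TTheory GRing.Theory Num.Theory.
Import numFieldNormedType.Exports.

Local Open Scope classical_set_scope.
Local Open Scope ring_scope.

Notation borel X := (g_sigma_algebraType (@open X)).

Section extended_metric.
Context {R : realType} {X : ptopologicalType}.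
Implicit Types (d : X -> X -> \bar R) (f : X -> R) (U : set X).

Record extended_distance d : Prop := ExtendedDistance {
  edist_ge0 : forall x y, (0 <= d x y)%E ;
  edist_sym : forall x y, d x y = d y x ;
  edist_triangle : forall x y z, (d x z <= d x y + d y z)%E ;
  edist_eq0 : forall x y, d x y = 0%E <-> x = y }.

(* When d y z = 0 then y = z, and when d y z = +oo only L = 0 is sensitive to
   the value of 0 * +oo, so the convention for 0 * +oo does not affect the
   infimum. *)
Definition Lip d f U : \bar R :=
  ereal_inf [set L | (0 <= L)%E /\
    forall y z, U y -> U z -> (`|f y - f z|%:E <= L * d y z)%E].

Definition Cb : set (X -> R) := [set f | continuous f /\ bounded_fun f].

Definition Lipb d : set (X -> R) := [set f | Cb f /\ (Lip d f setT < +oo)%E].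

Definition Lipb1 d : set (X -> R) := [set f | Lipb d f /\ (Lip d f setT <= 1)%E].

(* The infimum is finite for f in Lipb d, where it is at most Lip d f setT. *)
Definition lip d f (x : X) : R :=
  fine (ereal_inf [set Lip d f U | U in nbhs x]).

Definition Lipb_topology d : topologicalType :=
  sup_topology (fun f : {f : X -> R | Lipb d f} =>
    Topological.class (initial_topology (sval f))).

Record emt_space d : Prop := EmtSpace {
  emt_hausdorff : hausdorff_space X ;
  emt_distance : extended_distance d ;
  emt_topology : @open X = @open (Lipb_topology d) ;
  emt_distanceE : forall x y,
    d x y = ereal_sup [set `|f x - f y|%:E | f in Lipb1 d] }.

Definition inner_radon (m : set X -> \bar R) : Prop :=
  forall B : set X, measurable (B : set (borel X)) ->
    m B = ereal_sup [set m K | K in [set K | compact K /\ K `<=` B]].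

Record emtm_space d (m : {finite_measure set (borel X) -> \bar R}) : Prop :=
  EmtmSpace { emtm_emt : emt_space d ; emtm_radon : inner_radon m }.

Record compatible_algebra d (A : set (X -> R)) : Prop := CompatibleAlgebra {
  algebra_sub : A `<=` Lipb d ;
  algebra_1 : A (cst 1) ;
  algebraD : forall f g, A f -> A g -> A (f \+ g) ;
  algebraZ : forall (a : R) f, A f -> A (a \*: f) ;
  algebraM : forall f g, A f -> A g -> A (f \* g) ;
  algebra_distance : forall x y, d x y =
    ereal_sup [set `|f x - f y|%:E | f in A `&` [set f | (Lip d f setT <= 1)%E]] }.

End extended_metric.

(* Elements of L^p are represented by measurable functions X -> R with finite
   L^p norm; all notions below are invariant under equality a.e. *)
Section Lp_convergence.
Context {d : measure_display} {T : measurableType d} {R : realType}.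
Variables (m : {measure set T -> \bar R}) (p : R).

Local Notation Lp := (Lfun m p%:E).

Definition Lp_cvg (u : nat -> T -> R) (v : T -> R) : Prop :=
  [/\ forall n, u n \in Lp, v \in Lp &
      ('N[m]_p%:E[EFin \o (u n \- v)%R] @[n --> \oo] --> 0)%E].

(* Functionals in the topological dual of L^p; the bound makes them compatible
   with equality a.e. *)
Definition Lp_dual : set ((T -> R) -> R) :=
  [set phi | (forall (a : R) u v, u \in Lp -> v \in Lp ->
                phi ((a \*: u) \+ v) = a * phi u + phi v) /\
             (exists C : R, forall u, u \in Lp ->
                (`|phi u|%:E <= C%:E * 'N[m]_p%:E[EFin \o u])%E)].

Definition Lp_weak_cvg (u : nat -> T -> R) (v : T -> R) : Prop :=
  [/\ forall n, u n \in Lp, v \in Lp &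
      forall phi, Lp_dual phi -> (phi (u n) : R) @[n --> \oo] --> phi v].

End Lp_convergence.

Section Sobolev.
Context {R : realType} {X : ptopologicalType}.
Variables (d : X -> X -> \bar R) (m : {finite_measure set (borel X) -> \bar R}).
Variables (p : R) (A : set (X -> R)).
Implicit Types f G : X -> R.

Definition cheeger f : \bar R :=
  ereal_inf [set limn_einf (fun n => \int[m]_x ((lip d (f_ n) x) `^ p)%:E)%E |
    f_ in [set f_ : nat -> X -> R | (forall n, A (f_ n)) /\ Lp_cvg m p f_ f]].

Definition H1 : set (X -> R) :=
  [set f | f \in Lfun m p%:E /\ (cheeger f < +oo)%E].

Definition relaxed_gradient f G : Prop :=
  G \in Lfun m p%:E /\
  exists (f_ : nat -> X -> R) (G' : X -> R),
    [/\ forall n, A (f_ n),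
        Lp_cvg m p f_ f,
        Lp_weak_cvg m p (fun n => lip d (f_ n)) G' &
        {ae m, forall x, G' x <= G x}].

Definition is_minimal_relaxed_gradient f G : Prop :=
  relaxed_gradient f G /\
  forall G', relaxed_gradient f G' ->
    ('N[m]_p%:E[EFin \o G] <= 'N[m]_p%:E[EFin \o G'])%E.

(* A representative of |Df|_{*,A}: for 1 < p, A an algebra and f in H1, a
   minimal relaxed gradient exists and is unique up to equality a.e. *)
Definition minimal_relaxed_gradient f : X -> R :=
  xget (cst 0) [set G | is_minimal_relaxed_gradient f G].

End Sobolev.

(* Main.v *)
Require Import Defs.
From HB Require Import structures.
From mathcomp Require Import all_boot all_order all_algebra.
From mathcomp Require Import all_classical all_reals all_analysis.
From mathcomp Require Import measurable_realfun ring lra.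

Set Implicit Arguments.
Unset Strict Implicit.
Unset Printing Implicit Defensive.

Import Order.TTheory GRing.Theory Num.Theory.
Import numFieldNormedType.Exports.

Local Open Scope classical_set_scope.
Local Open Scope ring_scope.

(** Everything rests on one inequality: for f in Lipb, the Cheeger energy of f
    computed with the algebra A is at most the integral of (lip f)^p
    ([cheeger_le_energy]).  A diagonal argument then shows that A and Lipb
    give the same Cheeger energy ([cheeger_compatible_algebra]).

    Strong recovery.  Let B be a convex class of functions of Lipb, and f a
    function of finite energy.  Along a minimising sequence in B the energies
    tend to the infimum, and so do the energies of the midpoints, since lip is
    convex and no sequence converging to f can do better than the infimum.  As
    L^p is uniformly convex, the functions lip f_n converge strongly to some G
    ([strong_recovery_exists]).  Comparing f_n with (1 - t) f_n + t u for small
    t gives an Euler-Lagrange inequality: the integral of G^(p-1) lip u is at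
    least that of G^p, up to an error that vanishes as u tends to f while
    lip u stays bounded in L^p ([energy_variation]).  This tests weakly converging slopes against the
    single function G^(p-1), so it passes to all relaxed gradients H without
    any convex combinations: the integral of G^(p-1) H is at least that of G^p.
    Strict convexity of the power function then says that G has minimal norm,
    and is the only relaxed gradient with that norm
    ([minimal_relaxed_gradient_unique]).  Once the two energies are known to
    agree, a recovery sequence in A is one in Lipb too, so that both minimal
    relaxed gradients are the same G and are reached strongly from A.

    The inequality.  Let f be in Lipb, with recovery sequence f_n in A and
    limit G.  If f is c-Lipschitz on an open set U, then G <= c almost
    everywhere on U ([minimal_le_local_lip]).  For otherwise U contains a
    compact K of positive measure on which G > c; take q in A that is nearly 1
    on K, and small with small slope outside a closed part L of a small
    neighbourhood of K, and g in A uniformly close to f on L with global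
    Lipschitz constant c.  The slope of q g + (1 - q) f_n is at most
    q c + (1 - q) lip f_n + |g - f_n| lip q, where the last term is small in
    L^p, and this contradicts the Euler-Lagrange inequality.  By inner
    regularity of the measure, G <= lip f almost everywhere.

    Approximation.  The functions g come from a Stone-Weierstrass theorem that
    keeps track of the Lipschitz constant ([lattice_approximation]), where
    compactness is used.  The uniform limits of L-Lipschitz functions of A form
    a lattice, because the polynomials approximating the absolute value on
    [-1, 1] can be taken 1-Lipschitz ([abs_compl_lip]); and the formula for the
    distance in terms of A lets L-Lipschitz functions of A interpolate
    L-Lipschitz data at two points, up to any error ([alg_pair]).  The functions q are obtained
    from the same theorem, composed with polynomials that are flat near 0
    ([cutoff_exists]). *)

(** * Convexity of the power function *)

Section power_inequalities.
Context {R : realType}.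
Implicit Types a b p x y t s eta : R.

Lemma one_powR s : 1 `^ s = 1 :> R. Proof. by rewrite powR1. Qed.

(** The exponential lies strictly above its tangent at ln x; the values at
    p ln x and at 0, with weights 1/p and 1 - 1/p, give the inequality. *)
Lemma bernoulli_powR p x : 1 < p -> 0 <= x -> x != 1 ->
  1 + p * (x - 1) < x `^ p.
Proof.
move=> p1; have p0 : 0 < p by apply: lt_trans p1.
rewrite le_eqVlt => /predU1P[<- _|x0 x1].
  by rewrite powR0 ?gt_eqF// sub0r mulrN1 subr_lt0.
have lx : ln x != 0 by rewrite ln_eq0.
have l0 : (p - 1) * ln x != 0 by rewrite mulf_neq0// subr_eq0 gt_eqF.
have h1 := expR_gt1Dx l0.
have h2 : 1 - ln x < expR (- ln x) by rewrite expR_gt1Dx// oppr_eq0.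
have -> : x `^ p = x * expR ((p - 1) * ln x).
  rewrite /powR gt_eqF// -{2}(lnK x0) -expRD; congr expR; ring.
have xe : x * expR (- ln x) = 1 by rewrite expRN lnK// mulfV// gt_eqF.
have h2p : x * (1 - ln x) < 1 by rewrite -[ltRHS]xe ltr_pM2l.
have h1p : x * (1 + (p - 1) * ln x) < x * expR ((p - 1) * ln x).
  by rewrite ltr_pM2l.
apply: le_lt_trans h1p.
have : 0 <= (p - 1) * (1 - x * (1 - ln x)).
  by rewrite mulr_ge0// subr_ge0 ltW.
lra.
Qed.

Lemma powR_tangent_lt p x y : 1 < p -> 0 <= x -> 0 <= y -> x != y ->
  y `^ p + p * y `^ (p - 1) * (x - y) < x `^ p.
Proof.
move=> p1; have p0 : 0 < p by apply: lt_trans p1.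
move=> x0; rewrite le_eqVlt => /predU1P[<- xy|y0 xy].
  rewrite !powR0 ?gt_eqF ?subr_gt0// mulr0 mul0r addr0 powR_gt0//.
  by rewrite lt_neqAle eq_sym xy.
have xy1 : x / y != 1.
  by apply: contra xy => /eqP h; rewrite -(divfK (lt0r_neq0 y0) x) h mul1r.
have := bernoulli_powR p1 (divr_ge0 x0 (ltW y0)) xy1.
rewrite -(ltr_pM2r (powR_gt0 p y0)) -powRM ?divr_ge0 ?(ltW y0)// divfK ?gt_eqF//.
apply: le_lt_trans.
have -> : y `^ p = y * y `^ (p - 1) by rewrite mulr_powRB1// ltW.
rewrite le_eqVlt; apply/orP; left; apply/eqP; field.
by rewrite gt_eqF.
Qed.

Lemma powR_tangent p x y : 1 < p -> 0 <= x -> 0 <= y ->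
  y `^ p + p * y `^ (p - 1) * (x - y) <= x `^ p.
Proof.
move=> p1 x0 y0; have [->|xy] := eqVneq x y; first by rewrite subrr mulr0 addr0.
exact/ltW/powR_tangent_lt.
Qed.

(** The chord above [x, y] dominates the power function: combine its tangent
    at z, evaluated at both ends.  The denominator y - x is cleared, which
    keeps the degenerate case. *)
Lemma powR_chord p x y z : 1 < p -> 0 <= x -> x <= z -> z <= y ->
  (y - x) * z `^ p <= (y - z) * x `^ p + (z - x) * y `^ p.
Proof.
move=> p1 x0 xz zy; have z0 := le_trans x0 xz; have y0 := le_trans z0 zy.
have yz0 : 0 <= y - z by rewrite subr_ge0.
have zx0 : 0 <= z - x by rewrite subr_ge0.
have := ler_wpM2l yz0 (powR_tangent p1 x0 z0).
have := ler_wpM2l zx0 (powR_tangent p1 y0 z0).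
set A := x `^ p; set B := y `^ p; set C := z `^ p; set D := z `^ (p - 1).
nra.
Qed.

Definition midpoint_gap p a b := (a `^ p + b `^ p) / 2 - ((a + b) / 2) `^ p.

Lemma midpoint_gapC p a b : midpoint_gap p a b = midpoint_gap p b a.
Proof. by rewrite /midpoint_gap (addrC (a `^ p)) (addrC a). Qed.

Lemma midpoint_gap_gt0 p a b : 1 < p -> 0 <= a -> 0 <= b -> a != b ->
  0 < midpoint_gap p a b.
Proof.
move=> p1 a0 b0 ab; rewrite /midpoint_gap.
have c0 : 0 <= (a + b) / 2 by rewrite divr_ge0// addr_ge0.
have h1 : a != (a + b) / 2.
  by apply: contra ab => /eqP h; apply/eqP; lra.
have h2 : b != (a + b) / 2.
  by apply: contra ab => /eqP h; apply/eqP; lra.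
have := powR_tangent_lt p1 a0 c0 h1.
have := powR_tangent_lt p1 b0 c0 h2.
have -> : b - (a + b) / 2 = - (a - (a + b) / 2) by field.
by rewrite mulrN; lra.
Qed.

Lemma midpoint_gap_ge0 p a b : 1 < p -> 0 <= a -> 0 <= b ->
  0 <= midpoint_gap p a b.
Proof.
move=> p1 a0 b0; have [->|ab] := eqVneq a b; last exact/ltW/midpoint_gap_gt0.
rewrite /midpoint_gap; have -> : (b + b) / 2 = b by field.
have -> : (b `^ p + b `^ p) / 2 = b `^ p by field.
by rewrite subrr.
Qed.

(** The four arguments of the two gaps, other than 1, satisfy
    x <= y, (1 + x)/2 <= (1 + y)/2 and x + 2 (1 + y)/2 = y + 2 (1 + x)/2, so
    the comparison follows from the chord above [x, (1 + y)/2]. *)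
Lemma midpoint_gap_mono p x y : 1 < p -> 0 <= x -> x <= y -> y < 1 ->
  midpoint_gap p 1 y <= midpoint_gap p 1 x.
Proof.
move=> p1 x0 xy y1; rewrite /midpoint_gap powR1.
set w := (1 + y) / 2; set c := (1 + x) / 2.
have xw : x < w by rewrite /w; lra.
have yw : y <= w by rewrite /w; lra.
have xc : x <= c by rewrite /c; lra.
have cw : c <= w by rewrite /c /w; lra.
have h1 := powR_chord p1 x0 xy yw.
have h2 := powR_chord p1 x0 xc cw.
have : (w - x) * (y `^ p + 2 * c `^ p) <= (w - x) * (x `^ p + 2 * w `^ p).
  have e1 : (w - y) + 2 * (w - c) = w - x by rewrite /w /c; field.
  have e2 : (y - x) + 2 * (c - x) = 2 * (w - x) by rewrite /w /c; field.
  rewrite [leLHS](_ : _ = (w - x) * y `^ p + 2 * ((w - x) * c `^ p)); last by ring.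
  rewrite mulrDr (_ : (w - x) * (2 * _) = (2 * (w - x)) * w `^ p); last by ring.
  by rewrite -[in X in X * x `^ p]e1 -e2; lra.
rewrite ler_pM2l ?subr_gt0//; lra.
Qed.

(** Homogeneous inequalities between two nonnegative numbers only need to be
    checked when the larger of them is 1. *)
Lemma powR_homog_pair p (P : R -> R -> Prop) :
  (forall k a b, 0 < k -> 0 <= a -> 0 <= b -> P a b -> P (k * a) (k * b)) ->
  P 0 0 -> (forall a, 0 <= a <= 1 -> P a 1) -> (forall b, 0 <= b <= 1 -> P 1 b) ->
  forall a b, 0 <= a -> 0 <= b -> P a b.
Proof.
move=> PZ P0 Pa Pb a b a0 b0; case: (leP a b) => ab; last first.
  have a_gt0 : 0 < a by exact: le_lt_trans ab.
  have -> : b = a * (b / a) by rewrite mulrC divfK ?gt_eqF.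
  rewrite -[X in P X]mulr1.
  apply: PZ => //; first by rewrite divr_ge0.
  by apply: Pb; rewrite divr_ge0//= ler_pdivrMr// mul1r ltW.
move: b0; rewrite le_eqVlt => /predU1P[b0|b_gt0].
  have -> : a = 0 by apply/le_anti; rewrite a0 b0 ab.
  by rewrite -b0.
have -> : a = b * (a / b) by rewrite mulrC divfK ?gt_eqF.
rewrite -[X in P _ X]mulr1.
apply: PZ => //; first by rewrite divr_ge0// ltW.
by apply: Pa; rewrite divr_ge0 ?(ltW b_gt0)//= ler_pdivrMr// mul1r.
Qed.

(** Pointwise form of the uniform convexity of L^p.  After scaling, either
    |a - b|^p is below eta, or the gap is bounded below by monotonicity. *)
Lemma powR_unif_convex p eta : 1 < p -> 0 < eta -> exists2 C, 0 <= C &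
  forall a b, 0 <= a -> 0 <= b ->
  `|a - b| `^ p <= eta * (a `^ p + b `^ p) + C * midpoint_gap p a b.
Proof.
move=> p1 eta0; have p0 : 0 < p by apply: lt_trans p1.
set k := eta `^ p^-1.
have k0 : 0 < k by rewrite powR_gt0.
have kp : k `^ p = eta by rewrite -powRrM mulVf ?gt_eqF// powRr1// ltW.
have gap0 : k < 1 -> 0 < midpoint_gap p 1 (1 - k).
  move=> k1; apply: midpoint_gap_gt0 => //; first by rewrite subr_ge0 ltW.
  by rewrite eq_sym lt_eqF// ltrBlDr ltrDl.
set C := if k < 1 then (midpoint_gap p 1 (1 - k))^-1 else 0.
have C0 : 0 <= C.
  by rewrite /C; case: ifPn => // /gap0/ltW; rewrite invr_ge0.
exists C => //.
have main b : 0 <= b <= 1 ->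
    `|1 - b| `^ p <= eta * (1 `^ p + b `^ p) + C * midpoint_gap p 1 b.
  move=> /andP[b0 b1]; rewrite powR1 ger0_norm ?subr_ge0//.
  have bp := powR_ge0 b p.
  have g0 := midpoint_gap_ge0 p1 ler01 b0.
  have Cg0 : 0 <= C * midpoint_gap p 1 b by rewrite mulr_ge0.
  have [bk|bk] := leP (1 - b) k.
    have : (1 - b) `^ p <= eta.
      by rewrite -kp ge0_ler_powR ?nnegrE ?subr_ge0// ltW.
    have : 0 <= eta * b `^ p by rewrite mulr_ge0// ltW.
    by rewrite mulrDr mulr1; lra.
  have k1 : k < 1 by lra.
  have : (1 - b) `^ p <= 1.
    rewrite -[leRHS](one_powR p) ge0_ler_powR ?nnegrE ?subr_ge0 ?(ltW p0)//; lra.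
  have : 1 <= C * midpoint_gap p 1 b.
    rewrite /C k1 ler_pdivlMl ?gap0// mulr1 midpoint_gap_mono//; lra.
  have : 0 <= eta * (1 + b `^ p) by rewrite mulr_ge0 ?addr_ge0// ltW.
  by lra.
apply: (@powR_homog_pair p) => //.
- move=> t a b t0 a0 b0 /(ler_wpM2l (powR_ge0 t p)).
  rewrite -mulrBr normrM (ger0_norm (ltW t0)) powRM ?(ltW t0)// => /le_trans; apply.
  rewrite /midpoint_gap -mulrDr -mulrA !powRM ?(ltW t0) ?divr_ge0 ?addr_ge0//.
  rewrite le_eqVlt; apply/orP; left; apply/eqP; ring.
- rewrite /midpoint_gap !(subrr, addr0, mul0r, normr0) powR0 ?gt_eqF//.
  by rewrite !(addr0, mul0r, mulr0, subr0).
- move=> a /main; rewrite distrC midpoint_gapC (addrC (1 `^ p)); exact.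
Qed.

Lemma powR_modulus s x h : 0 < s -> 0 <= x -> 0 <= h -> x + h <= 1 ->
  (x + h) `^ s - x `^ s <= h `^ s + s * h.
Proof.
move=> s0 x0 h0 xh1.
have [s1|s1] := leP s 1.
  have hs0 : 0 <= s * h by rewrite mulr_ge0// ltW.
  have := h0; rewrite le_eqVlt => /predU1P[<-|h_gt0].
    by rewrite addr0 subrr mulr0 addr0 powR_ge0.
  set w := x + h; have w0 : 0 < w by rewrite ltr_wpDl.
  have xw : 0 <= x / w <= 1.
    by rewrite divr_ge0 ?(ltW w0)//= ler_pdivrMr// mul1r /w lerDl.
  have ge u : 0 <= u <= 1 -> u <= u `^ s.
    move=> /andP[]; rewrite le_eqVlt => /predU1P[<- _|u0 u1].
      exact: powR_ge0.
    by rewrite ger1_powR// u0.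
  have := ge _ xw.
  have : h / w <= (h / w) `^ s.
    by apply: ge; rewrite divr_ge0 ?(ltW w0)//= ler_pdivrMr// mul1r /w lerDr.
  have ws := powR_gt0 s w0.
  move=> /(ler_wpM2r (ltW ws)) + /(ler_wpM2r (ltW ws)).
  rewrite -!powRM ?divr_ge0 ?(ltW w0)// !divfK ?gt_eqF//.
  have : x / w * w `^ s + h / w * w `^ s = w `^ s.
    by rewrite -mulrDl -mulrDl divff ?gt_eqF// mul1r.
  lra.
have w0 : 0 <= x + h by rewrite addr_ge0.
have := powR_tangent s1 x0 w0.
have : (x + h) `^ (s - 1) <= 1.
  rewrite -[leRHS](one_powR (s - 1)) ge0_ler_powR ?nnegrE// subr_ge0; exact: ltW.
have sh0 : 0 <= s * h by rewrite mulr_ge0// ltW.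
move=> /(ler_wpM2l sh0); have := powR_ge0 h s.
have -> : x - (x + h) = - h by ring.
rewrite mulrN mulr1 (mulrAC s); lra.
Qed.

(** The power function is differentiable at a in the direction of b, with an
    error that is uniform after scaling by a^p + b^p.  Its tangent at the point
    c = (1 - t) a + t b replaces a^(p-1) by c^(p-1), and the modulus of
    continuity of the exponent p - 1 controls the difference. *)
Lemma powR_unif_diff p eta : 1 < p -> 0 < eta -> exists2 t, 0 < t < 1 &
  forall a b, 0 <= a -> 0 <= b ->
  ((1 - t) * a + t * b) `^ p <=
  a `^ p + t * (p * (a `^ (p - 1) * (b - a))) + t * (eta * (a `^ p + b `^ p)).
Proof.
move=> p1 eta0; have p0 : 0 < p by apply: lt_trans p1.
have s0 : 0 < p - 1 by rewrite subr_gt0.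
set s := p - 1 in s0 *.
(* both terms of the modulus of continuity at t must stay below k *)
set k := eta / p / 2.
have k0 : 0 < k by rewrite !divr_gt0.
set t := Num.min (1/2) (Num.min (k `^ s^-1) (k / s)).
have t0 : 0 < t by rewrite !lt_min divr_gt0//= powR_gt0//= divr_gt0.
have t1 : t < 1 by rewrite gt_min; apply/orP; left; lra.
have tk1 : t `^ s <= k.
  have : t <= k `^ s^-1 by rewrite !ge_min lexx/= orbT.
  move=> /(ge0_ler_powR (ltW s0)); rewrite !nnegrE (ltW t0) powR_ge0.
  by move=> /(_ isT isT); rewrite -powRrM mulVf ?gt_eqF// powRr1// ltW.
have tk2 : s * t <= k.
  have : t <= k / s by rewrite !ge_min lexx/= !orbT.
  by rewrite ler_pdivlMr// mulrC.
have modt : p * (t `^ s + s * t) <= eta.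
  have -> : eta = p * (k + k) by rewrite /k; field; rewrite gt_eqF.
  by rewrite ler_pM2l// lerD.
exists t; first by rewrite t0.
have key a b c : 0 <= a -> 0 <= b -> c = (1 - t) * a + t * b ->
    (c `^ s - a `^ s) * (b - a) <= t `^ s + s * t ->
    1 <= a `^ p + b `^ p ->
    c `^ p <= a `^ p + t * (p * (a `^ s * (b - a)))
              + t * (eta * (a `^ p + b `^ p)).
  move=> a0 b0 ce cs ab1.
  have c0 : 0 <= c by rewrite ce addr_ge0// mulr_ge0 ?subr_ge0// ltW.
  have := powR_tangent p1 a0 c0; rewrite -/s.
  have -> : a - c = - (t * (b - a)) by rewrite ce; ring.
  have h : t * (p * ((c `^ s - a `^ s) * (b - a))) <= t * (eta * (a `^ p + b `^ p)).
    rewrite ler_pM2l// (@le_trans _ _ eta)// ?ler_peMr ?(ltW eta0)//.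
    by apply: le_trans modt; rewrite ler_pM2l.
  set X := c `^ s in h *; set Y := a `^ s in h *; set D := b - a in h *.
  rewrite mulrN (_ : p * X * (t * D) = t * (p * (X * D))); last by ring.
  have : t * (p * ((X - Y) * D)) = t * (p * (X * D)) - t * (p * (Y * D)) by ring.
  lra.
apply: (@powR_homog_pair p).
- move=> l a b l0 a0 b0 /(ler_wpM2l (powR_ge0 l p)).
  rewrite -powRM ?(ltW l0)//; last by rewrite addr_ge0// mulr_ge0// ?subr_ge0 ltW.
  have -> : l * ((1 - t) * a + t * b) = (1 - t) * (l * a) + t * (l * b) by ring.
  move=> /le_trans; apply.
  rewrite !powRM ?(ltW l0)// -(mulr_powRB1 (ltW l0) p0) -/s.
  rewrite le_eqVlt; apply/orP; left; apply/eqP; ring.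
- by rewrite !(mulr0, addr0, subrr) powR0 ?gt_eqF// !(mulr0, addr0).
- move=> a /andP[a0 a1]; apply: key => //; last first.
    by rewrite powR1 lerDr powR_ge0.
  have -> : (1 - t) * a + t * 1 = a + t * (1 - a) by ring.
  have ta0 : 0 <= t * (1 - a) by rewrite mulr_ge0 ?subr_ge0// ltW.
  have tat : t * (1 - a) <= t by rewrite ler_piMr ?(ltW t0)//; lra.
  have at1 : a + t * (1 - a) <= 1 by nra.
  have h := powR_modulus s0 a0 ta0 at1.
  have h2 : (t * (1 - a)) `^ s <= t `^ s.
    by rewrite ge0_ler_powR ?nnegrE ?(ltW s0) ?(ltW t0).
  have h3 : s * (t * (1 - a)) <= s * t by rewrite ler_pM2l.
  have : 0 <= t `^ s + s * t by rewrite addr_ge0 ?powR_ge0// mulr_ge0// ltW.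
  have : (a + t * (1 - a)) `^ s - a `^ s <= t `^ s + s * t by lra.
  move: (_ - _) (_ + s * t) => u v uv v0.
  have [u0|u0] := leP 0 u; nra.
- move=> b /andP[b0 b1]; apply: key => //; last first.
    by rewrite powR1 lerDl powR_ge0.
  have -> : (1 - t) * 1 + t * b = 1 - t * (1 - b) by ring.
  have tb0 : 0 <= t * (1 - b) by rewrite mulr_ge0 ?subr_ge0// ltW.
  have tbt : t * (1 - b) <= t by rewrite ler_piMr ?(ltW t0)//; lra.
  have c0 : 0 <= 1 - t * (1 - b) by nra.
  have := powR_modulus s0 c0 tb0; rewrite subrK => /(_ (lexx _)) h.
  have h2 : (t * (1 - b)) `^ s <= t `^ s.
    by rewrite ge0_ler_powR ?nnegrE ?(ltW s0) ?(ltW t0).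
  have h3 : s * (t * (1 - b)) <= s * t by rewrite ler_pM2l.
  have : 0 <= t `^ s + s * t by rewrite addr_ge0 ?powR_ge0// mulr_ge0// ltW.
  have : 1 `^ s - (1 - t * (1 - b)) `^ s <= t `^ s + s * t by lra.
  rewrite -(opprB (1 `^ s)) mulNr -mulrN opprB.
  move: (_ - _) (_ + s * t) => u v uv v0.
  have [u0|u0] := leP 0 u; nra.
Qed.

End power_inequalities.

(** * Polynomial approximation of the absolute value and of cutoffs *)

Section polynomial_absolute_value.
Context {R : realType}.
Implicit Types s t u v w : R.

(** The classical iteration for 1 - |t|: it is the fixed point of
    y |-> (1 - t^2 + y^2) / 2.  Only ring operations on t are used, so that an
    algebra is stable under composition with it. *)
Fixpoint abs_compl n t : R :=
  if n is n'.+1 then (1 - t ^+ 2 + abs_compl n' t ^+ 2) / 2 else 0.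

(** With s = 1 - |t|, the error e = s - y becomes e (s + y) / 2 at the next
    step, hence at most e (1 - e / 2); this recursion is dominated by 2 / (n + 2). *)
Lemma abs_compl_bound n t : `|t| <= 1 ->
  0 <= abs_compl n t /\ 0 <= 1 - `|t| - abs_compl n t <= 2 / n.+2%:R.
Proof.
move=> t1; have t0 := normr_ge0 t.
have tt : t ^+ 2 = `|t| ^+ 2 by rewrite real_normK ?num_real.
elim: n => [|n [y0 /andP[e0 en]]] /=.
  by rewrite subr0 subr_ge0 t1 divff// lerBlDr lerDl.
rewrite tt; set a := `|t| in t0 t1 e0 en *; set y := abs_compl n t in y0 e0 en *.
have -> : 1 - a - (1 - a ^+ 2 + y ^+ 2) / 2 = (1 - a - y) * (1 - a + y) / 2.
  by field.
set e := 1 - a - y in e0 en *.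
split.
  rewrite divr_ge0// addr_ge0 ?sqr_ge0// subr_ge0 -(expr1n _ 2).
  by rewrite ler_pXn2r// ?nnegrE.
rewrite divr_ge0 ?mulr_ge0//=; last by rewrite addr_ge0// subr_ge0.
have n0 : (0 : R) < n.+2%:R by rewrite ltr0n.
have n1 : (0 : R) < n.+3%:R by rewrite ltr0n.
have nn : n.+3%:R = n.+2%:R + 1 :> R by rewrite -natr1.
have n2 : (2 : R) <= n.+2%:R by rewrite ler_nat.
set N := n.+2%:R in n0 nn n2 en *; rewrite nn.
rewrite ler_pdivlMr; last by rewrite -nn.
move: en; rewrite ler_pdivlMr// => en.
have h1 : (1 - a + y) <= 2 - e by rewrite /e; lra.
have h2 : e * (1 - a + y) / 2 <= e * (2 - e) / 2.
  by rewrite ler_pM2r// ler_wpM2l.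
have e1 : e <= 1 by rewrite /e; lra.
have : e * (2 - e) / 2 * (N + 1) <= 2.
  (* the right-hand side increases with e on [0, 1]; compare at e = 2 / N *)
  suff : N ^+ 2 * (e * (2 - e) * (N + 1)) <= N ^+ 2 * 4.
    by rewrite ler_pM2l ?exprn_gt0//; lra.
  have : (N * e) * (2 * N - N * e) <= 2 * (2 * N - 2).
    have h3 : 0 <= 2 - N * e by lra.
    have h4 : 0 <= 2 * N - N * e - 2 by lra.
    by have := mulr_ge0 h3 h4; lra.
  have N1 : 0 <= N + 1 by lra.
  move=> /(ler_wpM2r N1); nra.
move: h2; have N1 : 0 <= N + 1 by lra.
by move=> /(ler_wpM2r N1) h2 h3; exact: le_trans h3.
Qed.

(** The slope of the next iterate is at most |t| + y times the previous slope,
    and y <= 1 - |t|: Lipschitz constant 1 propagates. *)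
Lemma abs_compl_lip n s t : `|s| <= 1 -> `|t| <= 1 ->
  `|abs_compl n s - abs_compl n t| <= `|s - t|.
Proof.
move=> s1 t1; elim: n => [|n ih] /=; first by rewrite subrr normr0.
have [ys0 /andP[es _]] := abs_compl_bound n s1.
have [yt0 /andP[et _]] := abs_compl_bound n t1.
set y := abs_compl n s in ih ys0 es *; set z := abs_compl n t in ih yt0 et *.
have -> : (1 - s ^+ 2 + y ^+ 2) / 2 - (1 - t ^+ 2 + z ^+ 2) / 2
  = - ((s - t) * ((s + t) / 2)) + (y - z) * ((y + z) / 2) by field.
apply: (le_trans (ler_normD _ _)).
rewrite normrN (normrM (s - t)) (normrM (y - z)).
have h1 : `|(s + t) / 2| <= (`|s| + `|t|) / 2.
  by rewrite normrM (ger0_norm (_ : 0 <= 2^-1))// ler_pM2r// ler_normD.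
have h2 : `|(y + z) / 2| = (y + z) / 2.
  by rewrite ger0_norm// divr_ge0// addr_ge0.
rewrite h2.
have := ler_wpM2l (normr_ge0 (s - t)) h1.
have : 0 <= (y + z) / 2 by rewrite divr_ge0// addr_ge0.
move=> /(ler_wpM2r)/(_ _ _ ih).
have : (y + z) / 2 <= 1 - (`|s| + `|t|) / 2 by lra.
move=> /(ler_wpM2l (normr_ge0 (s - t))).
lra.
Qed.

(** max a b is (a + b) / 2 + |a - b| / 2; here c stands for the approximation of
    1 - |t| at t = (a - b) / M. *)
Lemma soft_max_bound (a b c M e : R) : 0 < M -> `|a - b| <= M ->
  0 <= 1 - `|(a - b) / M| - c <= e ->
  `|(a + b) / 2 + M / 2 * (1 - c) - Num.max a b| <= M * e.
Proof.
move=> M0 abM; have M20 : 0 < M / 2 by rewrite divr_gt0.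
rewrite normrM normfV (gtr0_norm M0) => /andP[c0 ce].
have -> : (a + b) / 2 + M / 2 * (1 - c) - Num.max a b =
    M / 2 * (1 - `|a - b| / M - c).
  have -> : Num.max a b = (a + b) / 2 + `|a - b| / 2.
    by rewrite maxr_absE mulrDl.
  by field; rewrite gt_eqF.
rewrite ger0_norm; last exact: (mulr_ge0 (ltW M20) c0).
apply: (@le_trans _ _ (M / 2 * e)); first by rewrite ler_pM2l.
have : 0 <= e by exact: le_trans c0 ce.
by move=> /(mulr_ge0 (ltW M0)); lra.
Qed.

(** Since the approximation of the absolute value is 1-Lipschitz, an increment
    of the approximate maximum is a convex combination of those of a and b, up
    to sign, whence no loss in the constant L. *)
Lemma soft_max_lip (a b a' b' c c' M L : R) : 0 < M ->
  `|c - c'| <= `|(a - b) / M - (a' - b') / M| ->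
  `|a - a'| <= L -> `|b - b'| <= L ->
  `|(a + b) / 2 + M / 2 * (1 - c) - ((a' + b') / 2 + M / 2 * (1 - c'))| <= L.
Proof.
move=> M0; rewrite -mulrBl normrM normfV (gtr0_norm M0) ler_pdivlMr// => cc.
have -> : (a + b) / 2 + M / 2 * (1 - c) - ((a' + b') / 2 + M / 2 * (1 - c')) =
  ((a - a') + (b - b') - M * (c - c')) / 2 by field.
have e : a - b - (a' - b') = (a - a') - (b - b') by ring.
rewrite e {e} in cc.
have : `|M * (c - c')| <= `|(a - a') - (b - b')|.
  by rewrite normrM (gtr0_norm M0) mulrC.
move: (a - a') (b - b') (M * (c - c')) => x y z zxy.
rewrite !ler_norml => /andP[x0 x1] /andP[y0 y1].
rewrite ler_pdivlMr// ler_pdivrMr//.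
move: zxy; have [xy|xy] := leP 0 (x - y).
  by rewrite (ger0_norm xy) ler_norml => /andP[]; lra.
by rewrite (ltr0_norm xy) ler_norml => /andP[]; lra.
Qed.

End polynomial_absolute_value.

Section cutoff_polynomial.
Context {R : realType}.
Implicit Types s t : R.

(** The polynomials of Brosowski and Deutsch: t^N is so much smaller than 3^-N
    below 1/4, and so much larger above 1/2, that the power 3^N turns the
    transition into a step.  Unlike a step function they are available in an
    algebra, and they are flat near 0. *)
Definition cutoff (N : nat) t : R := 1 - (1 - t ^+ N) ^+ (3 ^ N).

Lemma ler_expn_lip (r s t : R) n : 0 <= s <= r -> 0 <= t <= r ->
  `|s ^+ n - t ^+ n| <= n%:R * r ^+ n.-1 * `|s - t|.
Proof.
move=> /andP[s0 sr] /andP[t0 tr]; case: n => [|n].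
  by rewrite !expr0 subrr normr0 mul0r mul0r.
rewrite subrXX normrM mulrC ler_wpM2r//=.
apply: (le_trans (ler_norm_sum _ _ _)) => /=.
rewrite mulr_natl -[X in _ *+ X](card_ord n.+1) -sumr_const.
apply: ler_sum => i _.
rewrite normrM !normrX (ger0_norm s0) (ger0_norm t0).
have -> : r ^+ n = r ^+ (n.+1.-1 - i) * r ^+ i.
  by rewrite -exprD subnK// -ltnS.
have r0 : 0 <= r by exact: le_trans sr.
by rewrite ler_pM ?exprn_ge0// lerXn2r ?nnegrE.
Qed.

Lemma cutoff_lip N (r s t : R) : r <= 1 -> 0 <= s <= r -> 0 <= t <= r ->
  `|cutoff N s - cutoff N t| <= (3 ^ N)%:R * (N%:R * r ^+ N.-1) * `|s - t|.
Proof.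
move=> r1 sr tr; rewrite /cutoff.
have h u : 0 <= u <= r -> 0 <= 1 - u ^+ N <= 1.
  move=> /andP[u0 ur]; rewrite subr_ge0 lerBlDr lerDl exprn_ge0// andbT.
  by rewrite exprn_ile1// (le_trans ur).
have subC u v : 1 - u - (1 - v) = v - u :> R by ring.
rewrite subC; have := ler_expn_lip (3 ^ N) (h _ tr) (h _ sr).
rewrite expr1n mulr1 subC => /le_trans; apply.
rewrite -!mulrA ler_wpM2l// mulrA.
by rewrite (le_trans (ler_expn_lip N sr tr)).
Qed.

Lemma cutoff_range N t : 0 <= t <= 1 -> 0 <= cutoff N t <= 1.
Proof.
move=> /andP[t0 t1]; have tN0 : 0 <= t ^+ N by rewrite exprn_ge0.
have tN1 : t ^+ N <= 1 by rewrite exprn_ile1.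
rewrite /cutoff subr_ge0 lerBlDr lerDl exprn_ge0 ?subr_ge0// andbT.
by rewrite exprn_ile1 ?subr_ge0// lerBlDr lerDl.
Qed.

(** From (1 - x)^M (1 + x)^M <= 1 and Bernoulli's inequality, with M = 3^N and
    x = t^N, so that M x >= (3/2)^N. *)
Lemma cutoff_near1 N t : 2^-1 <= t <= 1 -> 1 - cutoff N t <= (2 / 3) ^+ N.
Proof.
move=> /andP[t2 t1]; have t0 : 0 <= t by apply: le_trans t2.
rewrite /cutoff subKr; set x := t ^+ N; set M := (3 ^ N)%N.
have x0 : 0 <= x by rewrite exprn_ge0.
have x1 : x <= 1 by rewrite exprn_ile1.
have y0 : 0 <= (1 - x) ^+ M by rewrite exprn_ge0// subr_ge0.
have b : M%:R * x <= (1 + x) ^+ M.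
  elim: M {y0} => [|k ih]; first by rewrite mul0r expr0.
  rewrite exprS -natr1 mulrDl mul1r.
  have : 1 <= (1 + x) ^+ k by rewrite exprn_ege1// lerDl.
  nra.
have : (1 - x) ^+ M * (1 + x) ^+ M <= 1.
  rewrite -exprMn exprn_ile1//; first by rewrite mulr_ge0 ?subr_ge0 ?addr_ge0.
  nra.
have Mx : (3 / 2) ^+ N <= M%:R * x.
  rewrite /M natrX expr_div_n -exprVn ler_wpM2l ?exprn_ge0// /x.
  by rewrite lerXn2r ?nnegrE ?invr_ge0 ?ler0n.
have q0 : 0 < ((3 / 2) ^+ N : R) by rewrite exprn_gt0 ?divr_gt0.
move=> h; have : (1 - x) ^+ M * (3 / 2) ^+ N <= 1.
  by apply: le_trans h; rewrite ler_wpM2l// (le_trans Mx).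
rewrite -ler_pdivlMr// div1r -exprVn invf_div; exact.
Qed.

(** The Lipschitz constant of the cutoff below 1/4 is 3^N N 4^(1-N), which
    tends to 0: it is below 32 (8/9)^N, as (3/4) <= (8/9)^2 and N (8/9)^N <= 8. *)
Lemma cutoff_exists (e : R) : 0 < e -> exists N C, [/\ 0 < C,
  forall s t, 0 <= s <= 1 -> 0 <= t <= 1 ->
    `|cutoff N s - cutoff N t| <= C * `|s - t|,
  forall s t, 0 <= s <= 4^-1 -> 0 <= t <= 4^-1 ->
    `|cutoff N s - cutoff N t| <= e * `|s - t|,
  forall t, 0 <= t <= 4^-1 -> cutoff N t <= e &
  forall t, 2^-1 <= t <= 1 -> 1 - e <= cutoff N t].
Proof.
move=> e0.
have gN n : n%:R * (8 / 9) ^+ n <= 8 :> R.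
  have q0 : 0 < ((9 / 8) ^+ n : R) by rewrite exprn_gt0 ?divr_gt0.
  have -> : (8 / 9) ^+ n = ((9 / 8) ^+ n)^-1 :> R by rewrite -exprVn invf_div.
  rewrite ler_pdivrMr//; elim: n {q0} => [|n ih]; first by rewrite expr0; lra.
  have : 1 <= ((9 / 8) ^+ n : R) by rewrite exprn_ege1//; lra.
  by rewrite exprS -[n.+1%:R]natr1; move: ih; move: (_ ^+ n) => q; lra.
pose N := (Num.bound (256 / e)).+1.
have NE : 256 / e <= N%:R.
  rewrite (le_trans (ltW (archi_boundP _)))// ?ler_nat ?divr_ge0 ?(ltW e0)//.
have N0 : 0 < N%:R :> R by rewrite ltr0n.
have e8 : 32 * (8 / 9) ^+ N <= e.
  have := gN N; rewrite mulrC -ler_pdivlMr// => h.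
  have : 32 * (8 / 9) ^+ N <= 32 * (8 / N%:R) :> R by rewrite ler_pM2l.
  move/le_trans; apply; rewrite mulrA ler_pdivrMr//.
  by move: NE; rewrite ler_pdivrMr// [e * _]mulrC; lra.
have q0 : 0 <= ((8 / 9) ^+ N : R) by rewrite exprn_ge0.
have small : (3 ^ N)%:R * (N%:R * 4^-1 ^+ N.-1) <= e :> R.
  apply: le_trans e8.
  have -> : 4^-1 ^+ N.-1 = 4 * 4^-1 ^+ N :> R 
    by rewrite /N/= exprS mulrA mulfV ?mul1r.
  rewrite natrX (_ : _ * _ = 4 * (N%:R * (3 ^+ N * 4^-1 ^+ N))); last by ring.
  rewrite -exprMn (_ : 32 * _ = 4 * (8 * (8 / 9) ^+ N)); last by ring.
  rewrite ler_pM2l//.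
  have : (3 * 4^-1) ^+ N <= (8 / 9) ^+ N * (8 / 9) ^+ N :> R.
    by rewrite -exprMn lerXn2r ?nnegrE//; lra.
  move=> /(ler_wpM2l (ltW N0)) /le_trans; apply.
  by rewrite mulrA ler_wpM2r.
exists N, ((3 ^ N)%:R * N%:R); split.
- by rewrite mulr_gt0// ltr0n expn_gt0.
- by move=> s t s1 t1; have := cutoff_lip N (lexx 1) s1 t1; rewrite expr1n mulr1.
- move=> s t s4 t4; apply: le_trans (cutoff_lip N _ s4 t4) _; first by lra.
  by rewrite ler_wpM2r.
- move=> t t4; have z4 : 0 <= (0 : R) <= 4^-1 by rewrite lexx/=; lra.
  have := cutoff_lip N _ t4 z4.
  rewrite {2}/cutoff expr0n subr0 expr1n subrr !subr0.
  have /andP[t0 t1] := t4.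
  have /andP[c0 _] : 0 <= cutoff N t <= 1 by rewrite cutoff_range// t0/=; lra.
  rewrite (ger0_norm c0) (ger0_norm t0) => h; have {}h := h ltac:(lra).
  apply: (le_trans h); apply: (@le_trans _ _ (e * 1)); last by rewrite mulr1.
  by rewrite ler_pM// ?mulr_ge0// ?exprn_ge0//; lra.
- move=> t /(cutoff_near1 N) h; have : (2 / 3) ^+ N <= (8 / 9) ^+ N :> R.
    by rewrite lerXn2r ?nnegrE//; lra.
  lra.
Qed.

End cutoff_polynomial.

(** * The space L^p *)

Section Lp_space.
Context {d : measure_display} {T : measurableType d} {R : realType}.
Variables (m : {finite_measure set T -> \bar R}) (p : R).
Hypothesis p1 : 1 < p.
Implicit Types (f g h G : T -> R) (a C : R).

Local Notation Lp := (Lfun m p%:E).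

(** The L^p norm as a real number; it is meaningful on L^p, where the extended
    norm is finite. *)
Definition nrm f : R := fine ('N[m]_p%:E[EFin \o f])%E.
Definition pint f : R := \int[m]_x (`|f x| `^ p).
(** For G >= 0 in L^p, the functional represented by the element G^(p-1) of the
    dual exponent: up to the factor p, it is the differential of [pint] at G. *)
Definition pairing G h : R := \int[m]_x (G x `^ (p - 1) * h x).

Let p0 : 0 < p. Proof. by apply: lt_trans p1. Qed.
Let p1E : (1 <= p%:E)%E. Proof. by rewrite lee_fin ltW. Qed.

Lemma Lp_measurable f : f \in Lp -> measurable_fun setT f.
Proof. by case/andP; rewrite inE. Qed.

Lemma LpP f : measurable_fun setT f -> ('N[m]_p%:E[EFin \o f] < +oo)%E -> f \in Lp.
Proof. by move=> mf nf; apply/andP; rewrite !inE. Qed.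

Lemma Lp_finite f : f \in Lp -> ('N[m]_p%:E[EFin \o f] < +oo)%E.
Proof. by case/andP => _; rewrite inE. Qed.

Lemma nrmE f : f \in Lp -> (nrm f)%:E = ('N[m]_p%:E[EFin \o f])%E.
Proof.
move=> /Lp_finite fp; rewrite /nrm fineK//.
by rewrite fin_numElt fp andbT (lt_le_trans ltNy0)// Lnorm_ge0.
Qed.

Lemma nrm_ge0 f : 0 <= nrm f.
Proof. by rewrite fine_ge0// Lnorm_ge0. Qed.

Lemma LpD f g : f \in Lp -> g \in Lp -> (fun x => f x + g x) \in Lp.
Proof.
move=> fp gp; have := Lfun_addr_closed m p1E => -[_]; exact.
Qed.

Lemma LpN f : f \in Lp -> (fun x => - f x) \in Lp.
Proof. by move=> fp; exact: (Lfun_oppr_closed fp). Qed.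

Lemma LpB f g : f \in Lp -> g \in Lp -> (fun x => f x - g x) \in Lp.
Proof. by move=> fp gp; apply: LpD => //; exact: LpN. Qed.

Lemma LpZ a f : f \in Lp -> (fun x => a * f x) \in Lp.
Proof.
move=> fp; have [_ /(_ a f (cst 0))] := Lfun_submod_closed m p1E.
rewrite (_ : a *: f + cst 0 = (fun x => a * f x)); last first.
  by apply/funext => x /=; rewrite /GRing.add/= addr0.
by apply => //; exact: Lfun_cst.
Qed.

Lemma nrmD f g : f \in Lp -> g \in Lp ->
  nrm (fun x => f x + g x) <= nrm f + nrm g.
Proof.
move=> fp gp; rewrite -lee_fin EFinD !nrmE// ?LpD//.
by apply: minkowski_EFin; [exact: Lp_measurable|exact: Lp_measurable|exact: ltW].
Qed.

Lemma nrmZ a f : f \in Lp -> nrm (fun x => a * f x) = `|a| * nrm f.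
Proof.
move=> fp; apply: EFin_inj; rewrite EFinM !nrmE// ?LpZ//.
exact: (LnormZ (Lfun_Sub p1E fp)).
Qed.

Lemma eq_nrm f g : f =1 g -> nrm f = nrm g.
Proof. by move=> /funext ->. Qed.

Lemma nrmBC f g : f \in Lp -> g \in Lp ->
  nrm (fun x => f x - g x) = nrm (fun x => g x - f x).
Proof.
move=> fp gp; rewrite -[LHS]mul1r -(normrN1 R) -nrmZ ?LpB//.
by apply: eq_nrm => x; rewrite mulN1r opprB.
Qed.

Lemma nrm_dist f g h : f \in Lp -> g \in Lp -> h \in Lp ->
  nrm (fun x => f x - h x) <= nrm (fun x => f x - g x) + nrm (fun x => g x - h x).
Proof.
move=> fp gp hp; apply: le_trans (nrmD (LpB fp gp) (LpB gp hp)).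
by rewrite le_eqVlt; apply/orP; left; apply/eqP/eq_nrm => x; rewrite addrA subrK.
Qed.

Lemma measurable_pow f : measurable_fun setT f ->
  measurable_fun setT (fun x => `|f x| `^ p).
Proof.
move=> mf; apply: (@measurableT_comp _ _ _ _ _ _ (@powR R ^~ p)) => //.
exact: measurableT_comp.
Qed.

Lemma Lp_dom f g : measurable_fun setT f -> g \in Lp ->
  (forall x, `|f x| <= `|g x|) -> f \in Lp /\ nrm f <= nrm g.
Proof.
move=> mf gp fg.
have le : ('N[m]_p%:E[EFin \o f] <= 'N[m]_p%:E[EFin \o g])%E.
  rewrite unlock /Lnorm gt0_ler_poweR ?invr_ge0 ?(ltW p0)//.
  - by rewrite in_itv/= leey integral_ge0// => x _; rewrite lee_fin powR_ge0.
  - by rewrite in_itv/= leey integral_ge0// => x _; rewrite lee_fin powR_ge0.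
  - apply: ge0_le_integral => //=.
    + by apply/measurable_EFinP; exact: measurable_pow.
    + by apply/measurable_EFinP; apply: measurable_pow; exact: Lp_measurable.
    + by move=> x _; rewrite lee_fin ge0_ler_powR ?nnegrE// ltW.
have fp : f \in Lp by apply: LpP => //; exact: le_lt_trans (Lp_finite gp).
by split=> //; rewrite -lee_fin !nrmE.
Qed.

Lemma Lp_cst a : cst a \in Lp. Proof. exact: Lfun_cst. Qed.

Lemma Lp_bounded f C : measurable_fun setT f -> (forall x, `|f x| <= C) ->
  f \in Lp /\ nrm f <= C * nrm (cst 1).
Proof.
move=> mf fC; have C0 : 0 <= C by exact: le_trans (fC point).
have [] := @Lp_dom f (fun x => C * cst 1 x) mf (LpZ C (Lp_cst 1)).
  by move=> x; rewrite /= mulr1 (ger0_norm C0).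
by move=> fp; rewrite nrmZ ?Lp_cst// (ger0_norm C0).
Qed.

Lemma Lp_integrable f : f \in Lp -> m.-integrable setT (fun x => (`|f x| `^ p)%:E).
Proof. by apply: Lfun_integrable; exact: ltW. Qed.

Lemma pint_ge0 f : 0 <= pint f.
Proof. by apply: Rintegral_ge0 => x _; exact: powR_ge0. Qed.

Lemma pintE f : f \in Lp -> (\int[m]_x (`|f x| `^ p)%:E)%E = (pint f)%:E.
Proof.
by move=> fp; rewrite /pint /Rintegral fineK// integrable_fin_num//; exact: Lp_integrable.
Qed.

Lemma pint_nrm f : f \in Lp -> pint f = nrm f `^ p.
Proof.
move=> fp; apply: EFin_inj; rewrite -poweR_EFin nrmE// powR_Lnorm ?gt_eqF//.
by rewrite -pintE.
Qed.

Lemma nrm_pint f : f \in Lp -> nrm f = pint f `^ p^-1.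
Proof. by move=> fp; rewrite pint_nrm// -powRrM mulfV ?gt_eqF// powRr1// nrm_ge0. Qed.

Lemma Lp_cvgP (u : nat -> T -> R) (v : T -> R) : Lp_cvg m p u v <->
  [/\ forall n, u n \in Lp, v \in Lp &
      nrm (fun x => u n x - v x) @[n --> \oo] --> 0].
Proof.
split=> -[up vp uv]; split=> //.
  have -> : (fun n => nrm (fun x => u n x - v x)) =
      fine \o (fun n => 'N[m]_p%:E[EFin \o (u n \- v)%R])%E by [].
  exact: (fine_cvg uv).
have -> : (fun n => 'N[m]_p%:E[EFin \o (u n \- v)%R])%E =
    (fun n => (nrm (fun x => u n x - v x))%:E).
  by apply/funext => n; rewrite nrmE// LpB.
by apply: cvg_EFin => //; exact: nearW.
Qed.

End Lp_space.

(** * Lower limits and the pairing with a power of a gradient *)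

Section limit_inferior.
Context {R : realType}.
Implicit Types (u : nat -> \bar R) (c : \bar R).

Lemma limn_einfE u : limn_einf u = ereal_sup (range (einfs u)).
Proof.
by rewrite limn_einf_lim; apply/cvg_lim => //; exact: cvg_einfs_sup.
Qed.

Lemma limn_einf_ge u c N : (forall n, (N <= n)%N -> (c <= u n)%E) ->
  (c <= limn_einf u)%E.
Proof.
move=> cu; rewrite limn_einfE.
apply: (@le_trans _ _ (einfs u N)); last by apply: ereal_sup_ubound; exists N.
by apply: le_ereal_inf_tmp => _ [n /= Nn <-]; exact: cu.
Qed.

Lemma limn_einf_le u c N : (forall n, (N <= n)%N -> (u n <= c)%E) ->
  (limn_einf u <= c)%E.
Proof.
move=> uc; rewrite limn_einfE; apply: ge_ereal_sup => _ [n _ <-].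
apply: (@le_trans _ _ (u (maxn n N))); last by rewrite uc// leq_maxr.
by apply: ereal_inf_lbound; exists (maxn n N) => //=; rewrite leq_maxl.
Qed.

Lemma limn_einf_ltP u c : (limn_einf u < c)%E ->
  forall N, exists2 n, (N <= n)%N & (u n < c)%E.
Proof.
move=> uc N; apply: contrapT => h; move: uc; apply/negP; rewrite -leNgt.
apply: (@limn_einf_ge _ _ N) => n Nn; rewrite leNgt; apply/negP => unc.
by apply: h; exists n.
Qed.

End limit_inferior.

Section Lp_duality.
Context {d : measure_display} {T : measurableType d} {R : realType}.
Variables (m : {finite_measure set T -> \bar R}) (p : R).
Hypothesis p1 : 1 < p.
Implicit Types (f g h G : T -> R) (a C : R).

Local Notation Lp := (Lfun m p%:E).
Local Notation nrm := (nrm m p).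
Local Notation pint := (pint m p).
Local Notation pairing := (pairing m p).

Let p0 : 0 < p. Proof. by apply: lt_trans p1. Qed.
Let s0 : 0 < p - 1. Proof. by rewrite subr_gt0. Qed.

Lemma measurable_pairing G h : G \in Lp -> h \in Lp ->
  measurable_fun setT (fun x => G x `^ (p - 1) * h x).
Proof.
move=> Gp hp; apply: measurable_funM; last exact: (Lp_measurable hp).
apply: (@measurableT_comp _ _ _ _ _ _ (@powR R ^~ (p - 1))) => //.
exact: (Lp_measurable Gp).
Qed.

(** Hoelder's inequality, where the norm of G^(p-1) in the dual exponent is
    the power p - 1 of the norm of G. *)
Lemma pairing_hoelder G h : G \in Lp -> (forall x, 0 <= G x) -> h \in Lp ->
  (\int[m]_x `|(G x `^ (p - 1) * h x)%:E| <= (nrm G `^ (p - 1) * nrm h)%:E)%E.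
Proof.
move=> Gp G0 hp; set q := p / (p - 1).
have q0 : 0 < q by rewrite divr_gt0.
have pq : q^-1 + p^-1 = 1 by rewrite /q; field; rewrite !gt_eqF.
have mG : measurable_fun setT (fun x => G x `^ (p - 1)).
  apply: (@measurableT_comp _ _ _ _ _ _ (@powR R ^~ (p - 1))) => //.
  exact: (Lp_measurable Gp).
have := hoelder m mG (Lp_measurable hp) q0 p0 pq.
rewrite Lnorm1 => /le_trans; apply.
rewrite [leRHS]EFinM (nrmE hp).
rewrite le_eqVlt; apply/orP; left; apply/eqP; congr (_ * _)%E.
rewrite unlock /Lnorm.
under eq_integral => x _.
  rewrite /= ger0_norm ?powR_ge0// -powRrM (_ : (p - 1) * q = p); last first.
    by rewrite /q mulrC divfK// gt_eqF.
  rewrite -{1}(ger0_norm (G0 x)).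
  over.
rewrite (pintE p1 Gp) poweR_EFin pint_nrm// -powRrM.
by rewrite /q invf_div mulrC divfK// gt_eqF.
Qed.

Lemma integrable_pairing G h : G \in Lp -> (forall x, 0 <= G x) -> h \in Lp ->
  m.-integrable setT (EFin \o (fun x => G x `^ (p - 1) * h x)).
Proof.
move=> Gp G0 hp; apply/integrableP; split.
  by apply/measurable_EFinP; exact: measurable_pairing.
by apply: le_lt_trans (pairing_hoelder Gp G0 hp) _; rewrite ltry.
Qed.

Lemma pairing_le_nrm G h : G \in Lp -> (forall x, 0 <= G x) -> h \in Lp ->
  `|pairing G h| <= nrm G `^ (p - 1) * nrm h.
Proof.
move=> Gp G0 hp; have ih := integrable_pairing Gp G0 hp.
apply: (le_trans (le_normr_Rintegral _ ih)) => //.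
rewrite -lee_fin /Rintegral fineK; first exact: pairing_hoelder.
by apply: integrable_fin_num => //; exact: (integrable_norm ih).
Qed.

Lemma pairingD G f g : G \in Lp -> (forall x, 0 <= G x) -> f \in Lp -> g \in Lp ->
  pairing G (fun x => f x + g x) = pairing G f + pairing G g.
Proof.
move=> Gp G0 fp gp; rewrite -RintegralD//; [|exact: integrable_pairing..].
by apply: eq_Rintegral => x _; rewrite mulrDr.
Qed.

Lemma pairingZ G a f : G \in Lp -> (forall x, 0 <= G x) -> f \in Lp ->
  pairing G (fun x => a * f x) = a * pairing G f.
Proof.
move=> Gp G0 fp; rewrite -RintegralZl//; last exact: integrable_pairing.
by apply: eq_Rintegral => x _; rewrite mulrCA.
Qed.

Lemma pairingB G f g : G \in Lp -> (forall x, 0 <= G x) -> f \in Lp -> g \in Lp ->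
  pairing G (fun x => f x - g x) = pairing G f - pairing G g.
Proof.
move=> Gp G0 fp gp; rewrite -RintegralB//; [|exact: integrable_pairing..].
by apply: eq_Rintegral => x _; rewrite mulrBr.
Qed.

Lemma pairing_ge0 G f : (forall x, 0 <= f x) -> 0 <= pairing G f.
Proof. by move=> f0; apply: Rintegral_ge0 => x _; rewrite mulr_ge0// powR_ge0. Qed.

Lemma pairing_self G : (forall x, 0 <= G x) -> pairing G G = pint G.
Proof.
move=> G0; apply: eq_Rintegral => x _.
by rewrite mulrC mulr_powRB1// ger0_norm.
Qed.

Lemma pairing_dual G : G \in Lp -> (forall x, 0 <= G x) -> Lp_dual m p (pairing G).
Proof.
move=> Gp G0; split=> [a u v up vp|].
  by rewrite -pairingZ// -pairingD// LpZ.
exists (nrm G `^ (p - 1)) => u up.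
by rewrite -nrmE// -EFinM lee_fin pairing_le_nrm.
Qed.

Lemma Lp_cvg_weak (u : nat -> T -> R) v : Lp_cvg m p u v -> Lp_weak_cvg m p u v.
Proof.
move=> /(Lp_cvgP m p1)[up vp uv]; split=> // phi [phiL [C phiC]].
have phiB n : phi (fun x => u n x - v x) = phi (u n) - phi v.
  have -> : (fun x => u n x - v x) = (-1 \*: v) \+ u n.
    by apply/funext => x /=; rewrite scaleN1r addrC.
  by rewrite phiL// mulN1r addrC.
apply/subr_cvg0; apply: (@squeeze_cvgr _ _ _ _ (fun n => - (C * nrm (fun x => u n x - v x)))
   (fun n => C * nrm (fun x => u n x - v x))).
- apply: nearW => n; rewrite /= -phiB -ler_norml.
  by rewrite -lee_fin EFinM nrmE ?LpB// phiC// LpB.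
- by rewrite -oppr0; apply: cvgN; rewrite -(mulr0 C); exact: cvgMr.
- by rewrite -(mulr0 C); exact: cvgMr.
Qed.

End Lp_duality.

(** * Completeness and uniform convexity of L^p *)

Section Lp_completeness.
Context {d : measure_display} {T : measurableType d} {R : realType}.
Variables (m : {finite_measure set T -> \bar R}) (p : R).
Hypothesis p1 : 1 < p.
Implicit Types (f g h G v : T -> R) (u w a b : nat -> T -> R).

Local Notation Lp := (Lfun m p%:E).
Local Notation nrm := (nrm m p).
Local Notation pint := (pint m p).
Local Notation pairing := (pairing m p).

Let p0 : 0 < p. Proof. by apply: lt_trans p1. Qed.

Lemma pint_le_nrm f (e : R) : 0 <= e -> measurable_fun setT f ->
  (\int[m]_x (`|f x| `^ p)%:E <= (e `^ p)%:E)%E -> f \in Lp /\ nrm f <= e.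
Proof.
move=> e0 mf fe.
have le : ('N[m]_p%:E[EFin \o f] <= e%:E)%E.
  rewrite unlock /Lnorm.
  have -> : (e%:E = ((e `^ p)%:E `^ p^-1))%E.
    by rewrite poweR_EFin -powRrM mulfV ?gt_eqF// powRr1.
  rewrite gt0_ler_poweR ?invr_ge0 ?(ltW p0)//.
  - by rewrite in_itv/= leey integral_ge0// => x _; rewrite lee_fin powR_ge0.
  - by rewrite in_itv/= leey lee_fin powR_ge0.
have fp : f \in Lp by apply: LpP => //; exact: le_lt_trans le (ltry _).
by split=> //; rewrite -lee_fin nrmE.
Qed.

(** Balls of L^p are closed for convergence almost everywhere. *)
Lemma nrm_fatou w f (e : R) N : 0 <= e -> measurable_fun setT f ->
  (forall k, w k \in Lp) -> (forall k, (N <= k)%N -> nrm (w k) <= e) ->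
  {ae m, forall x, w k x @[k --> \oo] --> f x} -> f \in Lp /\ nrm f <= e.
Proof.
move=> e0 mf wp we wf; apply: pint_le_nrm => //.
have mw k : measurable_fun setT (fun x => (`|w k x| `^ p)%:E).
  by apply/measurable_EFinP/measurable_pow; exact: (Lp_measurable (wp k)).
have einf0 x : (0 <= limn_einf (fun k => (`|w k x| `^ p)%:E))%E.
  by apply: (limn_einf_ge (N := 0%N)) => k _; rewrite lee_fin powR_ge0.
apply: (@le_trans _ _ (\int[m]_x limn_einf (fun k => (`|w k x| `^ p)%:E))%E).
  apply: ae_ge0_le_integral => //.
  - exact/measurable_EFinP/measurable_pow.
  - rewrite (_ : (fun _ => _) =
      (fun x => - limn_esup (fun k => (- (`|w k x| `^ p))%:E))%E); last first.
      by apply/funext => x; rewrite /limn_einf.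
    apply: measurableT_comp => //; apply: measurable_fun_limn_esup => k.
    apply/measurable_EFinP; apply: (@measurableT_comp _ _ _ _ _ _ (-%R : R -> R)) => //.
    exact/measurable_EFinP/mw.
  apply: filterS wf => x wfx _.
  (* lower semicontinuity of the power from its tangent at the limit *)
  apply/lee_addgt0Pr => eps eps0.
  have cv : p * `|f x| `^ (p - 1) * (`|w k x| - `|f x|) @[k --> \oo] --> 0.
    rewrite -(mulr0 (p * `|f x| `^ (p - 1))); apply: cvgMr.
    by apply/subr_cvg0; exact: cvg_norm.
  have [N1 _ N1P] : \forall k \near \oo,
      - eps <= p * `|f x| `^ (p - 1) * (`|w k x| - `|f x|).
    move/cvgrPdist_le : cv => /(_ eps eps0); apply: filterS => k.
    by rewrite sub0r normrN ler_norml => /andP[].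
  have : ((`|f x| `^ p - eps)%:E <= limn_einf (fun k => (`|w k x| `^ p)%:E))%E.
    apply: (limn_einf_ge (N := N1)) => k /N1P /= h; rewrite lee_fin.
    have := powR_tangent p1 (normr_ge0 (w k x)) (normr_ge0 (f x)); lra.
  by rewrite EFinB leeBlDr.
apply: (le_trans (fatou _ _ _ _)) => //.
apply: (limn_einf_le (N := N)) => k Nk.
rewrite pintE// lee_fin pint_nrm//.
by rewrite ge0_ler_powR ?nnegrE ?nrm_ge0 ?we// ltW.
Qed.

(** As m is finite, a fast subsequence is absolutely summable in L^1, hence
    converges almost everywhere; Fatou's lemma turns this into convergence in
    L^p.  The limit is built as an upper limit, which keeps it nonnegative. *)
Lemma Lp_complete u : (forall n, u n \in Lp) -> (forall n x, 0 <= u n x) ->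
  (forall e, 0 < e -> exists N, forall i j, (N <= i)%N -> (N <= j)%N ->
     nrm (fun x => u i x - u j x) <= e) ->
  exists v, [/\ v \in Lp, (forall x, 0 <= v x) & Lp_cvg m p u v].
Proof.
move=> up u0 uC.
have /choice[f fP] : forall k, exists N, forall i j, (N <= i)%N -> (N <= j)%N ->
     nrm (fun x => u i x - u j x) <= 1 / (2 ^ k.+1)%:R.
  by move=> k; apply: uC; rewrite divr_gt0// ltr0n expn_gt0.
pose n k := (\sum_(i < k.+1) (f i).+1)%N.
have nS k : n k.+1 = (n k + (f k.+1).+1)%N by rewrite /n big_ord_recr.
have fn k : (f k <= n k)%N.
  by rewrite /n big_ord_recr/= ltnW// ltn_addl.
have fnS k : (f k <= n k.+1)%N by rewrite nS (leq_trans (fn k))// leq_addr.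
have kn k : (k <= n k)%N.
  by elim: k => // k ih; rewrite nS addnS ltnS (leq_trans ih)// leq_addr.
pose w k := u (n k).
pose dw k x := `|w k.+1 x - w k x|.
have wp k : w k \in Lp by exact: up.
have dwp k : dw k \in Lp /\ nrm (dw k) <= 1 / (2 ^ k.+1)%:R.
  have wwp : (fun x => w k.+1 x - w k x) \in Lp by exact: LpB.
  have [] := @Lp_dom _ _ _ m p p1 (dw k) (fun x => w k.+1 x - w k x) _ wwp.
  - by apply: measurableT_comp => //; exact: (Lp_measurable wwp).
  - by move=> x; rewrite /dw normr_id.
  by move=> ? /le_trans h; split=> //; apply: h; exact: fP.
have mdw k : measurable_fun setT (EFin \o dw k).
  by apply/measurable_EFinP; exact: (Lp_measurable (dwp k).1).
pose C := nrm (cst 1) `^ (p - 1).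
have C0 : 0 <= C by exact: powR_ge0.
have idw k : (\int[m]_x (dw k x)%:E <= (C / (2 ^ k.+1)%:R)%:E)%E.
  have /le_trans := @pairing_hoelder _ _ _ m p p1 (cst 1) (dw k)
    (Lp_cst m p 1) (fun=> ler01) (dwp k).1.
  under eq_integral => x _.
    rewrite /= one_powR mul1r (ger0_norm (normr_ge0 _)).
    over.
  apply; rewrite lee_fin ler_wpM2l//.
  by have := (dwp k).2; rewrite div1r.
pose S x := (\sum_(k <oo) (dw k x)%:E)%E.
have iS : m.-integrable setT S.
  have S0 x : (0 <= S x)%E by apply: nneseries_ge0 => k _ _; rewrite lee_fin normr_ge0.
  have mS : measurable_fun setT S.
    apply: ge0_emeasurable_sum => [k x _ _|k _]; last exact: mdw.
    by rewrite lee_fin normr_ge0.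
  apply/integrableP; split=> //.
  under eq_integral => x _ do rewrite gee0_abs//.
  rewrite /S integral_nneseries//; last by move=> k x _; rewrite lee_fin normr_ge0.
  apply: (@le_lt_trans _ _ C%:E); last exact: ltry.
  have := @epsilon_trick R (fun=> 0%E) C xpredT (fun=> lexx _) C0.
  rewrite [X in (_ <= X + _)%E]eseries0// add0e; apply: le_trans.
  apply: lee_nneseries => [k _ _|k _]; last by rewrite add0e.
  by apply: integral_ge0 => x _; rewrite lee_fin normr_ge0.
pose v x := fine (limn_esup (fun k => (w k x)%:E)).
have wv : {ae m, forall x, w k x @[k --> \oo] --> v x}.
  have := integrable_ae measurableT iS; apply: filterS => x /(_ I) Sx.
  have cw : cvgn (w ^~ x).
    have -> : w ^~ x = (fun k => w 0%N x + series (telescope (w ^~ x)) k).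
      by apply/funext => k; rewrite -eq_sum_telescope.
    apply: is_cvgD; first exact: is_cvg_cst.
    apply: normed_cvg; apply: nondecreasing_is_cvgn.
      by apply: nondecreasing_series => *; exact: normr_ge0.
    exists (fine (S x)) => _ [k _ <-].
    rewrite -lee_fin fineK//.
    have := @nneseries_lim_ge R (fun i => (dw i x)%:E) xpredT 0 k.
    rewrite sumEFin => h; apply: h => i _ _; by rewrite lee_fin normr_ge0.
  suff -> : v x = limn (w ^~ x) by exact: cw.
  rewrite /v (_ : limn_esup _ = (limn (w ^~ x))%:E)//.
  rewrite is_cvg_limn_esupE; last first.
    by apply/cvg_ex; exists (limn (w ^~ x))%:E; apply: cvg_EFin => //; exact: nearW.
  by apply/cvg_lim => //; apply: cvg_EFin => //; exact: nearW.
have mv : measurable_fun setT v.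
  apply: measurableT_comp => //; apply: measurable_fun_limn_esup => k.
  by apply/measurable_EFinP; exact: (Lp_measurable (wp k)).
have v0 x : 0 <= v x.
  apply: fine_ge0; apply: le_trans (limn_einf_sup _).
  by apply: (limn_einf_ge (N := 0%N)) => k _; rewrite lee_fin; exact: u0.
have uv e : 0 < e -> exists N, forall i, (N <= i)%N ->
    (fun x => u i x - v x) \in Lp /\ nrm (fun x => u i x - v x) <= e.
  move=> e0; have [N NP] := uC _ e0; exists N => i Ni.
  apply: (@nrm_fatou (fun k x => u i x - w k x) _ e N (ltW e0)).
  - by apply: measurable_funB => //; exact: (Lp_measurable (up i)).
  - by move=> k; exact: LpB.
  - by move=> k Nk; apply: NP => //; rewrite (leq_trans Nk).
  - by apply: filterS wv => x wvx; apply: cvgB => //; exact: cvg_cst.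
have vp : v \in Lp.
  have [N /(_ N (leqnn N))[uvp _]] := uv 1 ltr01.
  have := LpB p1 (up N) uvp; rewrite (_ : (fun x => _) = v)//.
  by apply/funext => x; rewrite subKr.
exists v; split=> //; apply/Lp_cvgP => //; split=> //.
apply/cvgrPdist_le => e e0; have [N NP] := uv e e0.
exists N => // i /NP[_]; by rewrite /= sub0r normrN ger0_norm ?nrm_ge0.
Qed.

(** Uniform convexity, for sequences: if the midpoints have asymptotically the
    same p-th moments as the terms, the integral of the midpoint gap tends to
    0 and bounds the distances. *)
Lemma Lp_unif_convex a (E : R) : (forall n, a n \in Lp) ->
  (forall n x, 0 <= a n x) -> pint (a n) @[n --> \oo] --> E ->
  (forall e, 0 < e -> exists N, forall i j, (N <= i)%N -> (N <= j)%N ->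
     E - e <= pint (fun x => (a i x + a j x) / 2)) ->
  forall e, 0 < e -> exists N, forall i j, (N <= i)%N -> (N <= j)%N ->
     nrm (fun x => a i x - a j x) <= e.
Proof.
move=> ap a0 aE mid e e0.
have E0 : 0 <= E.
  rewrite -(cvg_lim _ aE)//; apply: limr_ge; first exact: cvgP aE.
  by apply: nearW => n; exact: pint_ge0.
have ep : 0 < e `^ p by rewrite powR_gt0.
have E1 : 0 < 2 * (E + 1) by rewrite mulr_gt0// ltr_wpDl.
pose eta := e `^ p / 2 / (2 * (E + 1)).
have eta0 : 0 < eta by rewrite !divr_gt0.
have [C C0 CP] := powR_unif_convex p1 eta0.
pose r := Num.min 1 (e `^ p / 4 / (C + 1)).
have r0 : 0 < r by rewrite lt_min ltr01/= !divr_gt0// ltr_wpDl.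
have [N1 _ N1P] : \forall n \near \oo, pint (a n) <= E + r.
  by apply: (cvgr_le E aE); rewrite ltrDl.
have [N2 N2P] := mid r r0.
exists (maxn N1 N2) => i j; rewrite !geq_max => /andP[/N1P /= i1 i2] /andP[/N1P /= j1 j2].
have ij := N2P _ _ i2 j2.
have ijp : (fun x => (a i x + a j x) / 2) \in Lp.
  have := LpZ p1 2^-1 (LpD p1 (ap i) (ap j)).
  rewrite (_ : (fun x => _) = (fun x => (a i x + a j x) / 2))//.
  by apply/funext => x; rewrite mulrC.
have ijB := LpB p1 (ap i) (ap j).
have int1 n : m.-integrable setT (EFin \o (fun x => a n x `^ p)).
  have := Lp_integrable p1 (ap n).
  by under eq_fun => x do rewrite ger0_norm//.
have int2 : m.-integrable setT (EFin \o (fun x => ((a i x + a j x) / 2) `^ p)).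
  have := Lp_integrable p1 ijp.
  by under eq_fun => x do rewrite ger0_norm ?divr_ge0 ?addr_ge0//.
have intS : m.-integrable setT (EFin \o (fun x => a i x `^ p + a j x `^ p)).
  by have := integrableD measurableT (int1 i) (int1 j); apply: eq_integrable.
have pintE n : pint (a n) = \int[m]_x (a n x `^ p).
  by apply: eq_Rintegral => x _; rewrite ger0_norm.
have intZ k (F : T -> R) : m.-integrable setT (EFin \o F) ->
    m.-integrable setT (EFin \o (fun x => k * F x)).
  by move=> iF; have := integrableZl measurableT k iF; apply: eq_integrable.
have gapE x : midpoint_gap p (a i x) (a j x) =
  2^-1 * (a i x `^ p + a j x `^ p) - ((a i x + a j x) / 2) `^ p.
  by rewrite /midpoint_gap mulrC.
have intG : m.-integrable setT (EFin \o (fun x => midpoint_gap p (a i x) (a j x))).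
  have := integrableB measurableT (intZ 2^-1 _ intS) int2.
  by apply: eq_integrable => // x _; rewrite /= gapE.
have : pint (fun x => a i x - a j x) <=
    eta * (pint (a i) + pint (a j)) +
    C * (2^-1 * (pint (a i) + pint (a j)) - pint (fun x => (a i x + a j x) / 2)).
  have -> : pint (fun x => (a i x + a j x) / 2) = \int[m]_x (((a i x + a j x) / 2) `^ p).
    by apply: eq_Rintegral => x _; rewrite ger0_norm// divr_ge0// addr_ge0.
  set S := \int[m]_x (a i x `^ p + a j x `^ p).
  have -> : pint (a i) + pint (a j) = S by rewrite !pintE -RintegralD.
  have <- : \int[m]_x (midpoint_gap p (a i x) (a j x)) =
      2^-1 * S - \int[m]_x (((a i x + a j x) / 2) `^ p).
    rewrite -RintegralZl// -RintegralB//; last exact: intZ.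
    by apply: eq_Rintegral => x _; rewrite gapE.
  rewrite -!RintegralZl// -RintegralD//; [|exact: intZ..].
  apply: le_Rintegral => //.
  - by have := Lp_integrable p1 ijB.
  - by have := integrableD measurableT (intZ eta _ intS) (intZ C _ intG); apply: eq_integrable.
  - by move=> x _; exact: CP.
(* the remaining estimate only involves the values of the integrals *)
move: (pint_nrm p1 ijB) ij i1 j1; move: (nrm_ge0 m p (fun x => a i x - a j x)).
move: (pint (fun x => _ - _)) (pint (fun x => _ / 2)) (pint (a i)) (pint (a j)).
move: (nrm _) => n D M x y n0 Dn Mr xr yr h.
have : D <= e `^ p.
  apply: (le_trans h); rewrite [leRHS](splitr (e `^ p)) lerD//.
    have r1 : r <= 1 by rewrite ge_min lexx.
    have : eta * (x + y) <= eta * (2 * (E + 1)) by rewrite ler_pM2l//; lra.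
    by rewrite {2}/eta divfK ?gt_eqF.
  have rC : r * (C + 1) <= e `^ p / 4.
    by rewrite -ler_pdivlMr ?ltr_wpDl// ge_min lexx orbT.
  have : C * (2^-1 * (x + y) - M) <= C * (2 * r) by rewrite ler_wpM2l//; lra.
  lra.
rewrite Dn => /(@ge0_ler_powR _ p^-1).
rewrite invr_ge0 (ltW p0) !nnegrE !powR_ge0 => /(_ isT isT isT).
by rewrite -!powRrM mulfV ?gt_eqF// !powRr1// ltW.
Qed.

End Lp_completeness.

(** * First variation of the L^p norm *)

Section Lp_variations.
Context {d : measure_display} {T : measurableType d} {R : realType}.
Variables (m : {finite_measure set T -> \bar R}) (p : R).
Hypothesis p1 : 1 < p.
Implicit Types (f g h G u v w : T -> R) (b : nat -> T -> R).

Local Notation Lp := (Lfun m p%:E).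
Local Notation nrm := (nrm m p).
Local Notation pint := (pint m p).
Local Notation pairing := (pairing m p).

Let p0 : 0 < p. Proof. by apply: lt_trans p1. Qed.

(** If the norms were unbounded, choose b_(k j) of norm above 2^(j+1) 2^j, and add
    up, with weights 2^-(j+1), the functionals norming them.  All terms are
    nonnegative on the nonnegative functions b_n, so that the sum is at least
    2^j on b_(k j), although it converges along b. *)
Lemma weak_cvg_bounded b v : (forall n x, 0 <= b n x) -> Lp_weak_cvg m p b v ->
  exists2 C, 0 <= C & forall n, nrm (b n) <= C.
Proof.
move=> b0 [bp vp bv]; apply: contrapT => hC.
have unbounded C : exists n, C < nrm (b n).
  apply: contrapT => /forallNP h; apply: hC; exists (Num.max 0 C).
    by rewrite le_max lexx.
  by move=> n; rewrite le_max; apply/orP; right; rewrite leNgt; apply/negP; exact: h.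
have /choice[k kP] : forall j, exists n, (2 ^ j.+1)%:R * (2 ^ j)%:R < nrm (b n).
  by move=> j; exact: unbounded.
have twogt0 j : 0 < (2 ^ j)%:R :> R by rewrite ltr0n expn_gt0.
have N0 j : 0 < nrm (b (k j)) by apply: le_lt_trans (kP j); rewrite mulr_ge0.
pose term u j := pairing (b (k j)) u / nrm (b (k j)) `^ (p - 1) / (2 ^ j.+1)%:R.
have term_le u j : u \in Lp -> `|term u j| <= nrm u / (2 ^ j.+1)%:R.
  move=> up; have c0 := powR_gt0 (p - 1) (N0 j).
  rewrite /term !normrM !normfV (gtr0_norm c0) (gtr0_norm (twogt0 _)).
  rewrite ler_pM2r ?invr_gt0// ler_pdivrMr// [leRHS]mulrC.
  exact: pairing_le_nrm.
have halfcvg (r : R) : series (fun j => r / (2 ^ j.+1)%:R) @ \oo --> r.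
  have := @cvg_geometric_series_half R r 0; rewrite expr0 divr1.
  by under eq_fun do rewrite addn1.
have cvgabs u : u \in Lp -> cvgn [normed series (term u)].
  move=> up; apply: (@series_le_cvg _ _ (fun j => nrm u / (2 ^ j.+1)%:R)) => //.
  - by move=> j; exact: normr_ge0.
  - by move=> j; rewrite divr_ge0// nrm_ge0.
  - by move=> j; exact: term_le.
  - exact: cvgP (halfcvg _).
have cvgterm u : u \in Lp -> cvgn (series (term u)).
  by move=> /cvgabs; exact: normed_cvg.
pose phi u := limn (series (term u)) : R.
have phiD : Lp_dual m p phi.
  split=> [r u w up wp|].
    have ru : (r \*: u : T -> R) \in Lp by exact: LpZ.
    rewrite /phi; apply/cvg_lim => //.
    rewrite (_ : series _ = (fun n => r * series (term u) n + series (term w) n)).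
      by apply: cvgD; [apply: cvgMr|]; exact: cvgterm.
    apply/funext => n; rewrite /series/= mulr_sumr -big_split/=.
    apply: eq_bigr => j _; rewrite /term.
    have -> : pairing (b (k j)) ((r \*: u) \+ w) =
        r * pairing (b (k j)) u + pairing (b (k j)) w.
      by rewrite -pairingZ// -pairingD.
    by rewrite !mulrDl !mulrA.
  exists 1 => u up; rewrite mul1e -nrmE// lee_fin.
  apply: le_trans (lim_series_norm (cvgabs _ up)) _.
  rewrite -(cvg_lim _ (halfcvg (nrm u)))//; apply: lim_series_le.
  - exact: cvgabs.
  - exact: cvgP (halfcvg _).
  - by move=> j; exact: term_le.
have phib j : (2 ^ j)%:R <= phi (b (k j)).
  have t0 i : 0 <= term (b (k j)) i.
    by rewrite /term !divr_ge0 ?powR_ge0// pairing_ge0.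
  have tj : (2 ^ j)%:R <= term (b (k j)) j.
    rewrite /term pairing_self// pint_nrm// -(mulr_powRB1 (ltW (N0 j)) p0).
    rewrite mulfK ?gt_eqF ?powR_gt0// ler_pdivlMr// mulrC ltW//; exact: kP.
  apply: (le_trans tj); apply: (@le_trans _ _ (series (term (b (k j))) j.+1)).
    rewrite /series/= big_nat_recr//= lerDr; apply: sumr_ge0 => i _; exact: t0.
  by apply: nondecreasing_cvgn_le; [exact: nondecreasing_series|exact: cvgterm].
have /cvg_seq_bounded [M [_ /(_ (M + 1))]] := cvgP _ (bv _ phiD).
rewrite ltrDl ltr01 => /(_ isT) bound.
pose j := Num.bound `|M + 1|.
have := bound (k j) I => /=; apply/negP; rewrite -ltNge.
apply: (@lt_le_trans _ _ (2 ^ j)%:R); last first.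
  by apply: le_trans (phib j) _; exact: ler_norm.
apply: (@le_lt_trans _ _ `|M + 1|); first exact: ler_norm.
apply: (lt_le_trans (archi_boundP (normr_ge0 _))).
by rewrite -/j ler_nat ltnW// ltn_expl.
Qed.

Lemma pint_unif_diff (eta : R) : 0 < eta -> exists2 t, 0 < t < 1 &
  forall G h, G \in Lp -> h \in Lp -> (forall x, 0 <= G x) ->
    (forall x, 0 <= h x) ->
  pint (fun x => (1 - t) * G x + t * h x) <=
  pint G + t * (p * (pairing G h - pint G)) + t * (eta * (pint G + pint h)).
Proof.
move=> eta0; have [t t01 tP] := powR_unif_diff p1 eta0; exists t => //.
move: t01 => /andP[t0 t1] G h Gp hp G0 h0.
have zp : (fun x => (1 - t) * G x + t * h x) \in Lp by apply: LpD; rewrite ?LpZ.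
have z0 x : 0 <= (1 - t) * G x + t * h x.
  by rewrite addr_ge0// mulr_ge0// ?subr_ge0 ltW.
have iG := Lp_integrable p1 Gp; have ih := Lp_integrable p1 hp.
have iGh := integrable_pairing p1 Gp G0 (LpB p1 hp Gp).
have iS := integrableD measurableT iG ih.
have iZ k (F : T -> \bar R) : m.-integrable setT F ->
    m.-integrable setT (fun x => k%:E * F x)%E by exact: integrableZl.
have -> : pairing G h - pint G = pairing G (fun x => h x - G x).
  by rewrite pairingB// pairing_self.
have -> : pint G + pint h = \int[m]_x (`|G x| `^ p + `|h x| `^ p).
  by rewrite RintegralD.
have iA := iZ t _ (iZ p _ iGh); have iB := iZ t _ (iZ eta _ iS).
have iGA := integrableD measurableT iG iA.
rewrite -!RintegralZl//; [|exact: (iZ eta _ iS)|exact: (iZ p _ iGh)].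
rewrite -RintegralD// -RintegralD//.
apply: le_Rintegral => //.
- exact: Lp_integrable.
- exact: (integrableD measurableT iGA iB).
- move=> x _; rewrite !ger0_norm//; exact: tP.
Qed.

(** The integrand |h|^p - G^p - p G^(p-1) (h - G) is nonnegative and vanishes
    only where h = G; the hypothesis bounds its integral by the difference of
    the p-th moments. *)
Lemma pint_minimal G h : G \in Lp -> (forall x, 0 <= G x) -> h \in Lp ->
  pint G <= pairing G h ->
  pint G <= pint h /\ (pint h <= pint G -> h = G %[ae m]).
Proof.
move=> Gp G0 hp Gh.
pose D x := `|h x| `^ p - (`|G x| `^ p + p * (G x `^ (p - 1) * (h x - G x))).
have D0 x : 0 <= D x /\ (D x = 0 -> h x = G x).
  have := powR_tangent p1 (normr_ge0 (h x)) (G0 x).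
  rewrite /D (ger0_norm (G0 x)).
  have c0 : 0 <= p * G x `^ (p - 1) by rewrite mulr_ge0 ?powR_ge0// ltW.
  have : p * G x `^ (p - 1) * (h x - G x) <= p * G x `^ (p - 1) * (`|h x| - G x).
    by rewrite ler_wpM2l// lerD2r ler_norm.
  rewrite !mulrA => h1 h2; split; first by lra.
  move=> Dx0; have [hG|] := eqVneq `|h x| (G x).
    have [h0|h0] := leP 0 (h x); first by rewrite -hG ger0_norm.
    have Gx0 : 0 < G x by rewrite -hG normr_gt0 lt_eqF.
    have : 0 < p * G x `^ (p - 1) by rewrite mulr_gt0// powR_gt0.
    by move: Dx0; rewrite hG; nra.
  by move=> /(powR_tangent_lt p1 (normr_ge0 _) (G0 x)); lra.
have iG := Lp_integrable p1 Gp; have ih := Lp_integrable p1 hp.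
have iGh := integrable_pairing p1 Gp G0 (LpB p1 hp Gp).
have iZ := integrableZl measurableT p iGh.
have iT := integrableD measurableT iG iZ.
have iD : m.-integrable setT (EFin \o D) by exact: (integrableB measurableT ih iT).
have DE : \int[m]_x D x = pint h - (pint G + p * (pairing G h - pint G)).
  rewrite RintegralB// RintegralD// RintegralZl//.
  by rewrite -[X in pairing G h - X](pairing_self m p1 G0) -pairingB.
have D_ge0 : 0 <= \int[m]_x D x by apply: Rintegral_ge0 => x _; exact: (D0 x).1.
have pGh : 0 <= p * (pairing G h - pint G) by rewrite mulr_ge0 ?subr_ge0// ltW.
move: DE; move: pGh; set X := p * _; set Y := \int[m]_x D x in D_ge0 *.
set A := pint h; set B := pint G => X0 YE; split; first by lra.
move=> hG; have Y0 : Y = 0 by lra.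
have mD : measurable_fun setT (EFin \o D) by case/integrableP : iD.
have : (\int[m]_x `|(EFin \o D) x|)%E = 0%E.
  under eq_integral => x _ do rewrite gee0_abs ?lee_fin ?(D0 x).1//.
  by rewrite -(fineK (integrable_fin_num _ iD))// -[fine _]/Y Y0.
move/(ae_eq_integral_abs m measurableT mD); apply: filterS => x /(_ I) [Dx0] _.
exact: (D0 x).2.
Qed.

End Lp_variations.

Section Lp_limits.
Context {d : measure_display} {T : measurableType d} {R : realType}.
Variables (m : {finite_measure set T -> \bar R}) (p : R).
Hypothesis p1 : 1 < p.
Implicit Types (f g h G u v w : T -> R) (a b : nat -> T -> R) (e : R).

Local Notation Lp := (Lfun m p%:E).
Local Notation nrm := (nrm m p).
Local Notation pint := (pint m p).
Local Notation pairing := (pairing m p).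

Let p0 : 0 < p. Proof. by apply: lt_trans p1. Qed.
Let s0 : 0 < p - 1. Proof. by rewrite subr_gt0. Qed.

Lemma pint_tangent G h : G \in Lp -> h \in Lp -> (forall x, 0 <= G x) ->
  (forall x, 0 <= h x) ->
  pint G + p * pairing G (fun x => h x - G x) <= pint h.
Proof.
move=> Gp hp G0 h0.
have iG := Lp_integrable p1 Gp; have ih := Lp_integrable p1 hp.
have iGh := integrable_pairing p1 Gp G0 (LpB p1 hp Gp).
have iZ := integrableZl measurableT p iGh.
rewrite -RintegralZl// -RintegralD//.
apply: le_Rintegral => //; first exact: (integrableD measurableT iG iZ).
move=> x _; rewrite !ger0_norm// mulrA; exact: powR_tangent.
Qed.

Lemma pint_dist G h : G \in Lp -> h \in Lp -> (forall x, 0 <= G x) ->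
  (forall x, 0 <= h x) ->
  pint G - pint h <= p * nrm G `^ (p - 1) * nrm (fun x => h x - G x).
Proof.
move=> Gp hp G0 h0; have h1 := pint_tangent Gp hp G0 h0.
have := pairing_le_nrm p1 Gp G0 (LpB p1 hp Gp).
rewrite ler_norml => /andP[/(ler_wpM2l (ltW p0)) + _].
move: h1; set Y := pairing _ _; set Z := nrm _ `^ _; set W := nrm (fun x => _).
rewrite -mulrA; set V := Z * W; move: (pint G) (pint h) => x y; lra.
Qed.

Lemma le_pint g h : g \in Lp -> h \in Lp -> (forall x, `|g x| <= `|h x|) -> pint g <= pint h.
Proof.
move=> gp hp gh; apply: le_Rintegral => //; [exact: Lp_integrable..|].
by move=> x _; rewrite ge0_ler_powR ?nnegrE// ltW.
Qed.

Lemma pint_cvg a G : Lp_cvg m p a G -> (forall n x, 0 <= a n x) ->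
  (forall x, 0 <= G x) -> pint (a n) @[n --> \oo] --> pint G.
Proof.
move=> /(Lp_cvgP m p1)[ap Gp aG] a0 G0.
apply/cvgrPdist_le => e e0.
pose M := nrm G + 1; have M0 : 0 < M by rewrite ltr_wpDl// nrm_ge0.
have c0 : 0 < p * M `^ (p - 1) by rewrite mulr_gt0// powR_gt0.
have t0 : 0 < Num.min 1 (e / (p * M `^ (p - 1))) by rewrite lt_min ltr01 divr_gt0.
move/cvgrPdist_le : aG => /(_ _ t0); apply: filterS => n.
rewrite sub0r normrN ger0_norm ?nrm_ge0// le_min => /andP[h1].
rewrite ler_pdivlMr// => h2.
have aM : nrm (a n) <= M.
  have := nrmD p1 Gp (LpB p1 (ap n) Gp).
  rewrite (_ : nrm (fun x => _ + _) = nrm (a n)); last first.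
    by apply: eq_nrm => x; rewrite addrC subrK.
  by move/le_trans; apply; rewrite /M lerD2l.
have low g : 0 <= nrm g -> nrm g <= M -> p * nrm g `^ (p - 1) <= p * M `^ (p - 1).
  by move=> g0 gM; rewrite ler_pM2l// ge0_ler_powR ?nnegrE ?(ltW M0)// ltW.
have d1 := pint_dist Gp (ap n) G0 (a0 n).
have d2 := pint_dist (ap n) Gp (a0 n) G0.
rewrite (nrmBC p1 Gp (ap n)) in d2.
have GM : nrm G <= M by rewrite lerDl.
have := ler_wpM2r (nrm_ge0 m p (fun x => a n x - G x)) (low _ (nrm_ge0 m p G) GM).
have := ler_wpM2r (nrm_ge0 m p (fun x => a n x - G x)) (low _ (nrm_ge0 m p (a n)) aM).
move: d1 d2 h2; set N := nrm (fun x => a n x - G x).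
rewrite [N * _]mulrC.
set u := _ * N; set v := _ * N; set w := _ * N.
move: (pint G) (pint (a n)) => x y *.
by rewrite ler_norml; apply/andP; split; lra.
Qed.

(** Here f <= g holds almost everywhere only: g - f is replaced by its
    positive part. *)
Lemma le_pairing_ae G f g : G \in Lp -> (forall x, 0 <= G x) -> f \in Lp -> g \in Lp ->
  {ae m, forall x, f x <= g x} -> pairing G f <= pairing G g.
Proof.
move=> Gp G0 fp gp fg; rewrite -subr_ge0 -pairingB//.
have hp := LpB p1 gp fp.
have mh := Lp_measurable hp.
rewrite (_ : pairing G _ = pairing G (fun x => Num.max 0 (g x - f x))).
  by apply: pairing_ge0 => x; rewrite le_max lexx.
rewrite /pairing /Rintegral; congr fine; apply: ae_eq_integral => //.
- by apply/measurable_EFinP; exact: (measurable_pairing Gp hp).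
- apply/measurable_EFinP; apply: measurable_funM; last exact: measurable_maxr.
  apply: (@measurableT_comp _ _ _ _ _ _ (@powR R ^~ (p - 1))) => //.
  exact: (Lp_measurable Gp).
- by apply: filterS fg => x fgx _; rewrite (max_idPr _)// subr_ge0.
Qed.

End Lp_limits.

Lemma Lp_cvg_ae {d' : measure_display} {T : measurableType d'} {R : realType}
    (m : {finite_measure set T -> \bar R}) (p : R) (u : nat -> T -> R) (v w : T -> R) :
  1 < p -> w \in Lfun m p%:E -> w = v %[ae m] -> Lp_cvg m p u v -> Lp_cvg m p u w.
Proof.
move=> p1 wp wv /(Lp_cvgP m p1)[up vp uv]; apply/(Lp_cvgP m p1); split=> //.
have vw0 : nrm m p (fun x => v x - w x) = 0.
  have h := LpB p1 vp wp; have p0 : 0 < p by exact: lt_trans p1.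
  rewrite nrm_pint// (_ : pint _ _ _ = 0) ?powR0 ?invr_neq0 ?gt_eqF//.
  rewrite /pint /Rintegral (@ae_eq_integral _ _ _ m setT (cst 0%E)) ?integral0//.
    exact/measurable_EFinP/measurable_pow/(Lp_measurable h).
  apply: filterS wv => x /(_ I) wvx _.
  by rewrite wvx subrr normr0 powR0// gt_eqF.
apply: (@squeeze_cvgr _ _ _ _ (fun=> 0) (fun n => nrm m p (fun x => u n x - v x))) => //.
  apply: nearW => n; rewrite nrm_ge0/=.
  by rewrite (le_trans (nrm_dist p1 (up n) vp wp))// vw0 addr0.
exact: cvg_cst.
Qed.

(** * Local Lipschitz constants *)

Section local_lipschitz.
Context {R : realType} {X : ptopologicalType}.
Variable d : X -> X -> \bar R.
Hypothesis dE : extended_distance d.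
Implicit Types (f g h q : X -> R) (U : set X) (L c e : R) (x y z : X).

(** Pairs at infinite distance impose nothing, so that all computations take
    place in the reals; with L > 0 this is the condition in the definition of
    Lip. *)
Definition lip_on L U f := forall y z, U y -> U z -> d y z \is a fin_num ->
  `|f y - f z| <= L * fine (d y z).

Lemma fine_dist_ge0 x y : 0 <= fine (d x y).
Proof. by apply: fine_ge0; exact: (Defs.edist_ge0 dE). Qed.

Lemma lip_on_le L L' U U' f : L <= L' -> U' `<=` U -> lip_on L U f -> lip_on L' U' f.
Proof.
move=> LL UU h y z /UU Uy /UU Uz dyz; apply: le_trans (h _ _ Uy Uz dyz) _.
by rewrite ler_wpM2r// fine_dist_ge0.
Qed.

Lemma Lip_le L U f : 0 <= L -> lip_on L U f -> (Lip d f U <= L%:E)%E.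
Proof.
move=> L0 h; apply/lee_addgt0Pr => e e0; apply: ereal_inf_lbound; split.
  by rewrite -EFinD lee_fin addr_ge0// ltW.
move=> y z Uy Uz; have := Defs.edist_ge0 dE y z.
case E : (d y z) => [r| |] // r0; last first.
  by rewrite -EFinD gt0_muley ?leey// lte_fin ltr_wpDl.
rewrite -EFinD -EFinM lee_fin.
have := h _ _ Uy Uz; rewrite E => /(_ isT) /= /le_trans; apply.
by rewrite ler_wpM2r// lerDl ltW.
Qed.

Lemma Lip_lt L U f : (Lip d f U < L%:E)%E -> lip_on L U f.
Proof.
move=> /ereal_inf_lt[l [l0 h] lL] y z Uy Uz dyz.
rewrite -lee_fin EFinM fineK//; apply: le_trans (h _ _ Uy Uz) _.
by apply: lee_wpmul2r; [exact: (Defs.edist_ge0 dE)|exact: ltW].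
Qed.

(** The infimum need not be attained in general; for the value 1 it is. *)
Lemma Lip_le1 U f : (Lip d f U <= 1)%E -> lip_on 1 U f.
Proof.
move=> f1 y z Uy Uz dyz; rewrite mul1r; apply/ler_addgt0Pr => e e0.
have r0 : 0 < fine (d y z) + 1 by rewrite ltr_wpDl// fine_dist_ge0.
pose c := e / (fine (d y z) + 1).
have c0 : 0 < c by rewrite divr_gt0.
have : (Lip d f U < (1 + c)%:E)%E by apply: le_lt_trans f1 _; rewrite lte_fin ltrDl.
move=> /Lip_lt/(_ _ _ Uy Uz dyz)/le_trans; apply.
rewrite mulrDl mul1r lerD2l /c mulrAC ler_pdivrMr//.
by rewrite ler_pM2l// lerDl.
Qed.

Lemma Lipb_lip_on f : Lipb d f -> exists2 L, 0 < L & lip_on L setT f.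
Proof.
move=> [_ fL]; exists (Num.max 1 (fine (Lip d f setT) + 1)).
  by rewrite lt_max ltr01.
apply: (@lip_on_le (fine (Lip d f setT) + 1) _ setT) => //.
  by rewrite le_max lexx orbT.
have fn : Lip d f setT \is a fin_num.
  rewrite fin_numElt fL andbT; apply: (lt_le_trans ltNy0).
  by apply: le_ereal_inf_tmp => l [].
by apply: Lip_lt; rewrite EFinD fineK// lteDl// lte_fin.
Qed.

Lemma lip_on_Lipb L f : Cb f -> 0 <= L -> lip_on L setT f -> Lipb d f.
Proof.
move=> fC L0 fL; split=> //; apply: le_lt_trans (Lip_le L0 fL) _; exact: ltry.
Qed.

Let lipE f x := ereal_inf [set Lip d f U | U in nbhs x].

Let lipE_ge0 f x : (0 <= lipE f x)%E.
Proof.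
apply: le_ereal_inf_tmp => _ [U _ <-].
by apply: le_ereal_inf_tmp => l [].
Qed.

Lemma lip_ge0 f x : 0 <= lip d f x.
Proof. by apply: fine_ge0; exact: lipE_ge0. Qed.

Lemma lip_le f x L U : nbhs x U -> 0 <= L -> lip_on L U f -> lip d f x <= L.
Proof.
move=> Ux L0 fU.
have fL : (lipE f x <= L%:E)%E.
  apply: (@le_trans _ _ (Lip d f U)); last exact: Lip_le.
  by apply: ereal_inf_lbound; exists U.
rewrite -lee_fin /lip fineK//.
rewrite fin_numElt (le_lt_trans fL (ltry _)) andbT.
exact: lt_le_trans ltNy0 (lipE_ge0 _ _).
Qed.

Lemma lip_lt f x c : Lipb d f -> lip d f x < c -> exists2 U, nbhs x U & lip_on c U f.
Proof.
move=> [_ fL] fxc; have : (lipE f x < c%:E)%E.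
  rewrite -[lipE f x]fineK ?lte_fin// fin_numElt.
  rewrite (lt_le_trans ltNy0 (lipE_ge0 _ _))/=.
  apply: le_lt_trans fL; apply: ereal_inf_lbound; exists setT => //.
  exact: filterT.
by move=> /ereal_inf_lt[_ [U xU <-]] /Lip_lt fU; exists U.
Qed.

Lemma lip_le_eps f x L : 0 <= L ->
  (forall e, 0 < e -> exists2 U, nbhs x U & lip_on (L + e) U f) -> lip d f x <= L.
Proof.
move=> L0 h; apply/ler_addgt0Pr => e e0; have [U xU fU] := h e e0.
by apply: lip_le xU _ fU; rewrite addr_ge0// ltW.
Qed.

(** Upper semicontinuity of lip: a neighbourhood that is good for x is good for
    the points of its interior. *)
Lemma open_lip_lt f c : Lipb d f -> open [set x | lip d f x < c].
Proof.
move=> fL; rewrite openE => x /= fxc.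
have [U xU fU] := lip_lt fL (midf_lt fxc).1.
apply: filterS (nbhs_interior xU) => y /= yU.
apply: le_lt_trans (midf_lt fxc).2; apply: lip_le yU _ fU.
by have := lip_ge0 f x; lra.
Qed.

Lemma measurable_lip f : Lipb d f -> measurable_fun setT (lip d f : borel X -> R).
Proof.
move=> fL; apply: (measurability _ (RGenInftyO.measurableE R)) => //.
move=> _ [_ [c ->] <-]; apply: sub_sigma_algebra; rewrite setTI.
rewrite (_ : _ @^-1` _ = [set x | lip d f x < c]); first exact: open_lip_lt.
by apply/seteqP; split=> x /=; rewrite in_itv.
Qed.

Lemma measurable_continuous f : continuous f ->
  measurable_fun setT (f : borel X -> R).
Proof.
move=> fC; apply: (measurability _ (RGenOpens.measurableE R)) => //.
move=> _ [_ [a [b ->]] <-]; apply: sub_sigma_algebra; rewrite setTI.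
by move/continuousP : fC; apply; exact: interval_open.
Qed.

End local_lipschitz.

Section lip_arithmetic.
Context {R : realType} {X : ptopologicalType}.
Variable d : X -> X -> \bar R.
Hypothesis dE : extended_distance d.
Implicit Types (f g h q : X -> R) (U : set X) (L a b c e : R) (x y z : X).

Lemma near_lip f x e : Lipb d f -> 0 < e ->
  exists2 U, nbhs x U & lip_on d (lip d f x + e) U f.
Proof. by move=> fL e0; apply: (lip_lt dE) => //; rewrite ltrDl. Qed.

Lemma lip_linear a b f g x : Lipb d f -> Lipb d g ->
  lip d (fun y => a * f y + b * g y) x <= `|a| * lip d f x + `|b| * lip d g x.
Proof.
move=> fL gL; apply: (lip_le_eps dE).
  by rewrite addr_ge0// mulr_ge0// lip_ge0.
move=> e e0; have D0 : 0 < `|a| + `|b| + 1 by rewrite ltr_wpDl// addr_ge0.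
pose t := e / (`|a| + `|b| + 1).
have t0 : 0 < t by rewrite divr_gt0.
have [U xU fU] := near_lip x fL t0; have [V xV gV] := near_lip x gL t0.
exists (U `&` V); first exact: filterI.
move=> y z [Uy Vy] [Uz Vz] dyz.
have {}fU := fU _ _ Uy Uz dyz; have {}gV := gV _ _ Vy Vz dyz.
have r0 := fine_dist_ge0 dE y z.
have -> : a * f y + b * g y - (a * f z + b * g z) = a * (f y - f z) + b * (g y - g z).
  by ring.
apply: (le_trans (ler_normD _ _)); rewrite !normrM.
apply: (le_trans (lerD (ler_wpM2l (normr_ge0 a) fU) (ler_wpM2l (normr_ge0 b) gV))).
rewrite !mulrA -mulrDl ler_wpM2r//.
have : t * (`|a| + `|b| + 1) = e by rewrite /t divfK// gt_eqF.
lra.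
Qed.

(** The Leibniz rule for q g + (1 - q) h.  It is sharper than what the rules for
    sums and products give: the slope of q is only paid where g and h differ. *)
Lemma lip_glue q g h x : Lipb d q -> Lipb d g -> Lipb d h ->
  (forall y, 0 <= q y <= 1) ->
  lip d (fun y => q y * g y + (1 - q y) * h y) x <=
    q x * lip d g x + (1 - q x) * lip d h x + `|g x - h x| * lip d q x.
Proof.
move=> qL gL hL q01.
have /andP[qx0 qx1] := q01 x.
have qx1' : 0 <= 1 - q x by rewrite subr_ge0.
have lg0 := lip_ge0 d g x; have lh0 := lip_ge0 d h x; have lq0 := lip_ge0 d q x.
set lg := lip d g x in lg0 *; set lh := lip d h x in lh0 *.
set lq := lip d q x in lq0 *; set D := `|g x - h x|.
have D0 : 0 <= D by exact: normr_ge0.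
apply: (lip_le_eps dE); first by rewrite !addr_ge0// mulr_ge0.
move=> e e0; have S0 : 0 < lg + lh + lq + D + 5 by rewrite ltr_wpDl// !addr_ge0.
pose t := Num.min 1 (e / (lg + lh + lq + D + 5)).
have t0 : 0 < t by rewrite lt_min ltr01/= divr_gt0.
have t1 : t <= 1 by rewrite ge_min lexx.
have tS : t * (lg + lh + lq + D + 5) <= e.
  by rewrite -ler_pdivlMr// ge_min lexx orbT.
have [U xU gU] := near_lip x gL t0; have [V xV hV] := near_lip x hL t0.
have [W xW qW] := near_lip x qL t0.
have qc : continuous q by case: qL => -[].
have gc : continuous g by case: gL => -[].
have hc : continuous h by case: hL => -[].
have qN : \forall y \near x, `|q x - q y| <= t by exact: (cvgr_dist_le _ _ (qc x) _ t0).
have ghN : \forall y \near x, `|g x - h x - (g y - h y)| <= t.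
  have ghc : (g y - h y) @[y --> x] --> g x - h x.
    by apply: cvgB; [exact: gc|exact: hc].
  exact: (cvgr_dist_le _ _ ghc _ t0).
exists (U `&` V `&` W `&` [set y | `|q x - q y| <= t] `&`
        [set y | `|g x - h x - (g y - h y)| <= t]).
  by do 4 (apply: filterI => //).
move=> y z [[[[Uy Vy] Wy] qy] ghy] [[[[Uz Vz] Wz] qz] ghz] dyz.
have {}gU := gU _ _ Uy Uz dyz; have {}hV := hV _ _ Vy Vz dyz.
have {}qW := qW _ _ Wy Wz dyz.
rewrite -/lg in gU; rewrite -/lh in hV; rewrite -/lq in qW.
have r0 := fine_dist_ge0 dE y z; set r := fine (d y z) in r0 gU hV qW *.
have /andP[qy0 qy1] := q01 y; have qy1' : 0 <= 1 - q y by rewrite subr_ge0.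
have -> : q y * g y + (1 - q y) * h y - (q z * g z + (1 - q z) * h z) =
  q y * (g y - g z) + (1 - q y) * (h y - h z) + (g z - h z) * (q y - q z) by ring.
apply: (le_trans (ler_normD _ _)); apply: (le_trans (lerD (ler_normD _ _) (lexx _))).
rewrite !normrM (ger0_norm qy0) (ger0_norm qy1').
have ghz' : `|g z - h z| <= D + t.
  have : `|g z - h z| <= `|g x - h x| + `|g x - h x - (g z - h z)|.
    by rewrite -[X in `|X| <= _](subKr (g x - h x)) ler_normB.
  by move/le_trans; apply; rewrite lerD2l.
have qyx : q y <= q x + t /\ 1 - q y <= 1 - q x + t.
  by move: qy => /=; rewrite ler_norml => /andP[]; split; lra.
have m1 := ler_wpM2l qy0 gU.
have m2 := ler_wpM2l qy1' hV.
have m3 : `|g z - h z| * `|q y - q z| <= (D + t) * ((lq + t) * r).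
  by apply: ler_pM.
apply: (@le_trans _ _ ((q y * (lg + t) + (1 - q y) * (lh + t) + (D + t) * (lq + t)) * r)).
  by rewrite !mulrDl; lra.
rewrite ler_wpM2r//.
have n1 : q y * (lg + t) <= (q x + t) * (lg + t).
  by rewrite ler_wpM2r ?addr_ge0 ?(ltW t0)//; exact: qyx.1.
have n2 : (1 - q y) * (lh + t) <= (1 - q x + t) * (lh + t).
  by rewrite ler_wpM2r ?addr_ge0 ?(ltW t0)//; exact: qyx.2.
have tt : t * t <= t by rewrite ler_piMr// ltW.
lra.
Qed.

End lip_arithmetic.

Section Lipb_class.
Context {R : realType} {X : ptopologicalType}.
Variable d : X -> X -> \bar R.
Hypothesis dE : extended_distance d.

Lemma Cb_bound (f : X -> R) : Cb f -> exists2 M : R, 0 < M & forall x, `|f x| <= M.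
Proof.
move=> [_ [M [_ /(_ (Num.max 0 M + 1))]]].
rewrite ltr_pwDr ?le_max ?lexx ?orbT// => /(_ isT) h.
exists (Num.max 0 M + 1); last by move=> x; exact: h.
by rewrite ltr_wpDl// le_max lexx.
Qed.

Lemma Lipb_convex (t : R) (f g : X -> R) : 0 <= t <= 1 -> Lipb d f -> Lipb d g ->
  Lipb d (fun x => (1 - t) * f x + t * g x).
Proof.
move=> /andP[t0 t1] fL gL; have t1' : 0 <= 1 - t by rewrite subr_ge0.
have [L L0 fLL] := Lipb_lip_on dE fL; have [M M0 gM] := Lipb_lip_on dE gL.
have [fC _] := fL; have [gC _] := gL.
have [Cf Cf0 fB] := Cb_bound fC; have [Cg Cg0 gB] := Cb_bound gC.
apply: (@lip_on_Lipb _ _ _ dE ((1 - t) * L + t * M)).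
- split.
    move=> x; apply: cvgD; apply: cvgMr; [exact: fC.1|exact: gC.1].
  exists (Cf + Cg); split; first exact: num_real.
  move=> C CC x _; apply: (le_trans (ler_normD _ _)).
  rewrite !normrM (ger0_norm t0) (ger0_norm t1').
  apply: le_trans (ltW CC); apply: lerD.
    by rewrite (le_trans _ (fB x))// ler_piMl// lerBlDr lerDl.
  by rewrite (le_trans _ (gB x))// ler_piMl.
- by rewrite addr_ge0// mulr_ge0// ltW.
- move=> y z _ _ yz.
  have -> : (1 - t) * f y + t * g y - ((1 - t) * f z + t * g z) =
    (1 - t) * (f y - f z) + t * (g y - g z) by ring.
  apply: (le_trans (ler_normD _ _)).
  rewrite !normrM (ger0_norm t0) (ger0_norm t1').
  rewrite [leRHS](_ : _ = (1 - t) * (L * fine (d y z)) + t * (M * fine (d y z))).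
    by apply: lerD; apply: ler_wpM2l => //; [exact: fLL|exact: gM].
  by ring.
Qed.

End Lipb_class.

(** * Lattice operations in a compatible algebra *)

Section algebra_lattice.
Context {R : realType} {X : ptopologicalType}.
Variables (d : X -> X -> \bar R) (A : set (X -> R)).
Hypotheses (dE : extended_distance d) (cA : compatible_algebra d A).
Implicit Types (f g h q : X -> R) (U K : set X) (L M a b c e : R) (x y z : X).

Lemma alg_lin a b f g : A f -> A g -> A (fun x => a * f x + b * g x).
Proof.
move=> Af Ag; have := algebraD cA (algebraZ cA a Af) (algebraZ cA b Ag).
exact.
Qed.

Lemma alg_mul f g : A f -> A g -> A (fun x => f x * g x).
Proof. exact: (algebraM cA). Qed.

Lemma alg_cst a : A (fun=> a).
Proof.
have := algebraZ cA a (algebra_1 cA); rewrite (_ : a \*: _ = fun=> a)//.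
by apply/funext => x /=; rewrite [LHS]mulr1.
Qed.

Lemma alg_affine a b f : A f -> A (fun x => a + b * f x).
Proof.
move=> Af; have := alg_lin a b (alg_cst 1) Af.
by rewrite (_ : (fun x => _) = (fun x => a + b * f x))//; apply/funext => x; rewrite mulr1.
Qed.

Lemma alg_exp n f : A f -> A (fun x => f x ^+ n).
Proof.
move=> Af; elim: n => [|n ih]; first exact: alg_cst.
rewrite (_ : (fun x => _) = (fun x => f x * f x ^+ n)); first exact: alg_mul.
by apply/funext => x; rewrite exprS.
Qed.

Lemma alg_Lipb f : A f -> Lipb d f. Proof. exact: (algebra_sub cA). Qed.

Lemma alg_continuous f : A f -> continuous f. Proof. by move=> /alg_Lipb[[]]. Qed.

Lemma alg_bound f : A f -> exists2 M, 0 < M & forall x, `|f x| <= M.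
Proof. by move=> /alg_Lipb[/Cb_bound]. Qed.

Lemma alg_abs_compl n f : A f -> A (fun x => abs_compl n (f x)).
Proof.
move=> Af; elim: n => [|n ih] /=; first exact: alg_cst.
have := alg_affine 2^-1 1 (alg_lin (- 2^-1) 2^-1 (alg_exp 2 Af) (alg_exp 2 ih)).
by congr A; apply/funext => x; field.
Qed.

Lemma alg_cutoff N f : A f -> A (fun x => cutoff N (f x)).
Proof.
move=> Af; have := alg_affine 1 (-1) (alg_exp (3 ^ N) (alg_affine 1 (-1) (alg_exp N Af))).
by congr A; apply/funext => x; rewrite /cutoff !mulN1r.
Qed.

(** The maximum of two functions of A is only a uniform limit of functions of A;
    closing up makes the lattice operations exact. *)
Definition alg_lip_closure L f := forall e, 0 < e ->
  exists g, [/\ A g, lip_on d L setT g & forall x, `|g x - f x| <= e].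

Lemma alg_lip_closure_alg L f : A f -> lip_on d L setT f -> alg_lip_closure L f.
Proof. by move=> Af Lf e e0; exists f; split=> // x; rewrite subrr normr0 ltW. Qed.

Lemma alg_lip_closure_cst L a : 0 <= L -> alg_lip_closure L (fun=> a).
Proof.
move=> L0; apply: alg_lip_closure_alg; first exact: alg_cst.
by move=> y z _ _ _; rewrite subrr normr0 mulr_ge0// fine_dist_ge0.
Qed.

Lemma alg_lip_closureN L f : alg_lip_closure L f -> alg_lip_closure L (fun x => - f x).
Proof.
move=> fL e e0; have [g [Ag gL gf]] := fL e e0; exists (fun x => - g x); split.
- have := alg_lin (-1) 0 Ag Ag; congr A; apply/funext => x.
  by rewrite mulN1r mul0r addr0.
- by move=> y z _ _ dyz; rewrite -opprD normrN gL.
- by move=> x; rewrite -opprD normrN.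
Qed.

(** The polynomial of [abs_compl] is applied to the difference of two functions
    of A, scaled into [-1, 1]. *)
Lemma alg_lip_closure_max L f g : alg_lip_closure L f -> alg_lip_closure L g ->
  alg_lip_closure L (fun x => Num.max (f x) (g x)).
Proof.
move=> fL gL e e0; have e20 : 0 < e / 2 by rewrite divr_gt0.
have [f' [Af f'L ff]] := fL _ e20; have [g' [Ag g'L gg]] := gL _ e20.
have [Mf Mf0 fM] := alg_bound Af; have [Mg Mg0 gM] := alg_bound Ag.
pose M := Mf + Mg; have M0 : 0 < M by rewrite addr_gt0.
have dM x : `|f' x - g' x| <= M by rewrite (le_trans (ler_normB _ _))// lerD.
pose t x := (f' x - g' x) / M.
have t1 x : `|t x| <= 1 by rewrite normrM normfV (gtr0_norm M0) ler_pdivrMr// mul1r.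
have At : A t.
  have := alg_lin M^-1 (- M^-1) Af Ag; congr A; apply/funext => x.
  by rewrite /t mulrBl mulNr !(mulrC M^-1).
pose n := Num.bound (4 * M / e).
have nP : M * (2 / n.+2%:R) <= e / 2.
  rewrite mulrA ler_pdivrMr ?ltr0n//.
  have := archi_boundP (ltW (divr_gt0 (mulr_gt0 (ltr0Sn R 3) M0) e0)).
  rewrite -/n ltr_pdivrMr// => h.
  have : n%:R * e <= n.+2%:R * e by rewrite ler_pM2r// ler_nat leqW.
  lra.
exists (fun x => (f' x + g' x) / 2 + M / 2 * (1 - abs_compl n (t x))); split.
- have := alg_lin 1 (M / 2) (alg_lin 2^-1 2^-1 Af Ag)
    (alg_affine 1 (-1) (alg_abs_compl n At)).
  by congr A; apply/funext => x; field.
- move=> y z _ _ dyz; apply: soft_max_lip => //.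
  + exact: abs_compl_lip.
  + exact: f'L.
  + exact: g'L.
- move=> x; have [_ h] := abs_compl_bound n (t1 x).
  have h1 := soft_max_bound M0 (dM x) h.
  have h2 : `|Num.max (f' x) (g' x) - Num.max (f x) (g x)| <= e / 2.
    have := ff x; have := gg x; rewrite !ler_norml => /andP[g1 g2] /andP[f1 f2].
    by rewrite lerBlDr ge_max lerBrDr !le_max -!lerBlDr;
      case: (leP (f x) (g x)) => fg; apply/andP; split;
      case: (leP (f' x) (g' x)) => fg'; lra.
  rewrite (splitr e); apply: (le_trans (ler_distD (Num.max (f' x) (g' x)) _ _)).
  by rewrite lerD//; exact: le_trans h1 nP.
Qed.

Lemma alg_lip_closure_min L f g : alg_lip_closure L f -> alg_lip_closure L g ->
  alg_lip_closure L (fun x => Num.min (f x) (g x)).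
Proof.
move=> fL gL.
have := alg_lip_closureN (alg_lip_closure_max (alg_lip_closureN fL) (alg_lip_closureN gL)).
by congr alg_lip_closure; apply/funext => x; rewrite oppr_max !opprK.
Qed.

End algebra_lattice.

(** * Approximation in a compatible algebra *)

Section lattice_approximation.
Context {R : realType} {X : ptopologicalType}.
Variables (d : X -> X -> \bar R) (A : set (X -> R)).
Hypotheses (dE : extended_distance d) (cA : compatible_algebra d A).
Implicit Types (f g h q : X -> R) (U K : set X) (L M a b c e : R) (x y z : X).

Local Notation closure_A := (alg_lip_closure d A).

Lemma compact_subcover (T : ptopologicalType) (K : set T) (D : T -> set T) : compact K ->
  (forall y : T, K y -> open (D y) /\ D y y) ->
  exists2 s : seq T, (forall y : T, y \in s -> K y) &
    forall z : T, K z -> exists2 y : T, y \in s & D y z.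
Proof.
rewrite compact_cover => cK DP.
have [y Ky|z Kz|s sK sD] := cK T K D; first exact: (DP y Ky).1.
  by exists z => //; exact: (DP z Kz).2.
exists (finmap.enum_fset s); first by move=> y /sK; rewrite inE.
by move=> z /sD [y /= ys Dyz]; exists y.
Qed.

(** The distance formula provides a 1-Lipschitz h in A with
    L |h x - h y| > |f x - f y| - e; the interpolating function is affine in
    h, with a slope c at most L in absolute value. *)
Lemma alg_pair f K L x y e : 0 < L -> lip_on d L K f -> K x -> K y -> 0 < e ->
  exists g, [/\ A g, lip_on d L setT g, `|g x - f x| <= e & `|g y - f y| <= e].
Proof.
move=> L0 fK Kx Ky e0.
have : (((`|f x - f y| - e) / L)%:E < d x y)%E.
  have := Defs.edist_ge0 dE x y; have := fK _ _ Kx Ky.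
  case: (d x y) => [r| |] // => [/(_ isT) /= h r0|_ _]; last exact: ltry.
  rewrite lte_fin ltr_pdivrMr// (mulrC r); lra.
rewrite (algebra_distance cA) => /ereal_sup_gt[_ [h [Ah hL] <-]].
rewrite lte_fin ltr_pdivrMr// => hxy.
have h1 := Lip_le1 dE hL.
pose D := h y - h x; pose t := f y - f x.
have {}hxy : `|t| - e < `|D| * L by rewrite /D /t (distrC (f y)) (distrC (h y)).
have [c cL cD] : exists2 c, `|c| <= L & `|c * D - t| <= e.
  have [D0|D0] := eqVneq D 0.
    exists 0; first by rewrite normr0 ltW.
    by rewrite mul0r sub0r normrN; move: hxy; rewrite D0 normr0 mul0r subr_lt0 => /ltW.
  have nD0 : 0 < `|D| by rewrite normr_gt0.
  have [tD|Dt] := leP `|t| (`|D| * L).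
    exists (t / D); last by rewrite divfK// subrr normr0 ltW.
    by rewrite normrM normfV ler_pdivrMr// mulrC.
  have t0 : t != 0 by apply: contraTneq Dt => ->; rewrite normr0 -leNgt mulr_ge0// ltW.
  exists (Num.sg t * Num.sg D * L).
    by rewrite !normrM !normr_sg t0 D0 !mul1r gtr0_norm.
  have -> : Num.sg t * Num.sg D * L * D - t = Num.sg t * (`|D| * L - `|t|).
    have := normrEsg D; have := numEsg t; move: `|D| `|t| => u v e1 e2.
    by rewrite [RHS]mulrBr -e1 e2; ring.
  by rewrite normrM normr_sg t0 mul1r distrC gtr0_norm ?subr_gt0//; lra.
exists (fun z => (f x - c * h x) + c * h z); split.
- exact: (alg_affine cA _ _ Ah).
- move=> u v _ _ uv; rewrite opprD addrACA subrr add0r -mulrBr normrM.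
  have := h1 u v I I uv; rewrite mul1r => h2.
  by rewrite ler_pM.
- by rewrite subrK subrr normr0 ltW.
- rewrite (_ : _ - f y = c * D - t)//; rewrite /D /t; ring.
Qed.

Lemma alg_lip_closure_min_seq L (g : X -> X -> R) y0 s :
  (forall y, y \in y0 :: s -> closure_A L (g y)) ->
  exists h, [/\ closure_A L h, forall y z, y \in y0 :: s -> h z <= g y z &
    forall z (P : R -> Prop), (forall y, y \in y0 :: s -> P (g y z)) -> P (h z)].
Proof.
elim: s => [|y s ih] gL.
  exists (g y0); split.
  - by apply: gL; rewrite mem_head.
  - by move=> y z; rewrite inE => /eqP ->.
  - by move=> z P; apply; rewrite mem_head.
have [|h [hL hg hP]] := ih.
  by move=> w; rewrite inE => /orP[/eqP ->|ws]; apply: gL; rewrite !inE ?eqxx// ws !orbT.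
exists (fun z => Num.min (h z) (g y z)); split.
- by apply: alg_lip_closure_min => //; apply: gL; rewrite !inE eqxx orbT.
- move=> w z; rewrite !inE => /or3P[/eqP->|/eqP->|ws]; rewrite ge_min ?lexx ?orbT//.
    by rewrite hg ?mem_head.
  by rewrite hg// inE ws orbT.
- move=> z P Pg; case: (leP (h z) (g y z)) => _; last by apply: Pg; rewrite !inE eqxx orbT.
  by apply: hP => w; rewrite inE => /orP[/eqP ->|ws]; apply: Pg; rewrite !inE ?eqxx// ws !orbT.
Qed.

Lemma alg_lip_closure_max_seq L (g : X -> X -> R) y0 s :
  (forall y, y \in y0 :: s -> closure_A L (g y)) ->
  exists h, [/\ closure_A L h, forall y z, y \in y0 :: s -> g y z <= h z &
    forall z (P : R -> Prop), (forall y, y \in y0 :: s -> P (g y z)) -> P (h z)].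
Proof.
move=> gL; have [|h [hL hg hP]] := @alg_lip_closure_min_seq L (fun y z => - g y z) y0 s.
  by move=> y /gL; exact: alg_lip_closureN.
exists (fun z => - h z); split.
- exact: alg_lip_closureN.
- by move=> y z /hg hgz; rewrite lerNr.
- move=> z P Pg; apply: (hP z (fun r => P (- r))) => y /Pg; by rewrite opprK.
Qed.

Lemma open_lt_add f g e : continuous f -> continuous g ->
  open [set z | g z < f z + e].
Proof.
move=> fc gc.
rewrite (_ : [set z | _] = (fun z => g z - f z) @^-1` [set t | t < e]).
  by apply: open_comp => [z _|]; [apply: cvgB; [exact: gc|exact: fc]|exact: open_lt].
by apply/seteqP; split=> z /=; rewrite ltrBlDl.
Qed.

(** First half of the lattice argument: minimum of functions that interpolate f
    at x and at a varying point y, over a finite subcover. *)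
Lemma lattice_lower f K L x e : compact K -> continuous f -> 0 < L ->
  lip_on d L K f -> K x -> 0 < e ->
  exists g, [/\ A g, lip_on d L setT g, f x - 2 * e <= g x &
    forall z, K z -> g z <= f z + 3 * e].
Proof.
move=> cK fc L0 fK Kx e0.
have /choice[g gP] : forall y, exists g, K y ->
    [/\ A g, lip_on d L setT g, `|g x - f x| <= e & `|g y - f y| <= e].
  move=> y; have [Ky|nKy] := pselect (K y); last by exists (cst 0).
  by have [g ?] := alg_pair L0 fK Kx Ky e0; exists g.
have [s sK sD] : exists2 s : seq X, (forall y, y \in s -> K y) &
    forall z, K z -> exists2 y, y \in s & g y z < f z + 2 * e.
  apply: (@compact_subcover X K (fun y => [set z | g y z < f z + 2 * e])) => // y Ky.
  have [Ag _ _ gy] := gP y Ky; split.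
    by apply: open_lt_add => //; exact: (alg_continuous cA Ag).
  by move: gy => /=; rewrite ler_norml => /andP[]; lra.
have [|h [hL hg hP]] := @alg_lip_closure_min_seq L g x s.
  have gL y : K y -> closure_A L (g y).
    by move=> /gP[Ag gL _ _]; exact: alg_lip_closure_alg.
  by move=> y; rewrite inE => /orP[/eqP ->|/sK]; exact: gL.
have [h' [Ah h'L hh]] := hL _ e0; exists h'; split=> //.
  have : f x - e <= h x.
    apply: (hP x (fun r => f x - e <= r)) => y; rewrite inE => ys.
    have Ky : K y by case/orP : ys => [/eqP ->|/sK].
    by have [_ _ + _] := gP y Ky; rewrite ler_norml => /andP[]; lra.
  by have := hh x; rewrite ler_norml => /andP[]; lra.
move=> z Kz; have [y ys gyz] := sD z Kz.
have := hg y z; rewrite inE ys orbT => /(_ isT).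
by have := hh z; rewrite ler_norml => /andP[]; lra.
Qed.

(** Stone-Weierstrass with control of the Lipschitz constant.  The function f is
    Lipschitz on K only, but the approximations are globally so; truncation
    keeps them bounded outside K. *)
Lemma lattice_approximation f K L M e : compact K -> continuous f -> 0 < L ->
  lip_on d L K f -> 0 <= M -> (forall x, `|f x| <= M) -> 0 < e ->
  exists g, [/\ A g, lip_on d L setT g, forall z, K z -> `|g z - f z| <= e &
    forall z, `|g z| <= M + e].
Proof.
move=> cK fc L0 fK M0 fM e0.
have [K0|/set0P[x0 Kx0]] := eqVneq K set0.
  exists (fun=> 0); split; first exact: (alg_cst cA).
  - by move=> y z _ _ _; rewrite subrr normr0 mulr_ge0 ?(ltW L0)// (fine_dist_ge0 dE).
  - by rewrite K0.
  - by move=> z; rewrite normr0 addr_ge0// ltW.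
pose t := e / 4; have t0 : 0 < t by rewrite divr_gt0.
have /choice[g gP] : forall x, exists g, K x -> [/\ A g, lip_on d L setT g,
    f x - 2 * t <= g x & forall z, K z -> g z <= f z + 3 * t].
  move=> x; have [Kx|nKx] := pselect (K x); last by exists (cst 0).
  by have [g ?] := lattice_lower cK fc L0 fK Kx t0; exists g.
have [s sK sD] : exists2 s : seq X, (forall y, y \in s -> K y) &
    forall z, K z -> exists2 y, y \in s & f z < g y z + 3 * t.
  apply: (@compact_subcover X K (fun y => [set z | f z < g y z + 3 * t])) => // y Ky.
  have [Ag _ gy _] := gP y Ky; split.
    by apply: open_lt_add => //; exact: (alg_continuous cA Ag).
  by move=> /=; lra.
have [|h [hL hg hP]] := @alg_lip_closure_max_seq L g x0 s.
  have gL y : K y -> closure_A L (g y).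
    by move=> /gP[Ag gL _ _]; exact: alg_lip_closure_alg.
  by move=> y; rewrite inE => /orP[/eqP ->|/sK]; exact: gL.
have hK z : K z -> `|h z - f z| <= 3 * t.
  move=> Kz; rewrite ler_norml; apply/andP; split.
    have [y ys gyz] := sD z Kz.
    have := hg y z; rewrite inE ys orbT => /(_ isT); lra.
  rewrite lerBlDl; apply: (hP z (fun r => r <= f z + 3 * t)) => y; rewrite inE => ys.
  have Ky : K y by case/orP : ys => [/eqP ->|/sK].
  by have [_ _ _ ->] := gP y Ky.
pose k z := Num.max (- M) (Num.min M (h z)).
have kL : closure_A L k.
  apply: alg_lip_closure_max => //; first exact: (alg_lip_closure_cst dE cA _ (ltW L0)).
  by apply: alg_lip_closure_min => //; exact: (alg_lip_closure_cst dE cA _ (ltW L0)).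
have kM z : `|k z| <= M.
  rewrite ler_norml /k le_max lexx/= ge_max ge_min lexx/= andbT.
  by rewrite (le_trans _ M0)// oppr_le0.
have kK z : K z -> `|k z - f z| <= 3 * t.
  move=> /hK; have := fM z; rewrite /k !ler_norml => /andP[f1 f2] /andP[h1 h2].
  rewrite lerBrDr le_max lerBlDl ge_max le_min ge_min.
  apply/andP; split; first by apply/orP; right; apply/andP; split; lra.
  by apply/andP; split; [lra|apply/orP; right; lra].
have [k' [Ak k'L kk]] := kL _ t0; exists k'; split=> //.
  move=> z Kz; have -> : e = t + 3 * t by rewrite /t; field.
  by rewrite (le_trans (ler_distD (k z) _ _))// lerD// kK.
move=> z; have : `|k' z| <= `|k z| + `|k' z - k z|.
  by rewrite -{1}(subrKC (k z) (k' z)) ler_normD.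
by have := kM z; have := kk z; rewrite /t; lra.
Qed.

End lattice_approximation.

(** * Cutoff functions in a compatible algebra *)

Section algebra_cutoff.
Context {R : realType} {X : ptopologicalType}.
Variables (d : X -> X -> \bar R) (A : set (X -> R)).
Hypotheses (dE : extended_distance d) (cA : compatible_algebra d A).
Hypotheses (hX : hausdorff_space X) (cX : compact [set: X]).
Implicit Types (f g h q : X -> R) (U K V : set X) (L M a b c e : R) (x y z : X).

Lemma closed_compactT K : closed K -> compact K.
Proof. by move=> cK; apply: subclosed_compact cX _. Qed.

(** The distance is a supremum of continuous functions, hence lower
    semicontinuous, and positive off the diagonal. *)
Lemma compact_dist_gt0 K V : compact K -> compact V -> K `&` V = set0 ->
  exists2 c, 0 < c & forall x y, K x -> V y -> d x y \is a fin_num -> c <= fine (d x y).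
Proof.
move=> cK cV KV0.
have /choice[h hP] : forall w : X * X, exists h, (K `*` V) w ->
    [/\ A h, lip_on d 1 setT h & 0 < `|h w.1 - h w.2|].
  move=> [x y]; have [[Kx Vy]|] := pselect ((K `*` V) (x, y)); last by exists (cst 0).
  have xy : x <> y.
    move=> xy; rewrite xy in Kx; have : (K `&` V) y by [].
    by rewrite KV0.
  have : (0 < d x y)%E.
    rewrite lt_neqAle (Defs.edist_ge0 dE) andbT eq_sym; apply/eqP.
    by move/(Defs.edist_eq0 dE).
  rewrite (algebra_distance cA) => /ereal_sup_gt[_ [h [Ah hL] <-]].
  by rewrite lte_fin => hxy; exists h; split=> //; exact: Lip_le1.
pose D w := [set v : X * X | `|h w w.1 - h w w.2| / 2 < `|h w v.1 - h w v.2|].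
have DP w : (K `*` V) w -> open (D w) /\ D w w.
  move=> /hP[Ah _ h0]; split; last by rewrite /D/=; lra.
  have hc := alg_continuous cA Ah.
  rewrite (_ : D w = (fun v => `|h w v.1 - h w v.2|) @^-1`
    [set t | `|h w w.1 - h w w.2| / 2 < t])//.
  apply: open_comp; last exact: open_gt.
  move=> v _; apply: cvg_norm; apply: cvgB.
    by apply: (@continuous_comp _ _ _ fst (h w)); [exact: cvg_fst|exact: hc].
  by apply: (@continuous_comp _ _ _ snd (h w)); [exact: cvg_snd|exact: hc].
pose XX : ptopologicalType := HB.pack (X * X)%type (Topological.on (X * X)%type)
  (Pointed.on (X * X)%type).
have [s sK sD] := @compact_subcover XX (K `*` V) D (compact_setX cK cV) DP.
have [c c0 cP] : exists2 c, 0 < c & forall w, w \in s -> c <= `|h w w.1 - h w w.2| / 2.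
  elim: s sK {sD} => [|w s ih] sK; first by exists 1.
  have [|c c0 cP] := ih; first by move=> v vs; apply: sK; rewrite inE vs orbT.
  have [_ _ hw] := hP w (sK w (mem_head _ _)).
  exists (Num.min (`|h w w.1 - h w w.2| / 2) c); first by rewrite lt_min c0 divr_gt0.
  move=> v; rewrite inE => /orP[/eqP ->|/cP vc]; first by rewrite ge_min lexx.
  by rewrite ge_min vc orbT.
exists c => // x y Kx Vy xy; have [w ws] := sD (x, y) (conj Kx Vy).
rewrite /D/= => /ltW /(le_trans (cP _ ws)) /le_trans; apply.
have [_ hL _] := hP w (sK w ws).
by have := hL x y I I xy; rewrite mul1r.
Qed.

(** A Urysohn function is flattened so that it is 1 on K and 0 on a closed set F
    that contains the complement of K': being 0 on a neighbourhood of points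
    outside K' is what allows small slopes there. *)
Lemma urysohn_bump K V : closed K -> open V -> K `<=` V ->
  exists (v : X -> R) (K' : set X), [/\ continuous v, closed K', K' `<=` V,
    forall x, 0 <= v x <= 1 & (forall x, K x -> v x = 1) /\
    exists2 F, closed F & [/\ ~` K' `<=` F, K `&` F = set0 & forall x, F x -> v x = 0]].
Proof.
move=> cK oV KV; have nX := compact_normal hX cX.
have KV0 : K `&` ~` V = set0 by apply/seteqP; split=> // x [/KV].
have [u [uc u0 u1 u01]] := @urysohn_ext_itv X R nX _ _ 0 1 cK (open_closedC oV) KV0 ltr01.
clear KV0.
exists (fun x => Num.max 0 (1 - 2 * u x)), [set x | u x <= 1 / 2]; split.
- move=> x; apply: (@continuous_max _ _ (fun=> 0) (fun x => 1 - 2 * u x)).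
    exact: cst_continuous.
  by apply: cvgB; [exact: cvg_cst|apply: cvgMr; exact: uc].
- apply: (@closed_comp _ _ u [set t | t <= 1 / 2]) => [x _|]; [exact: uc|exact: closed_le].
- move=> x /= ux; apply: contrapT => nVx.
  have /= : [set 1] (u x) by apply: u1; exists x.
  by move=> ux1; rewrite ux1 in ux; lra.
- move=> x; have /= : `[0, 1]%classic (u x) by apply: u01; exists x.
  by rewrite in_itv/= le_max lexx/= ge_max ler01/= => /andP[]; lra.
- split=> [x Kx|].
    have /= -> : [set 0] (u x) by apply: u0; exists x.
    by rewrite mulr0 subr0; apply/max_idPr; exact: ler01.
  exists [set x | 1 / 2 <= u x].
    by apply: (@closed_comp _ _ u [set t | 1 / 2 <= t]) => [x _|]; [exact: uc|exact: closed_ge].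
  split.
  + by move=> x /= /negP; rewrite -ltNge => /ltW.
  + apply/seteqP; split=> // x [Kx] /=.
    have /= -> : [set 0] (u x) by apply: u0; exists x.
    lra.
  + by move=> x /= ux; apply/max_idPl; lra.
Qed.

(** The bump is Lipschitz on the union of K and F, as these sets are at positive
    distance; it is approximated in A, squared and rescaled into [0, 1], and
    sharpened by [cutoff] until its slope outside K' is below e. *)
Lemma alg_cutoff_exists K V e : compact K -> open V -> K `<=` V -> 0 < e ->
  exists q (K' : set X) C, [/\ A q, closed K' /\ K' `<=` V, 0 < C /\ lip_on d C setT q,
     (forall x, 0 <= q x <= 1) /\ (forall x, K x -> 1 - e <= q x) &
     lip_on d e (~` K') q /\ forall x, ~ K' x -> q x <= e].
Proof.
move=> cK oV KV e0.
have [v [K' [vc cK' K'V v01 [v1 [F cF [K'F KF0 vF]]]]]] :=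
  urysohn_bump (compact_closed hX cK) oV KV.
have cFF := closed_compactT cF.
have [dl dl0 dlP] := compact_dist_gt0 cK cFF KF0.
have vL : lip_on d dl^-1 (K `|` F) v.
  have dist x y : K x -> F y -> d x y \is a fin_num -> `|v x - v y| <= dl^-1 * fine (d x y).
    move=> Kx Fy xy; rewrite v1// vF// subr0 normr1 ler_pdivlMl// mulr1.
    exact: dlP.
  move=> x y [Kx|Fx] [Ky|Fy] xy.
  - by rewrite !v1// subrr normr0 mulr_ge0 ?invr_ge0 ?(ltW dl0)// (fine_dist_ge0 dE).
  - exact: dist.
  - by rewrite distrC (Defs.edist_sym dE); apply: dist; rewrite // (Defs.edist_sym dE).
  - by rewrite !vF// subrr normr0 mulr_ge0 ?invr_ge0 ?(ltW dl0)// (fine_dist_ge0 dE).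
have cKF : compact (K `|` F).
  by apply: closed_compactT; apply: closedU => //; exact: compact_closed.
have vM x : `|v x| <= 1 by have /andP[? ?] := v01 x; rewrite ger0_norm.
have e8 : 0 < 1 / 8 :> R by lra.
have idl0 : 0 < dl^-1 by rewrite invr_gt0.
have [w [Aw _ wv wM]] := lattice_approximation dE cA cKF vc idl0 vL ler01 vM e8.
(* |w| <= 9/8, w >= 7/8 on K and |w| <= 1/8 on F *)
pose psi x := 64 / 81 * w x ^+ 2.
have Apsi : A psi.
  have := alg_affine cA 0 (64 / 81) (alg_exp cA 2 Aw).
  by congr A; apply/funext => x; rewrite add0r.
have psi01 x : 0 <= psi x <= 1.
  have := wM x; rewrite ler_norml => /andP[w1 w2].
  by rewrite /psi; apply/andP; split; nra.
have psiK x : K x -> 2^-1 <= psi x <= 1.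
  move=> Kx; have := wv x (or_introl Kx); rewrite v1// ler_norml => /andP[w1 w2].
  by have /andP[_ ->] := psi01 x; rewrite andbT /psi; nra.
have psiF x : F x -> 0 <= psi x <= 4^-1.
  move=> Fx; have := wv x (or_intror Fx); rewrite vF// subr0 ler_norml => /andP[w1 w2].
  by have /andP[-> _] := psi01 x; rewrite /psi; nra.
have [L L0 psiL] := Lipb_lip_on dE (alg_Lipb cA Apsi).
pose e' := Num.min e (e / L); have e'0 : 0 < e' by rewrite lt_min e0 divr_gt0.
have e'e : e' <= e by rewrite ge_min lexx.
have [N [C [C0 qC qF qF2 qK]]] := cutoff_exists e'0.
exists (fun x => cutoff N (psi x)), K', (C * L); split.
- exact: (alg_cutoff cA).
- by split.
- split; first exact: mulr_gt0.
  move=> y z Uy Uz yz; apply: (le_trans (qC _ _ (psi01 y) (psi01 z))).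
  by rewrite -mulrA ler_pM2l//; exact: psiL.
- split=> [x|x Kx]; first exact: cutoff_range.
  by apply: le_trans (qK _ (psiK x Kx)); rewrite lerB.
- split=> [y z /K'F Fy /K'F Fz yz|x /K'F Fx].
    apply: (le_trans (qF _ _ (psiF y Fy) (psiF z Fz))).
    apply: (@le_trans _ _ (e' * (L * fine (d y z)))).
      by rewrite ler_pM2l//; exact: psiL.
    rewrite mulrA ler_wpM2r ?(fine_dist_ge0 dE)// -ler_pdivlMr//.
    by rewrite ge_min lexx orbT.
  by apply: le_trans (qF2 _ (psiF x Fx)) _.
Qed.

End algebra_cutoff.

(** * The Cheeger energy *)

Section cheeger_energy.
Context {R : realType} {X : ptopologicalType}.
Variables (d : X -> X -> \bar R) (m : {finite_measure set (borel X) -> \bar R}).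
Variables (p : R) (B : set (X -> R)).
Hypotheses (p1 : 1 < p) (dE : extended_distance d).
Hypothesis BL : forall f, B f -> Lipb d f.
Implicit Types (f g h G u v : X -> R) (e c : R).

Local Notation Lp := (Lfun m p%:E).
Local Notation nrm := (nrm m p).
Local Notation pint := (pint m p).
Local Notation pairing := (pairing m p).
Local Notation energy f := (pint (lip d f)).

Lemma Cb_Lp f : Cb f -> (f : borel X -> R) \in Lp.
Proof.
move=> fC; have [M M0 fM] := Cb_bound fC.
by case: (Lp_bounded m p1 (measurable_continuous fC.1) fM).
Qed.

Lemma lip_Lp f : Lipb d f -> (lip d f : borel X -> R) \in Lp.
Proof.
move=> fL; have [L L0 fLL] := Lipb_lip_on dE fL.
have h x : `|lip d f x| <= L.
  rewrite ger0_norm ?lip_ge0//; exact: (lip_le dE (@filterT _ _ _) (ltW L0) fLL).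
by case: (Lp_bounded m p1 (measurable_lip dE fL) h).
Qed.

Lemma energyE f : Lipb d f -> (\int[m]_x ((lip d f x) `^ p)%:E)%E = (energy f)%:E.
Proof.
move=> fL; rewrite -(pintE p1 (lip_Lp fL)).
by apply: eq_integral => x _; rewrite ger0_norm// lip_ge0.
Qed.

Lemma harmonic_le e : 0 < e -> exists N, forall n, (N <= n)%N -> n.+1%:R^-1 <= e.
Proof.
move=> e0; exists (Num.bound e^-1) => n Nn.
rewrite invf_ple ?posrE ?ltr0n//.
rewrite (le_trans (ltW (archi_boundP _))) ?invr_ge0 ?(ltW e0)// ler_nat.
exact: leqW.
Qed.

Lemma cheeger_approx f (c : \bar R) e : (cheeger d m p B f < c)%E -> 0 < e ->
  exists u, [/\ B u, nrm (fun x => u x - f x) <= e & ((energy u)%:E < c)%E].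
Proof.
move=> /ereal_inf_lt[_ [u [Bu /(Lp_cvgP m p1)[up fp uf]] <-]] + e0.
move=> /limn_einf_ltP h.
move/cvgrPdist_le : uf => /(_ e e0)[N _ NP].
have [n Nn un] := h N; exists (u n); split=> //.
  by have := NP n Nn; rewrite /= sub0r normrN ger0_norm ?nrm_ge0.
by rewrite -energyE//; exact: BL.
Qed.

Lemma harmonic_Lp_cvg (u : nat -> X -> R) f : f \in Lp -> (forall n, B (u n)) ->
  (forall n, nrm (fun x => u n x - f x) <= n.+1%:R^-1) -> Lp_cvg m p u f.
Proof.
move=> fp Bu uf; apply/Lp_cvgP => //; split=> //.
  by move=> n; apply: Cb_Lp; case: (BL (Bu n)).
apply/cvgrPdist_le => e e0; have [N NP] := harmonic_le e0.
exists N => // n Nn; rewrite /= sub0r normrN ger0_norm ?nrm_ge0//.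
exact: le_trans (uf n) (NP n Nn).
Qed.

(** Otherwise some sequence tends to f with energies at most c - e, which the
    infimum defining the Cheeger energy forbids. *)
Lemma cheeger_lsc f c e : f \in Lp -> (c%:E <= cheeger d m p B f)%E -> 0 < e ->
  exists2 r, 0 < r & forall u, B u -> nrm (fun x => u x - f x) <= r -> c - e <= energy u.
Proof.
move=> fp cf e0; apply: contrapT => h.
have /choice[u uP] : forall n : nat, exists u, [/\ B u,
    nrm (fun x => u x - f x) <= n.+1%:R^-1 & energy u < c - e].
  move=> n; apply: contrapT => hn; apply: h; exists n.+1%:R^-1; first by rewrite invr_gt0.
  move=> u Bu uf; rewrite leNgt; apply/negP => ue; apply: hn; exists u; split=> //.
have : (cheeger d m p B f <= (c - e)%:E)%E.
  apply: (@le_trans _ _ (limn_einf (fun n => \int[m]_x ((lip d (u n) x) `^ p)%:E))%E).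
    apply: ereal_inf_lbound; exists u => //; split; first by move=> n; case: (uP n).
    by apply: harmonic_Lp_cvg => // n; case: (uP n).
  apply: (limn_einf_le (N := 0%N)) => n _; have [Bu _ /ltW ue] := uP n.
  by rewrite energyE ?lee_fin//; exact: BL.
by move=> /(le_trans cf); rewrite lee_fin; lra.
Qed.

Lemma cheeger_le f c : f \in Lp ->
  (forall e, 0 < e -> exists u, [/\ B u, nrm (fun x => u x - f x) <= e & energy u <= c + e]) ->
  (cheeger d m p B f <= c%:E)%E.
Proof.
move=> fp h; apply/lee_addgt0Pr => e e0.
have /choice[u uP] : forall n : nat, exists u, [/\ B u,
    nrm (fun x => u x - f x) <= n.+1%:R^-1 & energy u <= c + n.+1%:R^-1].
  by move=> n; apply: h; rewrite invr_gt0.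
apply: (@le_trans _ _ (limn_einf (fun n => \int[m]_x ((lip d (u n) x) `^ p)%:E))%E).
  apply: ereal_inf_lbound; exists u => //; split; first by move=> n; case: (uP n).
  by apply: harmonic_Lp_cvg => // n; case: (uP n).
have [N NP] := harmonic_le e0.
apply: (limn_einf_le (N := N)) => n Nn; have [Bu _ ue] := uP n.
rewrite energyE; last exact: BL.
by rewrite -EFinD lee_fin (le_trans ue)// lerD2l NP.
Qed.

Lemma cheeger_ge0 f : (0 <= cheeger d m p B f)%E.
Proof.
apply: le_ereal_inf_tmp => _ [u _ <-]; apply: (limn_einf_ge (N := 0%N)) => n _.
by apply: integral_ge0 => x _; rewrite lee_fin powR_ge0.
Qed.

End cheeger_energy.

(** * Recovery sequences and minimal relaxed gradients *)

Section recovery_sequences.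
Context {R : realType} {X : ptopologicalType}.
Variables (d : X -> X -> \bar R) (m : {finite_measure set (borel X) -> \bar R}).
Variables (p : R) (B : set (X -> R)).
Hypotheses (p1 : 1 < p) (dE : extended_distance d).
Hypothesis BL : forall f, B f -> Lipb d f.
Hypothesis Bcvx : forall t f g, 0 <= t <= 1 -> B f -> B g ->
  B (fun x => (1 - t) * f x + t * g x).
Implicit Types (f g h u v c : X -> R) (e C : R).

Local Notation Lp := (Lfun m p%:E).
Local Notation nrm := (nrm m p).
Local Notation pint := (pint m p).
Local Notation pairing := (pairing m p).
Local Notation energy f := (pint (lip d f)).

Let p0 : 0 < p. Proof. by apply: lt_trans p1. Qed.
Let BLp f : B f -> (f : borel X -> R) \in Lp.
Proof. by move=> /BL[fC _]; exact: Cb_Lp. Qed.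
Let lipp f : B f -> (lip d f : borel X -> R) \in Lp.
Proof. by move=> /BL; exact: lip_Lp. Qed.

Lemma nrm_convex_dist f g h t : 0 <= t <= 1 -> f \in Lp -> g \in Lp -> h \in Lp ->
  nrm (fun x => (1 - t) * f x + t * g x - h x) <=
  (1 - t) * nrm (fun x => f x - h x) + t * nrm (fun x => g x - h x).
Proof.
move=> /andP[t0 t1] fp gp hp.
have t1' : 0 <= 1 - t by rewrite subr_ge0.
rewrite -[Y in _ <= Y * _ + _](ger0_norm t1') -[Y in _ <= _ + Y * _](ger0_norm t0).
rewrite -!nrmZ ?LpB//.
apply: le_trans (nrmD p1 (LpZ p1 _ (LpB p1 fp hp)) (LpZ p1 _ (LpB p1 gp hp))).
rewrite le_eqVlt; apply/orP; left; apply/eqP/eq_nrm => x; ring.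
Qed.

Lemma lip_convex f g t x : 0 <= t <= 1 -> B f -> B g ->
  lip d (fun y => (1 - t) * f y + t * g y) x <= (1 - t) * lip d f x + t * lip d g x.
Proof.
move=> /andP[t0 t1] Bf Bg.
have := lip_linear dE (1 - t) t x (BL Bf) (BL Bg).
by rewrite (ger0_norm t0) ger0_norm// subr_ge0.
Qed.

(** Strong convergence of the slopes is what gives access to the first variation
    of the energy, at the limit G. *)
Definition strong_recovery f (f_ : nat -> X -> R) (G : X -> R) :=
  [/\ forall n, B (f_ n), Lp_cvg m p f_ f, forall x, 0 <= G x,
      Lp_cvg m p (fun n => lip d (f_ n)) G &
      cheeger d m p B f = (pint G)%:E].

Lemma strong_recovery_exists f : f \in Lp -> (cheeger d m p B f < +oo)%E ->
  exists (f_ : nat -> X -> R) (G : X -> R), strong_recovery f f_ G.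
Proof.
move=> fp ff; pose E := fine (cheeger d m p B f).
have fE : cheeger d m p B f = E%:E.
  rewrite fineK// fin_numElt ff andbT; apply: (lt_le_trans ltNy0).
  exact: cheeger_ge0.
have /choice[u uP] : forall n : nat, exists u, [/\ B u,
    nrm (fun x => u x - f x) <= n.+1%:R^-1 & energy u < E + n.+1%:R^-1].
  move=> n; have n0 : 0 < n.+1%:R^-1 :> R by rewrite invr_gt0.
  have : (cheeger d m p B f < (E + n.+1%:R^-1)%:E)%E by rewrite fE lte_fin ltrDl.
  move=> /cheeger_approx -/(_ p1 dE BL _ n0)[u [Bu uf ue]].
  by exists u; split=> //; rewrite -lte_fin.
have Bu n : B (u n) by case: (uP n).
have uf : Lp_cvg m p u f by apply: (harmonic_Lp_cvg p1 BL) => // n; case: (uP n).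
pose a n := lip d (u n).
have ap n : (a n : borel X -> R) \in Lp by exact: lipp.
have a0 n x : 0 <= a n x by exact: lip_ge0.
have lsc e : 0 < e -> exists N, forall i j, (N <= i)%N -> (N <= j)%N ->
    E - e <= energy (fun x => (1 - 2^-1) * u i x + 2^-1 * u j x).
  move=> e0; have fE' : (E%:E <= cheeger d m p B f)%E by rewrite fE.
  have [r r0 rP] := cheeger_lsc p1 dE BL fp fE' e0.
  have [N NP] := harmonic_le r0; exists N => i j Ni Nj.
  have h2 : 0 <= (2^-1 : R) <= 1 by apply/andP; split; lra.
  apply: rP; first exact: Bcvx.
  apply: (le_trans (nrm_convex_dist h2 (BLp (Bu i)) (BLp (Bu j)) fp)).
  have [_ ui _] := uP i; have [_ uj _] := uP j.
  have := le_trans ui (NP _ Ni); have := le_trans uj (NP _ Nj).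
  move: (nrm _) (nrm _) => x y; lra.
have half f' : (fun x => (1 - 2^-1) * f' x + 2^-1 * f' x) = f'.
  by apply/funext => x; rewrite -mulrDl subrK mul1r.
have aE : pint (a n) @[n --> \oo] --> E.
  apply/cvgrPdist_le => e e0.
  have [N NP] := lsc _ e0; have [N' NP'] := harmonic_le e0.
  exists (maxn N N') => // n /=; rewrite geq_max => /andP[Nn Nn'].
  have := NP n n Nn Nn; rewrite half => h1.
  have [_ _ h2] := uP n; have := NP' _ Nn'.
  move: h1 h2; rewrite /a ler_norml; move: (pint _) (n.+1%:R^-1) => x y h1 h2 h3.
  by apply/andP; split; lra.
have mid e : 0 < e -> exists N, forall i j, (N <= i)%N -> (N <= j)%N ->
    E - e <= pint (fun x => (a i x + a j x) / 2).
  move=> e0; have [N NP] := lsc e e0; exists N => i j Ni Nj.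
  apply: (le_trans (NP i j Ni Nj)).
  have h2 : 0 <= (2^-1 : R) <= 1 by apply/andP; split; lra.
  have ijp : (fun x => (a i x + a j x) / 2) \in Lp.
    rewrite (_ : (fun x => _) = (fun x => 2^-1 * (a i x + a j x))).
      exact: (LpZ p1 _ (LpD p1 (ap i) (ap j))).
    by apply/funext => x; rewrite mulrC.
  apply: (le_pint p1) => //; first by apply: lipp; exact: Bcvx.
  move=> x; rewrite !ger0_norm ?divr_ge0 ?addr_ge0 ?lip_ge0//.
  have := lip_convex x h2 (Bu i) (Bu j); rewrite -/(a i) -/(a j).
  move: (lip d _ x) (a i x) (a j x) => y z w; lra.
have [G [Gp G0 aG]] := Lp_complete p1 ap a0 (Lp_unif_convex p1 ap a0 aE mid).
exists u, G; split=> //; rewrite fE; congr EFin.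
exact: (cvg_unique _ aE (pint_cvg p1 aG a0 G0)).
Qed.

Section variation.
Variables (f : X -> R) (f_ : nat -> X -> R) (G : X -> R).
Hypothesis rec : strong_recovery f f_ G.

Let fp : f \in Lp. Proof. by case: rec => _ []. Qed.
Let Gp : G \in Lp. Proof. by case: rec => _ _ _ []. Qed.
Let G0 x : 0 <= G x. Proof. by case: rec. Qed.

(** The Euler-Lagrange inequality for the minimiser G, with competitors in B.
    The bound C on the norms makes the second order terms uniform: for a fixed
    small t, (1 - t) f_k + t u belongs to B and is close to f, so its energy is
    almost that of f; expanding it in t leaves t p (<G, c> - <G, G>). *)
Lemma energy_variation C e : 0 <= C -> 0 < e -> exists2 r, 0 < r &
  forall u c, B u -> nrm (fun x => u x - f x) <= r -> c \in Lp ->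
    (forall x, lip d u x <= c x) -> nrm c <= C -> pint G - e <= pairing G c.
Proof.
move=> C0 e0; have [Bf /(Lp_cvgP m p1)[_ _ ff] _ /(Lp_cvgP m p1)[ap _ aG] fE] := rec.
set E := pint G in fE *; have E0 : 0 <= E by exact: pint_ge0.
have S0 : 0 < E + C `^ p + 1 by rewrite ltr_wpDl// addr_ge0// powR_ge0.
pose eta := p * e / (2 * (E + C `^ p + 1)).
have eta0 : 0 < eta by rewrite divr_gt0// mulr_gt0.
have [t /andP[t0 t1] tP] := pint_unif_diff m p1 eta0.
have t01 : 0 <= t <= 1 by rewrite !ltW.
have t1' : 0 <= 1 - t by rewrite subr_ge0 ltW.
pose tol := t * p * e / 4; have tol0 : 0 < tol by rewrite divr_gt0// !mulr_gt0.
have fE' : (E%:E <= cheeger d m p B f)%E by rewrite fE.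
have [r r0 rP] := cheeger_lsc p1 dE BL fp fE' tol0.
pose M := nrm G + 1 + C; have M0 : 0 < M by rewrite ltr_wpDr// ltr_wpDl// nrm_ge0.
have pM0 : 0 < p * M `^ (p - 1) by rewrite mulr_gt0// powR_gt0.
have s0 : 0 < Num.min 1 (tol / (p * M `^ (p - 1))) by rewrite lt_min ltr01 divr_gt0.
move/cvgrPdist_le : ff => /(_ _ r0)[N1 _ N1P].
move/cvgrPdist_le : aG => /(_ _ s0)[N2 _ N2P].
pose k := maxn N1 N2.
have := N1P k (leq_maxl _ _); have := N2P k (leq_maxr _ _) => /=.
rewrite !sub0r !normrN !ger0_norm ?nrm_ge0// le_min ler_pdivlMr// => /andP[aG1 aGt] fk.
exists r => // u c Bu uf cp uc cC.
have c0 x : 0 <= c x by apply: le_trans (uc x); exact: lip_ge0.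
pose a := lip d (f_ k); have {}ap : a \in Lp := ap k.
have a0 x : 0 <= a x by exact: lip_ge0.
pose z x := (1 - t) * G x + t * c x; pose y x := (1 - t) * a x + t * c x.
have zp : z \in Lp by apply: LpD; rewrite ?LpZ.
have yp : y \in Lp by apply: LpD; rewrite ?LpZ.
have z0 x : 0 <= z x by rewrite addr_ge0// mulr_ge0// ltW.
have y0 x : 0 <= y x by rewrite addr_ge0// mulr_ge0// ltW.
have Bv : B (fun x => (1 - t) * f_ k x + t * u x) by exact: Bcvx.
have h1 : E - tol <= pint y.
  apply: le_trans (rP _ Bv _) _.
    apply: (le_trans (nrm_convex_dist t01 (BLp (Bf k)) (BLp Bu) fp)).
    have := ler_wpM2l (ltW t0) uf; have := ler_wpM2l t1' fk.
    move: (nrm _) (nrm _) => ? ?; lra.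
  apply: (le_pint p1) => //; first exact: lipp.
  move=> x; rewrite !ger0_norm ?lip_ge0//.
  apply: (le_trans (lip_convex x t01 (Bf k) Bu)).
  by rewrite lerD2l ler_pM2l.
have nzy : nrm (fun x => z x - y x) <= nrm (fun x => a x - G x).
  rewrite -(nrmBC p1 Gp ap) (_ : nrm (fun x => z x - y x) = (1 - t) * nrm (fun x => G x - a x)).
    by rewrite ler_piMl ?nrm_ge0// lerBlDr lerDl ltW.
  rewrite -{1}(ger0_norm t1') -nrmZ ?LpB//; apply: eq_nrm => x.
  by rewrite /z /y; ring.
have ny : nrm y <= M.
  apply: (le_trans (nrmD p1 (LpZ p1 _ ap) (LpZ p1 _ cp))); rewrite !nrmZ//.
  rewrite (ger0_norm t1') (ger0_norm (ltW t0)).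
  have : nrm a <= nrm G + 1.
    have := nrmD p1 Gp (LpB p1 ap Gp).
    rewrite (_ : nrm (fun x => _ + _) = nrm a); last first.
      by apply: eq_nrm => x; rewrite addrC subrK.
    by move/le_trans; apply; rewrite lerD2l.
  have : (1 - t) * nrm a <= nrm a by rewrite ler_piMl ?nrm_ge0// lerBlDr lerDl ltW.
  have : t * nrm c <= nrm c by rewrite ler_piMl ?nrm_ge0// ltW.
  rewrite /M; move: (nrm a) (nrm c) (nrm G) cC => ? ? ? ?; lra.
have h2 : pint y - pint z <= tol.
  apply: (le_trans (pint_dist p1 yp zp y0 z0)).
  apply: (@le_trans _ _ (p * M `^ (p - 1) * nrm (fun x => a x - G x))).
    rewrite ler_pM ?mulr_ge0 ?powR_ge0 ?nrm_ge0 ?(ltW p0)//.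
    by rewrite ler_pM2l// ge0_ler_powR ?nnegrE ?nrm_ge0 ?(ltW M0)// subr_ge0 ltW.
  by rewrite mulrC.
have h3 := tP G c Gp cp G0 c0.
have h4 : pint c <= C `^ p.
  by rewrite pint_nrm// ge0_ler_powR ?nnegrE ?nrm_ge0// ltW.
have h5 : eta * (E + pint c) <= p * e / 2.
  apply: (@le_trans _ _ (eta * (E + C `^ p + 1))).
    by rewrite ler_pM2l// -addrA lerD2l (le_trans h4)// lerDl.
  rewrite /eta le_eqVlt; apply/orP; left; apply/eqP; field.
  by rewrite gt_eqF.
have : 0 <= t * p * (pairing G c - (E - e)).
  move: h3; rewrite -/E -/z => h3.
  have h6 := ler_wpM2l (ltW t0) h5.
  move: h1 h2 h3 h6; rewrite /tol; move: (pint y) (pint z) (pairing G c) => y' z' P.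
  move: (eta * _) => Q; rewrite -/E; nra.
by rewrite pmulr_rge0 ?mulr_gt0// subr_ge0.
Qed.

(** The inequality passes to weak limits of slopes because it only involves the
    functional G^(p-1), and norms of weakly converging slopes are bounded. *)
Lemma relaxed_gradient_pairing H : relaxed_gradient d m p B f H ->
  pint G <= pairing G H.
Proof.
move=> [Hp [g [H' [Bg /(Lp_cvgP m p1)[_ _ gf] gH H'H]]]].
have [_ H'p gHphi] := gH.
have [C C0 gC] := weak_cvg_bounded p1 (fun n (x : borel X) => lip_ge0 d (g n) x) gH.
apply: le_trans (le_pairing_ae p1 Gp G0 H'p Hp H'H).
apply/ler_addgt0Pr => e e0; have e20 : 0 < e / 2 by rewrite divr_gt0.
have [r r0 rP] := energy_variation C0 e20.
have gHG := gHphi _ (pairing_dual p1 Gp G0).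
move/cvgrPdist_le : gf => /(_ _ r0)[N1 _ N1P].
move/cvgrPdist_le : gHG => /(_ _ e20)[N2 _ N2P].
pose k := maxn N1 N2.
have := N1P k (leq_maxl _ _); have := N2P k (leq_maxr _ _) => /=.
rewrite sub0r normrN (ger0_norm (nrm_ge0 _ _ _)) => h1 h2.
have := rP _ _ (Bg k) h2 (lipp (Bg k)) (fun x => lexx _) (gC k).
move: h1; rewrite ler_norml => /andP[].
move: (pairing _ _) (pairing _ _) (pint _) => x y z; lra.
Qed.

Lemma nrm_le_pint g h : g \in Lp -> h \in Lp ->
  ('N[m]_p%:E[EFin \o (g : borel X -> R)] <= 'N[m]_p%:E[EFin \o (h : borel X -> R)])%E <->
  pint g <= pint h.
Proof.
move=> gp hp; rewrite -!nrmE// lee_fin !pint_nrm//; split=> gh.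
  by rewrite ge0_ler_powR ?nnegrE ?nrm_ge0// ltW.
have := ge0_ler_powR (_ : 0 <= p^-1) _ _ gh.
rewrite invr_ge0 (ltW p0) !nnegrE !powR_ge0 => /(_ isT isT isT).
by rewrite -!powRrM mulfV ?gt_eqF// !powRr1// nrm_ge0.
Qed.

Lemma strong_recovery_minimal : is_minimal_relaxed_gradient d m p B f G.
Proof.
split.
  split; first exact: Gp.
  have [Bf ff _ aG _] := rec; exists f_, G; split=> //; first exact: Lp_cvg_weak.
  exact: aeW.
move=> H HP; have Hp := HP.1; apply/nrm_le_pint => //.
exact: (pint_minimal p1 Gp G0 Hp (relaxed_gradient_pairing HP)).1.
Qed.

Lemma minimal_relaxed_gradient_unique H : is_minimal_relaxed_gradient d m p B f H ->
  H = G %[ae m].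
Proof.
move=> [HP Hmin]; have Hp := HP.1.
apply: (pint_minimal p1 Gp G0 Hp (relaxed_gradient_pairing HP)).2.
by apply/nrm_le_pint => //; apply: Hmin; case: strong_recovery_minimal.
Qed.

Lemma minimal_relaxed_gradientP :
  minimal_relaxed_gradient d m p B f \in Lp /\
  minimal_relaxed_gradient d m p B f = G %[ae m].
Proof.
have h : is_minimal_relaxed_gradient d m p B f (minimal_relaxed_gradient d m p B f).
  exact: (xgetPex (cst 0) (ex_intro _ G strong_recovery_minimal)).
by split; [case: h.1|exact: minimal_relaxed_gradient_unique].
Qed.

End variation.

End recovery_sequences.

(** * Locality, and comparison of the two energies *)

Section locality.
Context {R : realType} {X : ptopologicalType}.
Variables (d : X -> X -> \bar R) (m : {finite_measure set (borel X) -> \bar R}).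
Variables (p : R) (A : set (X -> R)).
Hypotheses (p1 : 1 < p) (dE : extended_distance d) (cA : compatible_algebra d A).
Hypotheses (hX : hausdorff_space X) (cX : compact [set: X]) (mR : inner_radon m).
Implicit Types (f g h u v q G : X -> R) (e c C : R) (K U V : set X).

Local Notation Lp := (Lfun m p%:E).
Local Notation nrm := (nrm m p).
Local Notation pint := (pint m p).
Local Notation pairing := (pairing m p).
Local Notation energy f := (pint (lip d f)).

Let p0 : 0 < p. Proof. by apply: lt_trans p1. Qed.
Let s0 : 0 < p - 1. Proof. by rewrite subr_gt0. Qed.
Let AL f : A f -> Lipb d f. Proof. exact: (algebra_sub cA). Qed.
Let ALp f : A f -> (f : borel X -> R) \in Lp.
Proof. by move=> /AL[fC _]; exact: Cb_Lp. Qed.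

Lemma algebra_convex (t : R) f g : 0 <= t <= 1 -> A f -> A g ->
  A (fun x => (1 - t) * f x + t * g x).
Proof. by move=> _ Af Ag; exact: (alg_lin cA). Qed.

Lemma alg_glue q g h : A q -> A g -> A h -> A (fun x => q x * g x + (1 - q x) * h x).
Proof.
move=> Aq Ag Ah.
have := alg_lin cA 1 1 (alg_mul cA Aq Ag) (alg_mul cA (alg_affine cA 1 (-1) Aq) Ah).
by congr A; apply/funext => x; rewrite !mul1r mulN1r.
Qed.

(** Approximations of f with the same Lipschitz constant have bounded energy. *)
Lemma cheeger_lty f : Lipb d f -> (cheeger d m p A f < +oo)%E.
Proof.
move=> fL; have [L L0 fLL] := Lipb_lip_on dE fL.
have [fC _] := fL; have [M M0 fM] := Cb_bound fC.
apply: (@le_lt_trans _ _ (pint (cst L))%:E); last exact: ltry.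
apply: (cheeger_le p1 dE AL); first exact: Cb_Lp.
move=> e e0; have n0 : 0 < nrm (cst 1) + 1 by rewrite ltr_wpDl// nrm_ge0.
have en0 : 0 < e / (nrm (cst 1) + 1) by rewrite divr_gt0.
have [u [Au uL uf _]] := lattice_approximation dE cA cX fC.1 L0 fLL (ltW M0) fM en0.
exists u; split=> //.
  have mB : measurable_fun setT (fun x : borel X => u x - f x).
    apply: measurable_funB; [exact: (Lp_measurable (ALp Au))|].
    exact: (measurable_continuous fC.1).
  have [_ /le_trans] := Lp_bounded m p1 mB (fun x => uf x I); apply.
  rewrite mulrAC ler_pdivrMr// ler_pM2l// lerDl; exact: ler01.
apply: (@le_trans _ _ (pint (cst L))); last by rewrite lerDl ltW.
apply: (le_pint p1); [exact: (lip_Lp m p1 dE (AL Au))|exact: Lp_cst|].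
move=> x; rewrite !ger0_norm ?lip_ge0 ?(ltW L0)//.
exact: (lip_le dE (@filterT _ _ _) (ltW L0) uL).
Qed.

Section local_bound.
Variables (f : X -> R) (f_ : nat -> X -> R) (G : X -> R) (U : set X) (c : R).
Hypotheses (fL : Lipb d f) (rec : strong_recovery d m p A f f_ G).
Hypotheses (oU : open U) (c0 : 0 < c) (fU : lip_on d c U f).

Let fp : (f : borel X -> R) \in Lp. Proof. by case: rec => _ []. Qed.
Let Gp : (G : borel X -> R) \in Lp. Proof. by case: rec => _ _ _ []. Qed.
Let G0 x : 0 <= G x. Proof. by case: rec. Qed.
Let mG : measurable_fun setT (G : borel X -> R).
Proof. exact: (Lp_measurable Gp). Qed.

(** Variation of the recovery sequence by q g + (1 - q) f_k, where g in A is close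
    to f on K with Lipschitz constant c.  The size r of q and of its slope
    outside K is chosen before q; the quality eta of the approximation g, and
    the index k, depend on q, whose slope on K is not under control. *)
Lemma local_variation e : 0 < e -> exists2 r0, 0 < r0 & forall r q (K : set X) Lq,
  0 < r -> r <= r0 -> A q -> closed K -> K `<=` U -> 0 < Lq ->
  lip_on d Lq setT q -> (forall x, 0 <= q x <= 1) -> lip_on d r (~` K) q ->
  (forall x, ~ K x -> q x <= r) ->
  - e <= pairing G (fun x => q x * (c - G x)).
Proof.
move=> e0; have [fC _] := fL; have [M M0 fM] := Cb_bound fC.
pose n1 := nrm (cst 1); have n10 : 0 <= n1 by exact: nrm_ge0.
pose C := c * n1 + nrm G + 2.
have C0 : 0 <= C by rewrite !addr_ge0 ?mulr_ge0 ?nrm_ge0// ltW.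
have e20 : 0 < e / 2 by rewrite divr_gt0.
have [rv rv0 rvP] := energy_variation p1 dE AL algebra_convex rec C0 e20.
pose S := nrm G `^ (p - 1); have S0 : 0 <= S by exact: powR_ge0.
pose T := Num.min 1 (Num.min rv (e / (4 * (S + 1)))).
have T0 : 0 < T by rewrite !lt_min ltr01 rv0 divr_gt0// mulr_gt0// ltr_wpDl.
have T1 : T <= 1 by rewrite ge_min lexx.
have Trv : T <= rv by rewrite !ge_min lexx orbT.
have TS : S * T <= e / 4.
  have : T <= e / (4 * (S + 1)) by rewrite !ge_min lexx !orbT.
  rewrite ler_pdivlMr ?mulr_gt0 ?ltr_wpDl//; move: T T0 {T1 Trv} => t t0 ?; nra.
have T4 : 0 < T / 4 by rewrite divr_gt0.
have M1 : 0 < 2 * M + 1 by rewrite ltr_wpDl// mulr_ge0// ltW.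
have n11 : 0 < n1 + 1 by rewrite ltr_wpDl.
exists (Num.min 1 (T / 4 / ((2 * M + 1) * (n1 + 1)))).
  by rewrite lt_min ltr01 divr_gt0// mulr_gt0.
move=> r q K Lq r0; rewrite le_min => /andP[r1].
rewrite ler_pdivlMr ?mulr_gt0// => rT Aq cK KU Lq0 qL q01 qK qr.
have Lq1 : 0 < Lq + 1 by rewrite addr_gt0.
have Lq2 : 0 < Lq + 2 by rewrite addr_gt0.
pose eta := Num.min 1 (T / 4 / ((Lq + 1) * (n1 + 1))).
have eta0 : 0 < eta by rewrite lt_min ltr01 divr_gt0// mulr_gt0.
have eta1 : eta <= 1 by rewrite ge_min lexx.
have etaT : eta * ((Lq + 1) * (n1 + 1)) <= T / 4.
  by rewrite -ler_pdivlMr ?mulr_gt0// ge_min lexx orbT.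
have cKc : compact K by exact: (closed_compactT cX).
have fKc : lip_on d c K f by exact: (lip_on_le dE (lexx c) KU fU).
have [g [Ag gL gK gM]] := lattice_approximation dE cA cKc fC.1 c0 fKc (ltW M0) fM eta0.
have [Af /(Lp_cvgP m p1)[_ _ ff] _ /(Lp_cvgP m p1)[ap _ aG] _] := rec.
have TL : 0 < T / 4 / (Lq + 2) by rewrite divr_gt0.
move/cvgrPdist_le : ff => /(_ _ TL)[N1 _ N1P].
move/cvgrPdist_le : aG => /(_ _ T0)[N2 _ N2P].
pose k := maxn N1 N2.
have := N1P k (leq_maxl _ _); have := N2P k (leq_maxr _ _) => /=.
rewrite !sub0r !normrN !ger0_norm ?nrm_ge0// => aT fT0.
have fT : nrm (fun x => f_ k x - f x) * (Lq + 2) <= T / 4 by rewrite -ler_pdivlMr.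
pose w x := `|f_ k x - f x|.
have fkp := LpB p1 (ALp (Af k)) fp.
have [wp wn] : (w : borel X -> R) \in Lp /\ nrm w <= nrm (fun x => f_ k x - f x).
  apply: (Lp_dom p1 _ fkp); last by move=> x; rewrite /w normr_id.
  by apply: measurableT_comp => //; exact: (Lp_measurable fkp).
have w0 x : 0 <= w x by exact: normr_ge0.
pose a := lip d (f_ k); have {}ap : (a : borel X -> R) \in Lp := ap k.
have a0 x : 0 <= a x by exact: lip_ge0.
(* b + (Lq + r) w bounds |g - f_k| lip q: the first summand of b comes from K,
   the second one from its complement *)
pose b := Lq * eta + r * (2 * M + 1).
have b0 : 0 <= b by rewrite addr_ge0// mulr_ge0// ltW.
pose rr x := b + (Lq + r) * w x.
have rrp : (rr : borel X -> R) \in Lp.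
  by apply: (LpD p1); [exact: Lp_cst|exact: LpZ].
have cstE t : nrm (fun=> t) = `|t| * n1.
  by rewrite -nrmZ ?Lp_cst//; apply: eq_nrm => x; rewrite mulr1.
have bT : (eta + b) * n1 <= T / 2.
  have : r * (2 * M + 1) * n1 <= r * ((2 * M + 1) * (n1 + 1)).
    by rewrite -mulrA ler_pM2l// ler_pM2l// lerDl ler01.
  have : (eta + Lq * eta) * n1 <= eta * ((Lq + 1) * (n1 + 1)).
    have -> : eta + Lq * eta = eta * (Lq + 1) by ring.
    by rewrite -mulrA ler_pM2l// ler_pM2l// lerDl ler01.
  by rewrite /b; lra.
have wT : nrm w * (Lq + 2) <= T / 4 by apply: le_trans fT; rewrite ler_pM2r.
have wT1 : nrm w <= T / 4.
  by apply: le_trans wT; rewrite ler_peMr ?nrm_ge0//; lra.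
have rrT : nrm rr <= T.
  apply: (le_trans (nrmD p1 (Lp_cst m p b) (LpZ p1 (Lq + r) wp))).
  rewrite nrmZ// cstE (ger0_norm b0) ger0_norm ?addr_ge0 ?(ltW Lq0) ?(ltW r0)//.
  have : b * n1 <= (eta + b) * n1 by rewrite ler_wpM2r// lerDr ltW.
  have : (Lq + r) * nrm w <= nrm w * (Lq + 2).
    by rewrite mulrC ler_wpM2l ?nrm_ge0// lerD2l; lra.
  move: wT bT; clear -T0; move: (_ * nrm w) (nrm w * _) (b * n1) (_ * n1) => *; lra.
have qm : measurable_fun setT (q : borel X -> R).
  exact: (measurable_continuous (alg_continuous cA Aq)).
have q0 x : 0 <= q x by have /andP[] := q01 x.
have q1 x : 0 <= 1 - q x by have /andP[] := q01 x; rewrite subr_ge0.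
have qle x : q x <= 1 by have /andP[] := q01 x.
have gfM x : `|g x - f x| <= 2 * M + 1.
  rewrite (le_trans (ler_normB _ _))//; have := gM x; have := fM x; lra.
pose u x := q x * g x + (1 - q x) * f_ k x.
have Au : A u by exact: alg_glue.
have uf : nrm (fun x => u x - f x) <= rv.
  have ufw x : `|u x - f x| <= `|(eta + b) + w x|.
    rewrite [leRHS]ger0_norm; last exact: (addr_ge0 (addr_ge0 (ltW eta0) b0) (w0 x)).
    have -> : u x - f x = q x * (g x - f x) + (1 - q x) * (f_ k x - f x).
      by rewrite /u; ring.
    apply: (le_trans (ler_normD _ _)); rewrite !normrM (ger0_norm (q0 x)) (ger0_norm (q1 x)).
    have h1 : (1 - q x) * w x <= w x by rewrite ler_piMl// lerBlDr lerDl.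
    have h2 : q x * `|g x - f x| <= eta + b.
      have [Kx|nKx] := pselect (K x).
        apply: (@le_trans _ _ eta); last by rewrite lerDl.
        by rewrite (le_trans _ (gK x Kx))// ler_piMl.
      have : q x * `|g x - f x| <= r * (2 * M + 1) by rewrite ler_pM// qr.
      have : 0 <= Lq * eta by rewrite mulr_ge0// ltW.
      by rewrite /b; move: (_ * `|_|) => *; lra.
    exact: lerD h2 h1.
  have mu : measurable_fun setT (fun x : borel X => u x - f x).
    exact: (Lp_measurable (LpB p1 (ALp Au) fp)).
  have [_ /le_trans] := Lp_dom p1 mu (LpD p1 (Lp_cst m p (eta + b)) wp) ufw; apply.
  apply: (le_trans (nrmD p1 (Lp_cst m p (eta + b)) wp)).
  rewrite cstE ger0_norm; last exact: (addr_ge0 (ltW eta0) b0).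
  move: bT wT1 Trv; move: (_ * n1) (nrm w) => *; lra.
pose cc x := q x * c + (1 - q x) * a x + rr x.
have rr0 x : 0 <= rr x by rewrite /rr addr_ge0// mulr_ge0// addr_ge0// ltW.
have ucc x : lip d u x <= cc x.
  apply: (le_trans (lip_glue dE x (AL Aq) (AL Ag) (AL (Af k)) q01)).
  rewrite /cc -/(a x) !lerD//.
    by rewrite ler_wpM2l//; exact: (lip_le dE (@filterT _ _ _) (ltW c0) gL).
  have gfk : `|g x - f_ k x| <= `|g x - f x| + w x.
    by rewrite (le_trans (ler_distD (f x) _ _))// lerD2l distrC.
  have e1 : 0 <= Lq * w x by rewrite mulr_ge0// ltW.
  have e2 : 0 <= r * w x by rewrite mulr_ge0// ltW.
  have e3 : 0 <= r * (2 * M + 1) by rewrite mulr_ge0// ltW.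
  have e4 : 0 <= Lq * eta by rewrite mulr_ge0// ltW.
  have [Kx|nKx] := pselect (K x).
    have lq : lip d q x <= Lq by exact: (lip_le dE (@filterT _ _ _) (ltW Lq0) qL).
    have : `|g x - f_ k x| * lip d q x <= (eta + w x) * Lq.
      by rewrite ler_pM ?lip_ge0// (le_trans gfk)// lerD2r gK.
    by rewrite /rr /b; move: (_ * lip d q x) => *; lra.
  have lq : lip d q x <= r.
    apply: (lip_le dE _ (ltW r0) qK); apply: open_nbhs_nbhs; split=> //.
    exact: closed_openC.
  have : `|g x - f_ k x| * lip d q x <= (2 * M + 1 + w x) * r.
    by rewrite ler_pM ?lip_ge0// (le_trans gfk)// lerD2r.
  by rewrite /rr /b; move: (_ * lip d q x) => *; lra.
have qLp (h : X -> R) : (h : borel X -> R) \in Lp ->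
    ((fun x => q x * h x) : borel X -> R) \in Lp /\ nrm (fun x => q x * h x) <= nrm h.
  move=> hp; apply: (Lp_dom p1 _ hp).
    by apply: measurable_funM => //; exact: (Lp_measurable hp).
  by move=> x; rewrite normrM (ger0_norm (q0 x)) ler_piMl.
have q1Lp (h : X -> R) : (h : borel X -> R) \in Lp ->
    ((fun x => (1 - q x) * h x) : borel X -> R) \in Lp /\ nrm (fun x => (1 - q x) * h x) <= nrm h.
  move=> hp; apply: (Lp_dom p1 _ hp).
    apply: measurable_funM; last exact: (Lp_measurable hp).
    exact: measurable_funB.
  by move=> x; rewrite normrM (ger0_norm (q1 x)) ler_piMl// lerBlDr lerDl.
have ccp : (cc : borel X -> R) \in Lp.
  apply: (LpD p1) => //; apply: (LpD p1); last exact: (q1Lp _ ap).1.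
  exact: (qLp (cst c) (Lp_cst m p c)).1.
have ccC : nrm cc <= C.
  apply: (le_trans (nrmD p1 (LpD p1 (qLp (cst c) (Lp_cst m p c)).1 (q1Lp _ ap).1) rrp)).
  have := nrmD p1 (qLp (cst c) (Lp_cst m p c)).1 (q1Lp _ ap).1.
  have := (qLp (cst c) (Lp_cst m p c)).2; rewrite cstE (ger0_norm (ltW c0)).
  have := (q1Lp _ ap).2.
  have : nrm a <= nrm G + T.
    have := nrmD p1 Gp (LpB p1 ap Gp).
    rewrite (_ : nrm (fun x => _ + _) = nrm a); last first.
      by apply: eq_nrm => x; rewrite addrC subrK.
    by move/le_trans; apply; rewrite lerD2l.
  rewrite /C; move: (nrm (fun x => q x * c + _)) (nrm (fun x => (1 - q x) * a x)).
  move: (nrm (fun x => q x * cst c x)) (nrm a) (nrm G) (nrm rr) rrT (c * n1).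
  move=> *; lra.
have := rvP _ _ Au uf ccp ucc ccC.
have cGp : ((fun x => c - G x) : borel X -> R) \in Lp.
  by apply: (LpB p1) => //; exact: (Lp_cst m p c).
have aGp := LpB p1 ap Gp.
have -> : pairing G cc = pint G + pairing G (fun x => q x * (c - G x)) +
    (pairing G (fun x => (1 - q x) * (a x - G x)) + pairing G rr).
  rewrite -(pairing_self m p1 G0) -(pairingD p1 Gp G0 Gp (qLp _ cGp).1).
  rewrite -(pairingD p1 Gp G0 (q1Lp _ aGp).1 rrp).
  rewrite -(pairingD p1 Gp G0 (LpD p1 Gp (qLp _ cGp).1) (LpD p1 (q1Lp _ aGp).1 rrp)).
  by congr (pairing G _); apply/funext => x; rewrite /cc; ring.
have /ler_normlP[_ h1] := pairing_le_nrm p1 Gp G0 (q1Lp _ aGp).1.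
have /ler_normlP[_ h2] := pairing_le_nrm p1 Gp G0 rrp.
have h3 : S * nrm (fun x => (1 - q x) * (a x - G x)) <= S * T.
  by rewrite ler_wpM2l// (le_trans (q1Lp _ aGp).2).
have h4 : S * nrm rr <= S * T by rewrite ler_wpM2l.
move: h1 h2 h3 h4; rewrite -/S.
move: (S * nrm (fun x => (1 - q x) * (a x - G x))) (S * nrm rr) (S * T) TS.
move: (pairing G (fun x => (1 - q x) * (a x - G x))) (pairing G rr).
move: (pairing G (fun x => q x * (c - G x))) (pint G) => *; lra.
Qed.

(** If G > c on a compact K of positive measure inside U, a cutoff q supported
    near K makes the first variation negative: outside K the integrand
    q G^(p-1) (c - G) is positive only where G < c, where it is at most q c^p;
    there, q is small except on a set W of small measure. *)
Lemma minimal_le_local_lip : m (U `&` [set x | c < G x]) = 0%E.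
Proof.
set D := U `&` [set x | c < G x].
have mD : measurable (D : set (borel X)).
  apply: measurableI; first exact: sub_sigma_algebra.
  rewrite (_ : [set x | c < G x] = setT `&` G @^-1` `]c, +oo[%classic).
    exact: mG.
  by rewrite setTI; apply/seteqP; split=> x /=; rewrite in_itv/= andbT.
apply/eqP; apply: contrapT => /negP D0.
have mfin E : measurable (E : set (borel X)) -> m E \is a fin_num by exact: fin_num_measure.
have : (0 < m D)%E by rewrite lt_neqAle eq_sym D0 measure_ge0.
rewrite (mR mD) => /ereal_sup_gt[_ [K [cK KD] <-] mK0].
have mK : measurable (K : set (borel X)).
  rewrite -[K]setCK; apply: measurableC; apply: sub_sigma_algebra.
  exact/closed_openC/(compact_closed hX).
(* beta is the gain on K that the error terms cannot compensate *)
pose k x : R := \1_K x * (G x - c).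
have k0 x : 0 <= k x.
  rewrite /k indicE; case: (boolP (x \in K)) => [|_]; last by rewrite mul0r.
  by rewrite inE mul1r subr_ge0 => /KD[_ /ltW].
have Gcp : ((fun x => G x - c) : borel X -> R) \in Lp.
  by apply: (LpB p1) => //; exact: (Lp_cst m p c).
have kp : (k : borel X -> R) \in Lp.
  have mk : measurable_fun setT (k : borel X -> R).
    apply: measurable_funM; last exact: (Lp_measurable Gcp).
    exact: measurable_indic.
  apply: (Lp_dom p1 mk Gcp _).1 => x; rewrite normrM ler_piMl// indicE.
  by case: (x \in K); rewrite ?normr1 ?normr0.
pose beta := pairing G k.
have beta0 : 0 < beta.
  rewrite lt_neqAle pairing_ge0// andbT eq_sym; apply: contraTN mK0 => /eqP b0.
  have iGk := integrable_pairing p1 Gp G0 kp.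
  pose F (x : borel X) := G x `^ (p - 1) * k x.
  have mGk : measurable_fun setT (EFin \o F) by case/integrableP : iGk.
  have : (\int[m]_x `|(EFin \o F) x|)%E = 0%E.
    have F0 x : 0 <= F x by rewrite mulr_ge0// powR_ge0.
    under eq_integral => x _ do rewrite gee0_abs ?lee_fin ?F0//.
    by rewrite -(fineK (integrable_fin_num _ iGk))// -[fine _]/beta b0.
  move/(ae_eq_integral_abs m measurableT mGk) => [N [mN N0 NP]].
  rewrite -leNgt -N0; apply: le_measure; rewrite ?inE//.
  move=> x Kx; apply: NP => /= /(_ I)[] /eqP.
  have [_ /= cG] := KD x Kx.
  rewrite /F /k indicE mem_set// mul1r mulf_eq0 subr_eq0 (gt_eqF cG) orbF.
  by rewrite powR_eq0 (gt_eqF (lt_trans c0 cG)).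
pose mT := fine (m setT).
have mT0 : 0 <= mT by rewrite fine_ge0// measure_ge0.
have cp0 : 0 < c `^ p by rewrite powR_gt0.
have be8 : 0 < beta / 8 by rewrite divr_gt0.
have [r0 r00 r0P] := local_variation be8.
pose B1 := beta / 8 / (c `^ p * (1 + mT)).
have cm0 : 0 < c `^ p * (1 + mT) by rewrite mulr_gt0// ltr_pwDl.
pose r := Num.min r0 (Num.min (1 / 2) B1).
have rp : 0 < r by rewrite !lt_min r00 !divr_gt0.
have rr0 : r <= r0 by rewrite ge_min lexx.
have r2 : r <= 1 / 2 by rewrite !ge_min lexx orbT.
have rB : r * (c `^ p * (1 + mT)) <= beta / 8.
  by rewrite -ler_pdivlMr// !ge_min lexx !orbT.
(* outer approximation of D by the open set V, from inner regularity *)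
have mDc : measurable (~` D : set (borel X)) by exact: measurableC.
have [C [cC CD] mC] : exists2 C, compact C /\ C `<=` ~` D & (m (~` D) - r%:E < m C)%E.
  have : (m (~` D) - r%:E < m (~` D))%E by rewrite lteBlDr ?mfin// lteDl ?mfin// lte_fin.
  by rewrite {2}(mR mDc) => /ereal_sup_gt[_ [C CP <-]] ?; exists C.
have cC' : closed C by exact: compact_closed.
have mCb : measurable (C : set (borel X)).
  by rewrite -[C]setCK; apply: measurableC; apply: sub_sigma_algebra; exact: closed_openC.
pose V := U `&` ~` C.
have oV : open V by apply: openI => //; exact: closed_openC.
have KV : K `<=` V by move=> x Kx; split; [exact: (KD x Kx).1|move/CD; apply; exact: KD].
pose W := V `\` D.
have mV : measurable (V : set (borel X)) by exact: sub_sigma_algebra.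
have mW : measurable (W : set (borel X)) by exact: measurableD.
have mWr : fine (m W) <= r.
  have : (m W <= m (~` D `\` C))%E.
    apply: le_measure; rewrite ?inE//; first exact: measurableD.
    by move=> x [[_ nC] nD].
  rewrite [Y in (_ <= Y)%E]measureD//; last by rewrite ltey_eq mfin.
  have -> : (~` D `&` C : set (borel X)) = C by exact: setIidr.
  move=> h.
  have : fine (m W) <= fine (m (~` D)) - fine (m C).
    by rewrite -lee_fin EFinB !fineK ?mfin.
  have : fine (m (~` D)) - r < fine (m C) by rewrite -lte_fin EFinB !fineK ?mfin.
  by move: (fine _) (fine _) (fine _) => *; lra.
clear mC; have [q [L [Lq [Aq [cL LV] [Lq0 qL] [q01 qK] [qL2 qr]]]]] :=
  alg_cutoff_exists dE cA hX cX cK oV KV rp.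
have LU : L `<=` U by move=> x /LV[].
have low := r0P r q L Lq rp rr0 Aq cL LU Lq0 qL q01 qL2 qr.
have qm : measurable_fun setT (q : borel X -> R).
  exact: (measurable_continuous (alg_continuous cA Aq)).
pose h x := q x * (c - G x).
have hp : (h : borel X -> R) \in Lp.
  have mh : measurable_fun setT (h : borel X -> R).
    by apply: measurable_funM => //; exact: measurable_funB.
  apply: (Lp_dom p1 mh Gcp _).1 => x; have /andP[q0 q1] := q01 x.
  by rewrite normrM (ger0_norm q0) distrC ler_piMl.
have hk : pairing G h + (1 - r) * beta <= c `^ p * (fine (m W) + r * mT).
  rewrite -(pairingZ p1 _ Gp G0 kp) -(pairingD p1 Gp G0 hp (LpZ p1 _ kp)).
  have mind (E : set (borel X)) : measurable E -> m.-integrable setT (EFin \o (\1_E : _ -> R)).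
    by move=> mE; exact: integrable_indic.
  have -> : c `^ p * (fine (m W) + r * mT) =
      \int[m]_x (c `^ p * (\1_(W : set (borel X)) x + r * \1_(setT : set (borel X)) x)).
    have iT := integrableZl measurableT r (mind _ measurableT).
    have iW := mind _ mW.
    rewrite RintegralZl//; last exact: (integrableD measurableT iW iT).
    rewrite RintegralD// RintegralZl//; last exact: mind.
    by rewrite /Rintegral !integral_indic// !setIT.
  apply: le_Rintegral => //.
  - exact: (integrable_pairing p1 Gp G0 (LpD p1 hp (LpZ p1 _ kp))).
  - have iT := integrableZl measurableT r (mind _ measurableT).
    exact: (integrableZl measurableT (c `^ p) (integrableD measurableT (mind _ mW) iT)).
  move=> x _; rewrite indicT mulr1 /h.
  have /andP[q0 q1] := q01 x; have Gs0 : 0 <= G x `^ (p - 1) by exact: powR_ge0.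
  have rhs0 : 0 <= c `^ p * (\1_W x + r).
    by rewrite mulr_ge0 ?addr_ge0 ?(ltW cp0) ?(ltW rp)//.
  have r1 : 0 <= 1 - r by lra.
  have [cG|Gc] := ltP c (G x).
    apply: le_trans rhs0; rewrite mulr_ge0_le0//.
    rewrite /k indicE; have [xK|xK] := boolP (x \in K).
      by have := qK x (set_mem xK); rewrite mul1r; nra.
    by rewrite mul0r mulr0 addr0 mulr_ge0_le0// subr_le0 ltW.
  have xK : x \notin K by apply/negP; rewrite inE => /KD[_ /=]; rewrite ltNge Gc.
  rewrite /k indicE (negbTE xK) mul0r mulr0 addr0.
  have cGc : G x `^ (p - 1) * (c - G x) <= c `^ p.
    rewrite -(mulr_powRB1 (ltW c0) p0) mulrC ler_pM ?subr_ge0//; last first.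
      by rewrite ge0_ler_powR ?nnegrE ?(ltW c0)// ltW.
    by rewrite lerBlDr lerDl.
  have cG0 : 0 <= G x `^ (p - 1) * (c - G x) by rewrite mulr_ge0 ?subr_ge0.
  rewrite mulrCA mulrC; apply: ler_pM => //.
  have [xW|xW] := boolP (x \in W); first by rewrite indicE xW (le_trans q1)// lerDl ltW.
  rewrite indicE (negbTE xW) add0r; apply: qr => /LV Vx.
  by case/negP: xW; rewrite inE; split=> // -[_ /=]; rewrite ltNge Gc.
suff : beta <= 0 by rewrite leNgt beta0.
have : c `^ p * (fine (m W) + r * mT) <= beta / 8.
  apply: le_trans rB; rewrite mulrCA ler_pM2l// mulrDr mulr1 lerD2r//.
have : (1 / 2) * beta <= (1 - r) * beta by rewrite ler_pM2r//; lra.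
move: hk low; rewrite -/h; move: (pairing G h) (_ * (fine _ + _)) ((1 - r) * _) => *; lra.
Qed.

End local_bound.

(** The set where lip f < s < G is null for each s: a compact subset of it is
    covered by finitely many open sets on which f is s-Lipschitz.  Rational
    values of s suffice. *)
Lemma minimal_le_lip f (f_ : nat -> X -> R) G : Lipb d f -> strong_recovery d m p A f f_ G ->
  {ae m, forall x, G x <= lip d f x}.
Proof.
move=> fL rec.
have Gp : (G : borel X -> R) \in Lp by case: rec => _ _ _ [].
have mG := Lp_measurable Gp.
pose N (s : R) := [set x | lip d f x < s] `&` [set x | s < G x].
have mgt (s : R) : measurable ([set x | s < G x] : set (borel X)).
  rewrite (_ : [set x | s < G x] = setT `&` G @^-1` `]s, +oo[%classic).
    exact: mG.
  by rewrite setTI; apply/seteqP; split=> x /=; rewrite in_itv/= andbT.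
have N0 s : m (N s) = 0%E.
  have mN : measurable (N s : set (borel X)).
    apply: measurableI => //; apply: sub_sigma_algebra; exact: (open_lip_lt dE).
  apply/eqP; apply: contrapT => /negP ND.
  have : (0 < m (N s))%E by rewrite lt_neqAle eq_sym ND measure_ge0.
  rewrite (mR mN) => /ereal_sup_gt[_ [K [cK KN] <-]]; apply/negP; rewrite -leNgt.
  have [[x Kx]|K0] := pselect (K !=set0); last first.
    by rewrite (_ : K = set0) ?measure0//; apply/seteqP; split=> // x Kx; apply: K0; exists x.
  have s0' : 0 < s by apply: le_lt_trans (lip_ge0 d f x) (KN x Kx).1.
  have /choice[U UP] : forall y, exists U, K y -> [/\ open U, U y & lip_on d s U f].
    move=> y; have [/KN[fy _]|nKy] := pselect (K y); last by exists set0.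
    have [U yU fU] := lip_lt dE fL fy; exists U^° => _; split.
    - exact: open_interior.
    - exact: yU.
    - by apply: lip_on_le fU => //; exact: interior_subset.
  have UP' y : K y -> open (U y) /\ U y y by move=> /UP[].
  have [s' s'K s'U] := compact_subcover cK UP'.
  have mK : measurable (K : set (borel X)).
    rewrite -[K]setCK; apply: measurableC; apply: sub_sigma_algebra.
    exact/closed_openC/(compact_closed hX).
  have neg : m.-negligible [set z | exists2 y, y \in s' & (U y `&` [set x | s < G x]) z].
    elim: s' s'K {s'U} => [|y s' ih] s'K.
      by apply: (negligibleS _ (negligible_set0 m)) => z [].
    have [oU Uy fU] := UP y (s'K y (mem_head _ _)).
    have neg1 : m.-negligible (U y `&` [set x | s < G x]).
      apply/negligibleP; first by apply: measurableI => //; exact: sub_sigma_algebra.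
      exact: (minimal_le_local_lip fL rec oU s0' fU).
    have neg2 : m.-negligible [set z | exists2 y, y \in s' & (U y `&` [set x | s < G x]) z].
      by apply: ih => w ws; apply: s'K; rewrite inE ws orbT.
    apply: (negligibleS _ (negligibleU neg1 neg2)) => z [w].
    by rewrite inE => /orP[/eqP ->|ws]; [left|right; exists w].
  have KU : K `<=` [set z | exists2 y, y \in s' & (U y `&` [set x | s < G x]) z].
    move=> z Kz; have [y ys Uz] := s'U z Kz.
    by exists y => //; split=> //; exact: (KN z Kz).2.
  have nK : m.-negligible (K : set (borel X)).
    by apply: negligibleS neg; exact: KU.
  by have -> : m K = 0%E by apply/negligibleP.
pose F (i : nat) := if unpickle i is Some s then N (ratr (s : rat)) else set0.
have : m.-negligible (\bigcup_i F i).
  apply: negligible_bigcup => i; rewrite /F; case: unpickle => [s|]; last exact: negligible_set0.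
  apply/negligibleP; last exact: N0.
  by apply: measurableI => //; apply: sub_sigma_algebra; exact: (open_lip_lt dE).
apply: negligibleS => x /= /negP; rewrite -ltNge => /rat_in_itvoo[s].
rewrite in_itv/= => /andP[fs sG]; exists (pickle s); first exact: I.
by rewrite /F pickleK.
Qed.

Lemma cheeger_le_energy f : Lipb d f -> (cheeger d m p A f <= (energy f)%:E)%E.
Proof.
move=> fL; have [fC _] := fL; have fp := Cb_Lp m p1 fC.
have [f_ [G rec]] := strong_recovery_exists p1 dE AL algebra_convex fp (cheeger_lty fL).
have ae := minimal_le_lip fL rec; have [_ _ G0 [_ Gp _] ->] := rec.
have mG := Lp_measurable Gp; have mf := measurable_lip dE fL.
rewrite -[leLHS](pintE p1 Gp) -[leRHS](pintE p1 (lip_Lp m p1 dE fL)).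
apply: ae_ge0_le_integral => //.
- exact/measurable_EFinP/measurable_pow.
- exact/measurable_EFinP/measurable_pow.
apply: (@filterS _ _ (ae_filter_ringOfSetsType m) _ _ _ ae) => x Gf _.
by rewrite lee_fin !ger0_norm ?lip_ge0// ge0_ler_powR ?nnegrE ?lip_ge0// ltW.
Qed.

Lemma cheeger_compatible_algebra f : f \in Lp ->
  cheeger d m p (Lipb d) f = cheeger d m p A f.
Proof.
move=> fp; apply/eqP; rewrite eq_le; apply/andP; split.
  apply: ereal_inf_le_tmp => _ [u [Au uf] <-]; exists u => //; split=> // n.
  exact: AL.
have [->|] := eqVneq (cheeger d m p (Lipb d) f) +oo%E; first exact: leey.
rewrite -ltey => fy; pose E := fine (cheeger d m p (Lipb d) f).
have fE : cheeger d m p (Lipb d) f = E%:E.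
  rewrite fineK// fin_numElt fy andbT; apply: (lt_le_trans ltNy0).
  exact: cheeger_ge0.
rewrite fE; apply: (cheeger_le p1 dE AL fp) => e e0.
have e20 : 0 < e / 2 by rewrite divr_gt0.
have : (cheeger d m p (Lipb d) f < (E + e)%:E)%E by rewrite fE lte_fin ltrDl.
move=> /cheeger_approx -/(_ p1 dE (fun _ => id) _ e20)[v [vL vf ve]].
have /cheeger_approx -/(_ p1 dE AL _ e20)[u [Au uv ue]] :=
  le_lt_trans (cheeger_le_energy vL) ve.
have vp := Cb_Lp m p1 vL.1.
exists u; split; [exact: Au| |by move: ue; rewrite lte_fin => /ltW].
apply: (le_trans (nrm_dist p1 (ALp Au) vp fp)).
by rewrite [leRHS]splitr; exact: lerD uv vf.
Qed.

End locality.

Theorem theorem6p7 (R : realType) (X : ptopologicalType)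
    (d : X -> X -> \bar R) (m : {finite_measure set (borel X) -> \bar R})
    (p : R) (A : set (X -> R)) :
  1 < p ->
  emtm_space d m ->
  compact [set: X] ->
  compatible_algebra d A ->
  [/\ H1 d m p (Lipb d) = H1 d m p A,
      (forall f, H1 d m p (Lipb d) f ->
         minimal_relaxed_gradient d m p (Lipb d) f =
         minimal_relaxed_gradient d m p A f %[ae m]),
      (forall f, f \in Lfun m p%:E ->
         cheeger d m p (Lipb d) f = cheeger d m p A f) &
      (forall f, H1 d m p (Lipb d) f ->
         exists f_ : nat -> X -> R,
           [/\ forall n, A (f_ n),
               Lp_cvg m p f_ f &
               Lp_cvg m p (fun n => lip d (f_ n))
                 (minimal_relaxed_gradient d m p (Lipb d) f)])].
Proof.
move=> p1 [[hX dE _ _] mR] cX cA.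
have AL f : A f -> Lipb d f by exact: (algebra_sub cA).
have cheegerE f := cheeger_compatible_algebra p1 dE cA hX cX mR (f := f).
have recovery f : H1 d m p (Lipb d) f -> exists (f_ : nat -> X -> R) (G : X -> R),
    strong_recovery d m p A f f_ G /\ strong_recovery d m p (Lipb d) f f_ G.
  move=> [fp]; rewrite cheegerE// => fy.
  have [f_ [G rec]] := strong_recovery_exists p1 dE AL (algebra_convex cA) fp fy.
  exists f_, G; split=> //; have [Af ff G0 aG fE] := rec; split=> //.
    by move=> n; exact: AL.
  by rewrite cheegerE.
have minA f f_ G := @minimal_relaxed_gradientP R X d m p A p1 dE AL (algebra_convex cA) f f_ G.
have minL f f_ G :=
  @minimal_relaxed_gradientP R X d m p (Lipb d) p1 dE (fun _ => id) (Lipb_convex dE) f f_ G.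
split.
- by apply/seteqP; split=> f [fp fy]; split; rewrite // ?cheegerE// -cheegerE.
- move=> f /recovery[f_ [G [/minA[_ GA] /minL[_ GL]]]].
  apply: (@filterS2 _ _ (ae_filter_ringOfSetsType m) _ _ _ _ GA GL) => x GAx GLx xT.
  by rewrite GAx// GLx.
- exact: cheegerE.
- move=> f /recovery[f_ [G [rec /minL[Gp GL]]]]; have [Af ff _ aG _] := rec.
  by exists f_; split=> //; exact: (Lp_cvg_ae p1 Gp GL aG).
Qed.
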